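(* Let $I\subset\mathbb{R}$ be an open interval containing $0$, let $a>0$, and let $b,c:I\to(0,\infty)$ be smooth functions. Put $$A_1(\lambda)=A_3(\lambda)=\begin{bmatrix}-a & b(\lambda)\\ -c(\lambda) & -a\end{bmatrix},\qquad A_2(\lambda)=A_4(\lambda)=\begin{bmatrix}-a & c(\lambda)\\ -b(\lambda) & -a\end{bmatrix},$$ and for $i=1,2,3,4$ let $f_i(x,\lambda)=A_i(\lambda)x+\bar f_i(x,\lambda)$ for $(x,\lambda)\in\mathbb{R}^2\times I$, where $\bar f_i:\mathbb{R}^2\times I\to\mathbb{R}^2$ is analytic and $\bar f_i(x,\lambda)=o(\|x\|)$ as $x\to 0$. Consider the switched system $$\dot x=f_i(x,\lambda)\quad\text{for } x\in S_i,\qquad i=1,2,3,4,$$ with the regions $S_1,\dots,S_4$ given in the context. Define $$\Delta(\lambda)=\left(\frac{b(\lambda)}{c(\lambda)}\right)^2 e^{-\frac{a}{\sqrt{b(\lambda)c(\lambda)}}\cdot 2\pi},\qquad \lambda\in I,$$ and suppose that $\Delta(0)=1$ and $\left.\frac{d\Delta(\lambda)}{d\lambda}\right|_{\lambda=0}\neq 0$. Let $\pi(x_1,\lambda)$ be the Poincaré map of the switched system on the half-line $R^+=\{(x_1,0):x_1\ge 0\}$ (see context), and suppose it is written, in a neighborhood of $(x_1,\lambda)=(0,0)$, as $$\pi(x_1,\lambda)=\Delta(\lambda)x_1+\delta(\lambda)x_1^k+o(x_1^k),\qquad \delta(0)\neq 0,\quad k>1 .$$ Then: 1) If $\left.\delta(\lambda)\frac{d\Delta(\lambda)}{d\lambda}\right|_{\lambda=0}<0$,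 then there exist $\bar\lambda>0$ and a continuous function $x_1:[0,\bar\lambda)\to[0,\infty)$ with $x_1(0)=0$ such that for each $\lambda\in(0,\bar\lambda)$ one has $x_1(\lambda)>0$ and the switched system with parameter $\lambda$ has a nontrivial periodic orbit passing through $(x_1(\lambda),0)$. 2) If $\left.\delta(\lambda)\frac{d\Delta(\lambda)}{d\lambda}\right|_{\lambda=0}>0$, then there exist $\hat\lambda>0$ and a continuous function $x_1:(-\hat\lambda,0]\to[0,\infty)$ with $x_1(0)=0$ such that for each $\lambda\in(-\hat\lambda,0)$ one has $x_1(\lambda)>0$ and the switched system with parameter $\lambda$ has a nontrivial periodic orbit passing through $(x_1(\lambda),0)$.
   Context: Write $x=(x_1,x_2)^T\in\mathbb{R}^2$. The regions are $S_1=\{0<x_1<\infty,\ x_2\ge 0\}$, $S_2=\{-\infty<x_1\le 0,\ x_2>0\}$, $S_3=\{-\infty<x_1<0,\ x_2\le 0\}$, $S_4=\{0\le x_1<\infty,\ x_2<0\}$, so that $\mathbb{R}^2=S_1\cup S_2\cup S_3\cup S_4\cup\{(0,0)\}$. The origin is an equilibrium. A solution is a continuous curve $x(t)$ which follows the vector field $f_i(\cdot,\lambda)$ while $x(t)\in S_i$, the switching from one subsystem to another taking place when $x(t)$ crosses a half coordinate axis (so the differential equation holds except possibly at the isolated crossing times). Poincaré map: near the origin, orbits turn clockwise around the origin. For $x_1>0$ small and $\lambda$ near $0$, the solution starting at $(x_1,0)$ crosses successively the negative $x_2$-half-axis (following $f_4$), the negative $x_1$-half-axis (following $f_3$), the positive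 $x_2$-half-axis (following $f_2$) and returns to the positive $x_1$-half-axis (following $f_1$) at a point $(\pi(x_1,\lambda),0)$; one sets $\pi(0,\lambda)=0$. The half-line $R^+$ is identified with $[0,\infty)$ via $(x_1,0)\leftrightarrow x_1$. A nontrivial periodic orbit is one different from the equilibrium at the origin. *)

(* Defs.v *)
(* Real analysis on Stdlib's [R] with Coquelicot; the plane is the product
   [R * R], with Coquelicot's product topology and Euclidean norm. *)
From Stdlib Require Export Reals.
From Coquelicot Require Export Coquelicot.
#[global] Open Scope R_scope.

Definition plane : Type := (R * R)%type.

Definition origin : plane := (0, 0).

(* The open interval ]l, u[, possibly unbounded. *)
Definition open_interval (l u : Rbar) (lam : R) : Prop :=
  Rbar_lt l lam /\ Rbar_lt lam u.

Definition smooth_on (I : R -> Prop) (g : R -> R) : Prop :=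
  forall (n : nat) (lam : R), I lam -> ex_derive_n g n lam.

(* Homogeneous part of degree n of the formal power series in three variables
   with coefficients c, evaluated at (y1, y2, y3):
   the sum of c_{ijm} y1^i y2^j y3^m over i + j + m = n. *)
Definition homogeneous_part (c : nat -> nat -> nat -> R) (n : nat)
    (y1 y2 y3 : R) : R :=
  sum_n (fun i => sum_n (fun j =>
    c i j (n - i - j)%nat * y1 ^ i * y2 ^ j * y3 ^ (n - i - j)) (n - i)) n.

(* Real analyticity in the three variables (x_1, x_2, lambda) jointly: around
   the point, g is the sum of an absolutely convergent power series. *)
Definition analytic_at (g : plane -> R -> R) (x : plane) (lam : R) : Prop :=
  exists (r : R) (c : nat -> nat -> nat -> R),
    0 < r /\
    ex_series (fun n => homogeneous_part (fun i j m => Rabs (c i j m)) n r r r) /\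
    forall y1 y2 y3 : R,
      Rabs y1 < r -> Rabs y2 < r -> Rabs y3 < r ->
      is_series (fun n => homogeneous_part c n y1 y2 y3)
        (g (fst x + y1, snd x + y2) (lam + y3)).

Definition analytic_field_on (I : R -> Prop) (g : plane -> R -> plane) : Prop :=
  forall (x : plane) (lam : R), I lam ->
    analytic_at (fun y mu => fst (g y mu)) x lam /\
    analytic_at (fun y mu => snd (g y mu)) x lam.

Inductive mode : Type := M1 | M2 | M3 | M4.

Definition region (i : mode) (x : plane) : Prop :=
  match i with
  | M1 => 0 < fst x /\ 0 <= snd x
  | M2 => fst x <= 0 /\ 0 < snd x
  | M3 => fst x < 0 /\ snd x <= 0
  | M4 => 0 <= fst x /\ snd x < 0
  end.

Definition on_half_axis (x : plane) : Prop :=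
  x <> origin /\ (fst x = 0 \/ snd x = 0).

(* 2 x 2 matrices, given by their two rows. *)
Definition mat2 : Type := ((R * R) * (R * R))%type.

Definition mat2_apply (A : mat2) (x : plane) : plane :=
  (fst (fst A) * fst x + snd (fst A) * snd x,
   fst (snd A) * fst x + snd (snd A) * snd x).

Definition A_mat (a : R) (b c : R -> R) (i : mode) (lam : R) : mat2 :=
  match i with
  | M1 | M3 => ((- a, b lam), (- c lam, - a))
  | M2 | M4 => ((- a, c lam), (- b lam, - a))
  end.

Definition subsystem (a : R) (b c : R -> R) (fbar : mode -> plane -> R -> plane)
    (i : mode) (x : plane) (lam : R) : plane :=
  plus (mat2_apply (A_mat a b c i lam) x) (fbar i x lam).

Definition Delta (a : R) (b c : R -> R) (lam : R) : R :=
  (b lam / c lam) ^ 2 * exp (- (a / sqrt (b lam * c lam)) * (2 * PI)).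

(* x is a solution, on the time set J, of the switched system with subsystems
   f and parameter lam.  D is the set of switching times: at such a time x is
   on a half-axis, and D does not accumulate in J.  Inside J and away from D
   the curve satisfies the differential equation of the region it is in, the
   origin (which belongs to no region) being an equilibrium. *)
Definition solution (f : mode -> plane -> R -> plane) (lam : R)
    (J : R -> Prop) (x : R -> plane) : Prop :=
  continuous_on J x /\
  exists D : R -> Prop,
    (forall t, J t -> D t -> on_half_axis (x t)) /\
    (forall t, J t -> locally' t (fun s => ~ D s)) /\
    (forall t, locally t J -> ~ D t ->
       (forall i : mode, region i (x t) -> is_derive x t (f i (x t) lam)) /\
       (x t = origin -> is_derive x t zero)).

(* Between the times s and t the curve is in region i, off the half-axes. *)
Definition travels_in (i : mode) (x : R -> plane) (s t : R) : Prop :=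
  forall tau, s < tau < t -> region i (x tau) /\ ~ on_half_axis (x tau).

(* The solution starting at (p, 0) turns once, clockwise, around the origin
   and comes back to the positive x_1-half-axis at (q, 0). *)
Definition first_return (f : mode -> plane -> R -> plane) (lam p q : R) : Prop :=
  exists (x : R -> plane) (t1 t2 t3 t4 : R),
    0 < t1 /\ t1 < t2 /\ t2 < t3 /\ t3 < t4 /\
    solution f lam (fun t => 0 <= t <= t4) x /\
    x 0 = (p, 0) /\
    travels_in M4 x 0 t1 /\ (fst (x t1) = 0 /\ snd (x t1) < 0) /\
    travels_in M3 x t1 t2 /\ (fst (x t2) < 0 /\ snd (x t2) = 0) /\
    travels_in M2 x t2 t3 /\ (fst (x t3) = 0 /\ 0 < snd (x t3)) /\
    travels_in M1 x t3 t4 /\ (x t4 = (q, 0) /\ 0 < q).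

(* pi is the Poincare map on the half-line x_1 >= 0, which is only determined
   for x_1 >= 0 small and lambda near 0. *)
Definition is_poincare_map (f : mode -> plane -> R -> plane) (I : R -> Prop)
    (pi : R -> R -> R) : Prop :=
  exists eta : R, 0 < eta /\
    forall lam, I lam -> Rabs lam < eta ->
      pi 0 lam = 0 /\
      forall x1, 0 < x1 < eta -> first_return f lam x1 (pi x1 lam).

Definition periodic_orbit (f : mode -> plane -> R -> plane) (lam : R)
    (gamma : plane -> Prop) : Prop :=
  exists (x : R -> plane) (T : R),
    0 < T /\
    solution f lam (fun _ => True) x /\
    (forall t, x (t + T) = x t) /\
    (forall p, gamma p <-> exists t, x t = p).

Definition nontrivial_periodic_orbit (f : mode -> plane -> R -> plane)
    (lam : R) (gamma : plane -> Prop) : Prop :=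
  periodic_orbit f lam gamma /\ ~ (forall p, gamma p <-> p = origin).

(* Main.v *)
Require Import Defs.
From Stdlib Require Import Lra Lia ClassicalEpsilon.

(** In each quadrant write a point as [rho (1 - u, u)] up to signs, with
    [rho = |x_1| + |x_2|].  The orbits then satisfy [rho' = rho G(lam, u, rho)]
    for [u] in [0, 1], where [G] has Taylor expansions of every order at
    [rho = 0], with remainders controlled uniformly in the parameters.  If [rho]
    starts from [x om(lam, x)] and [w0] solves the equation linearised at
    [rho = 0], then [zeta = rho / (x om w0)] satisfies
    [zeta = 1 + x om int w0 zeta^2 G_1(rho)], where [G = G_0 + rho G_1]: an
    expansion of [zeta] of order [m] yields one of order [m + 1], with no need to
    differentiate solutions with respect to their initial value.  After four
    quadrants [pi(x, lam) / x] has expansions of every order as well, and by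
    uniqueness of the coefficients
    [pi(x, lam) = x (Delta(lam) + x^(k-1) (q(lam) + x psi(lam, x)))] with
    [q(0) = delta(0)] and [psi] bounded and Lipschitz enough to make
    [x^(k-1) (q + x psi)] strictly monotone in [x].  So the fixed points form a
    graph over [lam], Hoelder continuous in [lam]; a fixed point of [pi] closes
    up to a periodic solution. *)

(** * Taylor expansions with uniform remainders *)

(** The assumed expansion of [pi] has a remainder that is only o(x^k), and [delta] carries no
    regularity. This is enough to locate fixed points, but not to make pi(x, lam) / x monotone in x,
    so a fixed point picked for each lam need not depend continuously on lam. The missing regularity
    has to be extracted from the vector fields. The functions that occur are quotients by x, and
    their dependence on x may degenerate at x = 0. A Lipschitz constant of order 1/x is what
    survives such a division, and it still suffices at the end: the increment of x^k psi between y <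
    x is then of order x^(k-1) (x - y), which for small x is dominated by the increment of q
    x^(k-1), of order x^(k-2) (x - y). In lam only Lipschitz continuity is tracked. A fixed point
    then behaves like the (k-1)-th root of a Lipschitz function, whence the exponent 1/(k-1). *)

Definition dom (r lam x : R) : Prop := Rabs lam < r /\ 0 < x < r.

(* At a fixed [x] the remainders are to be Lipschitz in the parameters [lam], [u];
   in [x] the Lipschitz constant is only required to be [O(1/x)]. *)
Definition gap (lam u x mu v y : R) : R :=
  Rabs (x - y) + x * (Rabs (lam - mu) + Rabs (u - v)).

Definition tame (r : R) (phi : R -> R -> R -> R) : Prop :=
  exists C, 0 <= C /\
    (forall lam u x, dom r lam x -> Rabs (phi lam u x) <= C) /\
    (forall lam u x mu v y, dom r lam x -> dom r mu y ->
       x * Rabs (phi lam u x - phi mu v y) <= C * gap lam u x mu v y).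

(** Unrolled, this is p_0 + x p_1 + ... + x^(m-1) p_(m-1) + x^m psi with Lipschitz coefficients and
    a tame remainder. The recursion on the quotient (phi - p) / x turns the closure properties below
    into inductions on the order. *)
Fixpoint taylor (r : R) (m : nat) (phi : R -> R -> R -> R) : Prop :=
  match m with
  | O => tame r phi
  | S m' => exists (p : R -> R -> R) (psi : R -> R -> R -> R),
      tame r (fun lam u _ => p lam u) /\ taylor r m' psi /\
      forall lam u x, dom r lam x -> phi lam u x = p lam u + x * psi lam u x
  end.

Definition smooth (r : R) (phi : R -> R -> R -> R) : Prop :=
  forall m, taylor r m phi.

Lemma gap_ge0 r lam u x mu v y : dom r lam x -> 0 <= gap lam u x mu v y.
Proof.
  intros [_ [Hx _]]. unfold gap.
  pose proof (Rabs_pos (x - y)). pose proof (Rabs_pos (lam - mu)).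
  pose proof (Rabs_pos (u - v)). nra.
Qed.

Lemma dom_le r s lam x : s <= r -> dom s lam x -> dom r lam x.
Proof. unfold dom. intros; lra. Qed.

Lemma tame_ext r phi chi :
  (forall lam u x, dom r lam x -> phi lam u x = chi lam u x) ->
  tame r phi -> tame r chi.
Proof.
  intros E [C [HC [B L]]]. exists C. split; [exact HC|split].
  - intros. rewrite <- E by assumption. auto.
  - intros. rewrite <- !E by assumption. auto.
Qed.

Lemma tame_le r s phi : s <= r -> tame r phi -> tame s phi.
Proof.
  intros Hs [C [HC [B L]]]. exists C. split; [exact HC|split].
  - intros. apply B. eapply dom_le; eauto.
  - intros. apply L; eapply dom_le; eauto.
Qed.

Lemma tame_const r k : tame r (fun _ _ _ => k).
Proof.
  exists (Rabs k). split; [apply Rabs_pos|split].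
  - intros; lra.
  - intros. rewrite Rminus_diag, Rabs_R0, Rmult_0_r.
    apply Rmult_le_pos; [apply Rabs_pos|eapply gap_ge0; eauto].
Qed.

Lemma tame_x r : tame r (fun _ _ x => x).
Proof.
  exists (Rabs r). split; [apply Rabs_pos|split].
  - intros lam u x [_ Hx]. rewrite !Rabs_pos_eq by lra. lra.
  - intros lam u x mu v y Hx Hy. pose proof Hx as [_ Hx'].
    rewrite (Rabs_pos_eq r) by lra.
    apply Rmult_le_compat; try lra; try apply Rabs_pos.
    unfold gap. pose proof (Rabs_pos (lam - mu)). pose proof (Rabs_pos (u - v)). nra.
Qed.

Lemma tame_plus r phi chi :
  tame r phi -> tame r chi -> tame r (fun lam u x => phi lam u x + chi lam u x).
Proof.
  intros [C [HC [B L]]] [C' [HC' [B' L']]].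
  exists (C + C'). split; [lra|split].
  - intros. eapply Rle_trans; [apply Rabs_triang|].
    apply Rplus_le_compat; auto.
  - intros. specialize (L lam u x mu v y H H0). specialize (L' lam u x mu v y H H0).
    destruct H as [_ [Hx _]].
    replace (_ - _) with ((phi lam u x - phi mu v y) + (chi lam u x - chi mu v y)) by ring.
    pose proof (Rabs_triang (phi lam u x - phi mu v y) (chi lam u x - chi mu v y)). nra.
Qed.

Lemma tame_mult r phi chi :
  tame r phi -> tame r chi -> tame r (fun lam u x => phi lam u x * chi lam u x).
Proof.
  intros [C [HC [B L]]] [C' [HC' [B' L']]].
  exists (2 * C * C'). split; [nra|split].
  - intros. rewrite Rabs_mult.
    pose proof (B lam u x H). pose proof (B' lam u x H).
    pose proof (Rabs_pos (phi lam u x)). pose proof (Rabs_pos (chi lam u x)).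
    apply Rle_trans with (C * C'); [apply Rmult_le_compat; auto|nra].
  - intros. specialize (L lam u x mu v y H H0). specialize (L' lam u x mu v y H H0).
    pose proof (gap_ge0 r lam u x mu v y H) as Hg.
    pose proof (B lam u x H) as Bx. pose proof (B' mu v y H0) as By.
    destruct H as [_ [Hx _]].
    replace (_ - _) with (phi lam u x * (chi lam u x - chi mu v y)
       + (phi lam u x - phi mu v y) * chi mu v y) by ring.
    eapply Rle_trans.
    { apply Rmult_le_compat_l; [lra|apply Rabs_triang]. }
    rewrite !Rabs_mult.
    assert (Rabs (phi lam u x) * (x * Rabs (chi lam u x - chi mu v y))
       <= C * (C' * gap lam u x mu v y)).
    { apply Rmult_le_compat; auto using Rabs_pos.
      apply Rmult_le_pos; [lra|apply Rabs_pos]. }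
    assert (Rabs (chi mu v y) * (x * Rabs (phi lam u x - phi mu v y))
       <= C' * (C * gap lam u x mu v y)).
    { apply Rmult_le_compat; auto using Rabs_pos.
      apply Rmult_le_pos; [lra|apply Rabs_pos]. }
    nra.
Qed.

Lemma tame_inv r kappa phi :
  0 < kappa -> (forall lam u x, dom r lam x -> kappa <= phi lam u x) ->
  tame r phi -> tame r (fun lam u x => / phi lam u x).
Proof.
  intros Hk HB [C [HC [B L]]].
  assert (Hi : forall lam u x, dom r lam x -> 0 < / phi lam u x <= / kappa).
  { intros. pose proof (HB lam u x H). split; [apply Rinv_0_lt_compat; lra|].
    apply Rinv_le_contravar; lra. }
  pose proof (Rinv_0_lt_compat _ Hk) as Hik.
  exists (/ kappa + / kappa * / kappa * C).
  split; [nra|split].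
  - intros. pose proof (Hi lam u x H).
    rewrite Rabs_pos_eq by lra. assert (0 <= / kappa * / kappa * C) by nra. lra.
  - intros. specialize (L lam u x mu v y H H0).
    pose proof (gap_ge0 r lam u x mu v y H) as Hg.
    pose proof (HB lam u x H). pose proof (HB mu v y H0).
    pose proof (Hi lam u x H). pose proof (Hi mu v y H0).
    replace (/ phi lam u x - / phi mu v y) with
      ((/ phi lam u x * / phi mu v y) * - (phi lam u x - phi mu v y)) by (field; lra).
    rewrite Rabs_mult, Rabs_Ropp, Rabs_pos_eq by nra.
    assert (/ phi lam u x * / phi mu v y * (x * Rabs (phi lam u x - phi mu v y))
      <= / kappa * / kappa * (C * gap lam u x mu v y)).
    { destruct H as [_ [Hx _]]. apply Rmult_le_compat; auto.
      - nra.
      - apply Rmult_le_pos; [lra|apply Rabs_pos].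
      - apply Rmult_le_compat; lra. }
    nra.
Qed.

(** The lower bound [kappa] keeps the inner radius x psi comparable to x, so a Lipschitz constant of
    order 1/(x psi) is again of order 1/x. *)
Lemma tame_comp r s kappa Phi psi :
  0 < kappa -> s <= r ->
  (forall lam u x, dom s lam x -> kappa <= psi lam u x /\ x * psi lam u x < r) ->
  tame r Phi -> tame s psi ->
  tame s (fun lam u x => Phi lam u (x * psi lam u x)).
Proof.
  intros Hk Hs HB [C [HC [B L]]] [K [HK [B' L']]].
  assert (Hd : forall lam u x, dom s lam x -> dom r lam (x * psi lam u x)).
  { intros lam u x H. pose proof (HB lam u x H) as [? ?].
    destruct H as [? [? ?]]. repeat split; try lra. nra. }
  pose proof (Rinv_0_lt_compat _ Hk) as Hik.
  exists (C + / kappa * C * (3 * K)).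
  split; [assert (0 <= / kappa * C) by nra; nra|split].
  - intros. pose proof (B _ u _ (Hd lam u x H)).
    assert (0 <= / kappa * C * (3 * K)) by (assert (0 <= / kappa * C) by nra; nra). lra.
  - intros. specialize (L _ u _ _ v _ (Hd lam u x H) (Hd mu v y H0)).
    specialize (L' lam u x mu v y H H0).
    pose proof (gap_ge0 s lam u x mu v y H) as Hg.
    pose proof (HB lam u x H) as [Hpx _].
    pose proof (B' lam u x H) as Bx. pose proof (B' mu v y H0) as By.
    destruct H as [_ [Hx _]].
    set (d := Rabs (Phi lam u (x * psi lam u x) - Phi mu v (y * psi mu v y))) in *.
    assert (Hd0 : 0 <= d) by apply Rabs_pos.
    (* One [K] comes from the variation of [psi], one from its size in front of x - y, and one from
       the rescaled parameter term of [gap]. *)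
    assert (Hgap : gap lam u (x * psi lam u x) mu v (y * psi mu v y)
                   <= 3 * K * gap lam u x mu v y).
    { unfold gap at 1.
      replace (x * psi lam u x - y * psi mu v y) with
        (x * (psi lam u x - psi mu v y) + (x - y) * psi mu v y) by ring.
      pose proof (Rabs_triang (x * (psi lam u x - psi mu v y)) ((x - y) * psi mu v y)) as T.
      rewrite !Rabs_mult, (Rabs_pos_eq x) in T by lra.
      assert (Rabs (x - y) * Rabs (psi mu v y) <= gap lam u x mu v y * K).
      { apply Rmult_le_compat; auto using Rabs_pos.
        unfold gap. pose proof (Rabs_pos (lam - mu)). pose proof (Rabs_pos (u - v)). nra. }
      assert (x * psi lam u x * (Rabs (lam - mu) + Rabs (u - v)) <= gap lam u x mu v y * K).
      { rewrite Rabs_pos_eq in Bx by lra.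
        replace (_ * _) with ((x * (Rabs (lam - mu) + Rabs (u - v))) * psi lam u x) by ring.
        pose proof (Rabs_pos (lam - mu)). pose proof (Rabs_pos (u - v)).
        pose proof (Rabs_pos (x - y)).
        apply Rmult_le_compat; try lra; unfold gap; nra. }
      lra. }
    assert (x * d <= / kappa * (x * psi lam u x * d)).
    { replace (x * d) with (/ kappa * (x * kappa * d)) by (field; lra).
      apply Rmult_le_compat_l; [lra|]. apply Rmult_le_compat_r; [lra|]. nra. }
    assert (/ kappa * (x * psi lam u x * d)
       <= / kappa * (C * (3 * K * gap lam u x mu v y))).
    { apply Rmult_le_compat_l; [lra|]. eapply Rle_trans; [exact L|].
      apply Rmult_le_compat_l; lra. }
    nra.
Qed.

Lemma tame_reparam r h phi :
  (forall u v, Rabs (h u - h v) <= Rabs (u - v)) ->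
  tame r phi -> tame r (fun lam u x => phi lam (h u) x).
Proof.
  intros Hh [C [HC [B L]]]. exists C. split; [exact HC|split].
  - intros; auto.
  - intros. eapply Rle_trans; [apply L; assumption|].
    apply Rmult_le_compat_l; [exact HC|]. unfold gap.
    specialize (Hh u v). destruct H as [_ [Hx _]]. nra.
Qed.

Lemma taylor_ext r m phi chi :
  (forall lam u x, dom r lam x -> phi lam u x = chi lam u x) ->
  taylor r m phi -> taylor r m chi.
Proof.
  destruct m as [|m]; simpl; intros E H; [eapply tame_ext; eauto|].
  destruct H as [p [psi [H1 [H2 H3]]]]. exists p, psi.
  repeat split; auto. intros. rewrite <- E by assumption. auto.
Qed.

Lemma taylor_le r s m phi : s <= r -> taylor r m phi -> taylor s m phi.
Proof.
  intros Hs. revert phi. induction m as [|m IH]; simpl; intros phi H.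
  - eapply tame_le; eauto.
  - destruct H as [p [psi [H1 [H2 H3]]]]. exists p, psi.
    repeat split; auto; [eapply tame_le; eauto|].
    intros. apply H3. eapply dom_le; eauto.
Qed.

Lemma taylor_S r m phi : taylor r (S m) phi -> taylor r m phi.
Proof.
  revert phi. induction m as [|m IH]; intros phi [p [psi [H1 [H2 H3]]]].
  - simpl in *. eapply tame_ext.
    { intros. symmetry. apply H3. assumption. }
    apply (tame_plus r _ (fun lam u x => x * psi lam u x) H1).
    apply (tame_mult r (fun _ _ x => x)); [apply tame_x|exact H2].
  - exists p, psi. auto.
Qed.

Lemma taylor_coef r m p :
  tame r (fun lam u _ => p lam u) -> taylor r m (fun lam u _ => p lam u).
Proof.
  intros H. revert p H. induction m as [|m IH]; intros p H; [exact H|].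
  exists p, (fun _ _ _ => 0). repeat split; auto.
  - apply (IH (fun _ _ => 0)). apply tame_const.
  - intros; ring.
Qed.

Lemma taylor_mulx r m phi :
  taylor r m phi -> taylor r (S m) (fun lam u x => x * phi lam u x).
Proof.
  intros H. exists (fun _ _ => 0), phi. repeat split; auto.
  - apply tame_const.
  - intros; ring.
Qed.

Lemma taylor_plus r m phi chi :
  taylor r m phi -> taylor r m chi ->
  taylor r m (fun lam u x => phi lam u x + chi lam u x).
Proof.
  revert phi chi. induction m as [|m IH]; intros phi chi H K; [apply tame_plus; auto|].
  destruct H as [p [psi [H1 [H2 H3]]]]. destruct K as [q [xi [K1 [K2 K3]]]].
  exists (fun lam u => p lam u + q lam u), (fun lam u x => psi lam u x + xi lam u x).
  repeat split; auto.
  - apply (tame_plus r _ _ H1 K1).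
  - intros. rewrite H3, K3 by assumption. ring.
Qed.

(** The remainder is arranged as p xi + psi chi, with [chi] left unsplit; truncated to order m by
    [taylor_S], it fits the induction hypothesis. *)
Lemma taylor_mult r m phi chi :
  taylor r m phi -> taylor r m chi ->
  taylor r m (fun lam u x => phi lam u x * chi lam u x).
Proof.
  revert phi chi. induction m as [|m IH]; intros phi chi H K; [apply tame_mult; auto|].
  pose proof (taylor_S _ _ _ K) as K0.
  destruct H as [p [psi [H1 [H2 H3]]]]. destruct K as [q [xi [K1 [K2 K3]]]].
  exists (fun lam u => p lam u * q lam u),
    (fun lam u x => p lam u * xi lam u x + psi lam u x * chi lam u x).
  repeat split; auto.
  - apply (tame_mult r _ _ H1 K1).
  - apply taylor_plus; [|auto]. apply (IH (fun lam u _ => p lam u)); auto.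
    apply taylor_coef; auto.
  - intros. rewrite H3, K3 by assumption. ring.
Qed.

(** The passage to the limit x -> 0, made at one explicit x with x (C + 1) at most (m - p) / 2.
    Every later identification of a coefficient goes through it. *)
Lemma coef_limit r x0 p (psi : R -> R) C m :
  0 < r -> 0 < x0 ->
  (forall x, 0 < x < r -> Rabs (psi x) <= C) ->
  (forall x, 0 < x < r -> x < x0 -> m <= p + x * psi x) -> m <= p.
Proof.
  intros Hr Hx0 B H. apply Rnot_lt_le. intros Hlt.
  assert (HC : 0 <= C).
  { eapply Rle_trans; [apply Rabs_pos|]. apply (B (r / 2)). lra. }
  set (x := Rmin (Rmin (r / 2) (x0 / 2)) ((m - p) / (2 * (C + 1)))).
  assert (Hq : 0 < (m - p) / (2 * (C + 1))).
  { apply Rdiv_lt_0_compat; lra. }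
  assert (0 < x) by (unfold x; repeat apply Rmin_glb_lt; lra).
  assert (x <= r / 2) by (unfold x; eapply Rle_trans; [apply Rmin_l|apply Rmin_l]).
  assert (x <= x0 / 2) by (unfold x; eapply Rle_trans; [apply Rmin_l|apply Rmin_r]).
  assert (Hxq : x <= (m - p) / (2 * (C + 1))) by apply Rmin_r.
  assert (x * (C + 1) <= (m - p) / 2).
  { replace ((m - p) / 2) with ((m - p) / (2 * (C + 1)) * (C + 1)) by (field; lra).
    apply Rmult_le_compat_r; lra. }
  specialize (H x ltac:(lra) ltac:(lra)). specialize (B x ltac:(lra)).
  pose proof (Rle_abs (psi x)).
  nra.
Qed.

(** 1/phi = 1/p - x psi / (p phi): the remainder contains 1/phi only to the previous order. The
    lower bound passes from phi to p by letting x tend to 0. *)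
Lemma taylor_inv r m kappa phi :
  0 < kappa -> (forall lam u x, dom r lam x -> kappa <= phi lam u x) ->
  taylor r m phi -> taylor r m (fun lam u x => / phi lam u x).
Proof.
  intros Hk. revert phi. induction m as [|m IH]; intros phi HB H;
    [eapply tame_inv; eauto|].
  pose proof (taylor_S _ _ _ H) as H0.
  destruct H as [p [psi [H1 [H2 H3]]]].
  assert (Hp : forall lam u x, dom r lam x -> kappa <= p lam u).
  { intros lam u x [Hl Hx].
    assert (tame r psi) as [C [HC [B _]]].
    { clear -H2. induction m; [exact H2|]. apply IHm, taylor_S, H2. }
    apply (coef_limit r r (p lam u) (fun x => psi lam u x) C); try lra.
    - intros. apply B. split; assumption.
    - intros. rewrite <- H3 by (split; assumption). apply HB. split; assumption. }
  assert (Hip : tame r (fun lam u _ => / p lam u)).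
  { apply (tame_inv r kappa (fun lam u _ => p lam u)); auto. }
  exists (fun lam u => / p lam u),
    (fun lam u x => (-1) * (psi lam u x * (/ p lam u * / phi lam u x))).
  repeat split; auto.
  - apply (taylor_mult r m (fun _ _ _ => -1)).
    + apply (taylor_coef r m (fun _ _ => -1)), tame_const.
    + apply taylor_mult; [exact H2|].
      apply (taylor_mult r m (fun lam u _ => / p lam u)); [|auto].
      apply (taylor_coef r m (fun lam u => / p lam u)); exact Hip.
  - intros. pose proof (Hp lam u x H). pose proof (HB lam u x H).
    rewrite H3 in * by assumption. field. lra.
Qed.

(** Substituting z = x psi in p + z Psi(z) leaves p untouched and produces the factor x by itself,
    so order m of [psi] is enough for order m + 1 of the composite. *)
Lemma taylor_comp r s m kappa Phi psi :
  0 < kappa -> s <= r ->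
  (forall lam u x, dom s lam x -> kappa <= psi lam u x /\ x * psi lam u x < r) ->
  taylor r m Phi -> taylor s m psi ->
  taylor s m (fun lam u x => Phi lam u (x * psi lam u x)).
Proof.
  intros Hk Hs HB. revert Phi. induction m as [|m IH]; intros Phi H K;
    [eapply tame_comp; eauto|].
  apply taylor_S in K.
  destruct H as [p [Psi [H1 [H2 H3]]]].
  exists p, (fun lam u x => psi lam u x * Psi lam u (x * psi lam u x)).
  repeat split.
  - eapply tame_le; eauto.
  - apply taylor_mult; auto.
  - intros lam u x H. pose proof (HB lam u x H) as [? ?].
    rewrite H3; [ring|]. destruct H as [? [? ?]]. repeat split; try lra. nra.
Qed.

(** Serves with a constant [h], to read a function off at the end u = 1 of a quadrant. *)
Lemma taylor_reparam r m h phi :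
  (forall u v, Rabs (h u - h v) <= Rabs (u - v)) ->
  taylor r m phi -> taylor r m (fun lam u x => phi lam (h u) x).
Proof.
  intros Hh. revert phi. induction m as [|m IH]; intros phi H;
    [apply tame_reparam; auto|].
  destruct H as [p [psi [H1 [H2 H3]]]].
  exists (fun lam u => p lam (h u)), (fun lam u x => psi lam (h u) x).
  repeat split; auto. apply (tame_reparam r h _ Hh H1).
Qed.

Lemma taylor_tame r m phi : taylor r m phi -> tame r phi.
Proof. induction m; intros H; [exact H|apply IHm, taylor_S, H]. Qed.

Lemma coef_unique r p q (psi xi : R -> R) C :
  0 < r ->
  (forall x, 0 < x < r -> Rabs (psi x) <= C /\ Rabs (xi x) <= C) ->
  (forall x, 0 < x < r -> p + x * psi x = q + x * xi x) -> p = q.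
Proof.
  intros Hr B H. apply Rle_antisym.
  - apply (coef_limit r r q (fun x => xi x - psi x) (C + C)); auto.
    + intros x Hx. destruct (B x Hx).
      unfold Rminus. eapply Rle_trans; [apply Rabs_triang|]. rewrite Rabs_Ropp. lra.
    + intros x Hx _. specialize (H x Hx). lra.
  - apply (coef_limit r r p (fun x => psi x - xi x) (C + C)); auto.
    + intros x Hx. destruct (B x Hx).
      unfold Rminus. eapply Rle_trans; [apply Rabs_triang|]. rewrite Rabs_Ropp. lra.
    + intros x Hx _. specialize (H x Hx). lra.
Qed.

(** [smooth] provides an unrelated expansion at each order. Uniqueness of the leading coefficient
    forces all the first remainders to agree, so a single [psi] has expansions of every order. *)
Lemma smooth_split r phi :
  0 < r -> smooth r phi ->
  exists p psi, tame r (fun lam u _ => p lam u) /\ smooth r psi /\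
    forall lam u x, dom r lam x -> phi lam u x = p lam u + x * psi lam u x.
Proof.
  intros Hr H. destruct (H 1%nat) as [p [psi [H1 [H2 H3]]]].
  exists p, psi. repeat split; auto. intros m.
  destruct (H (S m)) as [q [xi [K1 [K2 K3]]]].
  apply (taylor_ext r m xi); [|exact K2].
  destruct H2 as [C [HC [B _]]].
  destruct (taylor_tame _ _ _ K2) as [C' [HC' [B' _]]].
  intros lam u x Hd. pose proof Hd as [Hl Hx].
  assert (E : p lam u = q lam u).
  { apply (coef_unique r _ _ (fun x => psi lam u x) (fun x => xi lam u x) (C + C')); auto.
    - intros z Hz. specialize (B lam u z (conj Hl Hz)). specialize (B' lam u z (conj Hl Hz)). lra.
    - intros z Hz. rewrite <- H3, <- K3 by (split; assumption). reflexivity. }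
  assert (x * xi lam u x = x * psi lam u x).
  { specialize (H3 _ u _ Hd). specialize (K3 _ u _ Hd). lra. }
  apply (Rmult_eq_reg_l x); lra.
Qed.

(** * Integration, monotonicity and a Gronwall inequality *)

(** [tame] quantifies over all real u, whereas the angular variable lives in [0, 1]. Composing with
    this 1-Lipschitz projection extends functions from [0, 1] at no cost. *)
Definition clamp (u : R) : R := Rmax 0 (Rmin 1 u).

Lemma clamp_range u : 0 <= clamp u <= 1.
Proof.
  unfold clamp, Rmax, Rmin. repeat destruct Rle_dec; lra.
Qed.

Lemma clamp_id u : 0 <= u <= 1 -> clamp u = u.
Proof. unfold clamp, Rmax, Rmin. intros. repeat destruct Rle_dec; lra. Qed.

Lemma clamp_lip u v : Rabs (clamp u - clamp v) <= Rabs (u - v).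
Proof.
  unfold clamp, Rmax, Rmin, Rabs.
  repeat destruct Rle_dec; repeat destruct Rcase_abs; lra.
Qed.

Lemma lipschitz_continuous (f : R -> R) C :
  (forall u v, Rabs (f u - f v) <= C * Rabs (u - v)) -> forall u, continuous f u.
Proof.
  intros H u. apply continuity_pt_filterlim. intros eps Heps.
  assert (HC : 0 <= C).
  { specialize (H 1 0). rewrite Rminus_0_r, Rabs_R1 in H.
    pose proof (Rabs_pos (f 1 - f 0)). lra. }
  exists (eps / (C + 1)). split; [apply Rdiv_lt_0_compat; lra|].
  intros v [_ Hv]. simpl in *. unfold Rdist in *.
  eapply Rle_lt_trans; [apply H|].
  apply Rle_lt_trans with (C * (eps / (C + 1))).
  - apply Rmult_le_compat_l; lra.
  - replace eps with ((C + 1) * (eps / (C + 1))) at 2 by (field; lra).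
    apply Rmult_lt_compat_r; [apply Rdiv_lt_0_compat|]; lra.
Qed.

(** At fixed lam and x the gap is x |u - v|, so the factor x cancels and a genuine Lipschitz bound
    in u remains. *)
Lemma tame_continuous r phi lam x :
  tame r phi -> dom r lam x -> forall u, continuous (fun u => phi lam u x) u.
Proof.
  intros [C [HC [_ L]]] Hd. apply (lipschitz_continuous _ C). intros u v.
  specialize (L lam u x lam v x Hd Hd). destruct Hd as [_ [Hx _]].
  unfold gap in L. rewrite !Rminus_diag, Rabs_R0 in L.
  apply (Rmult_le_reg_l x); lra.
Qed.

Lemma tame_ex_RInt r phi lam x a b :
  tame r phi -> dom r lam x -> ex_RInt (fun u => phi lam u x) a b.
Proof.
  intros H Hd. apply (ex_RInt_continuous (V := R_CompleteNormedModule)).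
  intros. eapply tame_continuous; eauto.
Qed.

Lemma abs_RInt_le (f : R -> R) a b M :
  ex_RInt f a b -> (forall t, Rabs (f t) <= M) ->
  Rabs (RInt f a b) <= Rabs (b - a) * M.
Proof.
  intros Hf HM. apply (norm_RInt_le_const_abs (V := R_NormedModule) f a b).
  - intros. apply HM.
  - apply (RInt_correct (V := R_CompleteNormedModule)). exact Hf.
Qed.

Lemma tame_RInt r phi :
  tame r phi -> tame r (fun lam u x => RInt (fun v => phi lam v x) 0 (clamp u)).
Proof.
  intros T. pose proof T as [C [HC [B L]]]. exists (2 * C). split; [lra|split].
  - intros lam u x Hd. eapply Rle_trans.
    { apply (abs_RInt_le _ _ _ C); [eapply tame_ex_RInt; eauto|auto]. }
    pose proof (clamp_range u). rewrite Rminus_0_r, Rabs_pos_eq by lra. nra.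
  - intros lam u x mu v y Hd Hd'.
    pose proof (fun a b => tame_ex_RInt r phi lam x a b T Hd) as E.
    pose proof (fun a b => tame_ex_RInt r phi mu y a b T Hd') as E'.
    assert (Hx : 0 < x) by (destruct Hd; lra).
    (* The difference is split into the same integrand over a moved endpoint and a moved integrand
       over the same interval. *)
    replace (RInt (fun v0 => phi lam v0 x) 0 (clamp u)
             - RInt (fun v0 => phi mu v0 y) 0 (clamp v)) with
      (RInt (fun v0 => phi lam v0 x) (clamp v) (clamp u)
       + RInt (fun v0 => phi lam v0 x - phi mu v0 y) 0 (clamp v)).
    2:{ rewrite (RInt_minus (V := R_CompleteNormedModule)) by auto.
        pose proof (RInt_Chasles (V := R_CompleteNormedModule)
          (fun v0 => phi lam v0 x) 0 (clamp v) (clamp u) (E _ _) (E _ _)) as Ch.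
        unfold minus, plus, opp in *. simpl in *. lra. }
    assert (I1 : Rabs (RInt (fun v0 => phi lam v0 x) (clamp v) (clamp u))
              <= Rabs (u - v) * C).
    { eapply Rle_trans; [apply (abs_RInt_le _ _ _ C); auto|].
      apply Rmult_le_compat_r; [exact HC|apply clamp_lip]. }
    set (g := gap lam 0 x mu 0 y).
    assert (I2 : Rabs (RInt (fun v0 => phi lam v0 x - phi mu v0 y) 0 (clamp v))
              <= 1 * (/ x * (C * g))).
    { eapply Rle_trans; [apply (abs_RInt_le _ _ _ (/ x * (C * g)))|].
      - apply (ex_RInt_minus (V := R_NormedModule)); auto.
      - intros t. specialize (L lam t x mu t y Hd Hd').
        replace (gap lam t x mu t y) with g in L
          by (unfold g, gap; rewrite !Rminus_diag; reflexivity).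
        apply (Rmult_le_reg_l x); [lra|].
        replace (x * (/ x * (C * g))) with (C * g) by (field; lra). exact L.
      - pose proof (clamp_range v). rewrite Rminus_0_r, Rabs_pos_eq by lra.
        apply Rmult_le_compat_r; [|lra].
        apply Rmult_le_pos; [left; apply Rinv_0_lt_compat; lra|].
        apply Rmult_le_pos; [lra|]. eapply gap_ge0; eauto. }
    eapply Rle_trans; [apply Rmult_le_compat_l; [lra|apply Rabs_triang]|].
    assert (Hg : x * (1 * (/ x * (C * g))) = C * g) by (field; lra).
    assert (Hg' : g <= gap lam u x mu v y).
    { unfold g, gap. rewrite Rminus_diag, Rabs_R0.
      pose proof (Rabs_pos (u - v)). nra. }
    assert (x * Rabs (u - v) <= gap lam u x mu v y).
    { unfold gap. pose proof (Rabs_pos (x - y)). pose proof (Rabs_pos (lam - mu)). nra. }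
    rewrite Rmult_plus_distr_l.
    assert (x * Rabs (RInt (fun v0 => phi lam v0 x) (clamp v) (clamp u))
      <= C * gap lam u x mu v y).
    { eapply Rle_trans; [apply Rmult_le_compat_l; [lra|exact I1]|]. nra. }
    assert (x * Rabs (RInt (fun v0 => phi lam v0 x - phi mu v0 y) 0 (clamp v))
      <= C * gap lam u x mu v y).
    { eapply Rle_trans; [apply Rmult_le_compat_l; [lra|exact I2]|]. nra. }
    lra.
Qed.

Lemma taylor_RInt r m phi :
  taylor r m phi ->
  taylor r m (fun lam u x => RInt (fun v => phi lam v x) 0 (clamp u)).
Proof.
  revert phi. induction m as [|m IH]; intros phi H; [apply tame_RInt; auto|].
  destruct H as [p [psi [H1 [H2 H3]]]].
  exists (fun lam u => RInt (p lam) 0 (clamp u)),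
    (fun lam u x => RInt (fun v => psi lam v x) 0 (clamp u)).
  repeat split; auto.
  - apply (tame_RInt r (fun lam u _ => p lam u)). exact H1.
  - intros lam u x Hd. apply taylor_tame in H2.
    rewrite (RInt_ext _ (fun v => plus (p lam v) (scal x (psi lam v x)))).
    2:{ intros. apply H3. exact Hd. }
    pose proof (tame_ex_RInt r psi lam x 0 (clamp u) H2 Hd) as E2.
    pose proof (tame_ex_RInt r _ lam x 0 (clamp u) H1 Hd) as E1.
    rewrite (RInt_plus (V := R_CompleteNormedModule)); [|exact E1|].
    2:{ apply (ex_RInt_scal (V := R_NormedModule)). exact E2. }
    rewrite (RInt_scal (V := R_CompleteNormedModule)) by exact E2. reflexivity.
Qed.

Lemma derive_nonpos_le (f df : R -> R) a b :
  a <= b -> (forall x, a < x < b -> is_derive f x (df x)) ->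
  (forall x, a < x < b -> df x <= 0) ->
  (forall x, a <= x <= b -> continuous f x) -> f b <= f a.
Proof.
  intros Hab D N C.
  (* The intermediate point may be an endpoint, where nothing is known of [df]; the derivative
     handed over is therefore set to 0 outside the open interval. *)
  destruct (MVT_gen f a b
    (fun x => if Rlt_dec a x then if Rlt_dec x b then df x else 0 else 0))
    as [c [_ E]]; rewrite ?Rmin_left, ?Rmax_right in * by lra.
  - intros x Hx. destruct (Rlt_dec a x); [|lra]. destruct (Rlt_dec x b); [|lra].
    apply D. exact Hx.
  - intros x Hx. apply continuity_pt_filterlim. apply C. exact Hx.
  - cut (f b - f a <= 0); [lra|]. rewrite E.
    destruct (Rlt_dec a c); [destruct (Rlt_dec c b)|]; [specialize (N c)| |]; nra.
Qed.

Lemma derive_zero_eq (f df : R -> R) a b :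
  a <= b -> (forall x, a < x < b -> is_derive f x (df x)) ->
  (forall x, a < x < b -> df x = 0) ->
  (forall x, a <= x <= b -> continuous f x) -> f b = f a.
Proof.
  intros Hab D N C. apply Rle_antisym.
  - apply (derive_nonpos_le f df); auto. intros. rewrite N; auto; lra.
  - cut (- f b <= - f a); [lra|].
    apply (derive_nonpos_le (fun x => - f x) (fun x => - df x)); auto.
    + intros. apply (is_derive_opp f). auto.
    + intros. rewrite N by auto. lra.
    + intros. apply (continuous_opp f). auto.
Qed.

(** The estimate is made on e^2 + B^2, which is differentiable where |e| may fail to be. From 2 e e'
    <= 2C e^2 + 2 |e| B <= (2C + 1)(e^2 + B^2) comes the rate 2C + 1, and exp(-(2C + 1) u) (e^2 +
    B^2) decreases. *)
Lemma gronwall (e de : R -> R) C B :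
  0 <= C -> 0 <= B ->
  (forall u, 0 < u < 1 -> is_derive e u (de u)) ->
  (forall u, 0 < u < 1 -> Rabs (de u) <= C * Rabs (e u) + B) ->
  (forall u, continuous e u) ->
  forall u, 0 <= u <= 1 -> Rabs (e u) <= (Rabs (e 0) + B) * exp (2 * C + 1).
Proof.
  intros HC HB D N Ce u Hu.
  set (k := 2 * C + 1).
  assert (H : (e u * e u + B * B) * exp (- k * u) <= (e 0 * e 0 + B * B) * exp (- k * 0)).
  { apply (derive_nonpos_le (fun u => (e u * e u + B * B) * exp (- k * u))
      (fun u => (2 * e u * de u) * exp (- k * u)
                - k * (e u * e u + B * B) * exp (- k * u))); [lra| | |].
    - intros v Hv. specialize (D v ltac:(lra)). auto_derive.
      + repeat split; exists (de v); exact D.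
      + rewrite (is_derive_unique (fun x : R => e x) v (de v) D). ring.
    - intros v Hv. specialize (N v ltac:(lra)).
      rewrite <- Rmult_minus_distr_r.
      assert (0 < exp (- k * v)) by apply exp_pos.
      assert (e v * de v <= C * (e v * e v) + (e v * e v + B * B) / 2).
      { apply Rle_trans with (Rabs (e v) * Rabs (de v)).
        - rewrite <- Rabs_mult. apply Rle_abs.
        - assert (Rabs (e v) * Rabs (e v) = e v * e v).
          { rewrite <- Rabs_mult, Rabs_pos_eq; nra. }
          pose proof (Rabs_pos (e v)). rewrite <- H0.
          assert (Rabs (e v) * Rabs (de v) <= Rabs (e v) * (C * Rabs (e v) + B))
            by (apply Rmult_le_compat_l; lra).
          pose proof (Rle_0_sqr (Rabs (e v) - B)). unfold Rsqr in *. nra. }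
      assert (2 * e v * de v - k * (e v * e v + B * B) <= 0).
      { unfold k. assert (0 <= C * (B * B)) by (apply Rmult_le_pos; nra). nra. }
      nra.
    - intros v Hv.
      apply (continuous_mult (K := R_AbsRing) (fun u => e u * e u + B * B)
               (fun u => exp (- k * u))).
      + apply (continuous_plus (V := R_NormedModule)); [|apply continuous_const].
        apply (continuous_mult (K := R_AbsRing)); apply Ce.
      + apply (ex_derive_continuous (fun u => exp (- k * u))). auto_derive. trivial. }
  rewrite Rmult_0_r, exp_0, Rmult_1_r in H.
  assert (Hk : 0 < k) by (unfold k; lra).
  assert (E : exp (- k * u) * exp (k * u) = 1).
  { rewrite <- exp_plus. replace (- k * u + k * u) with 0 by ring. apply exp_0. }
  assert (Eu : exp (k * u) <= exp k).
  { destruct (Req_dec u 1) as [->|]; [rewrite Rmult_1_r; lra|].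
    left. apply exp_increasing. nra. }
  assert (1 <= exp k) by (pose proof (exp_ineq1 k ltac:(lra)); lra).
  pose proof (exp_pos (k * u)). pose proof (Rabs_pos (e 0)).
  assert (Q2 : e u * e u + B * B <= (e 0 * e 0 + B * B) * exp (k * u)).
  { replace (e u * e u + B * B) with
      ((e u * e u + B * B) * exp (- k * u) * exp (k * u)) by (rewrite Rmult_assoc, E; ring).
    apply Rmult_le_compat_r; lra. }
  assert (A0 : Rabs (e 0) * Rabs (e 0) = e 0 * e 0).
  { rewrite <- Rabs_mult, Rabs_pos_eq; nra. }
  assert (Q3 : e u * e u <= ((Rabs (e 0) + B) * exp k) * ((Rabs (e 0) + B) * exp k)).
  { assert ((e 0 * e 0 + B * B) * exp (k * u) <= (e 0 * e 0 + B * B) * exp k)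
      by (apply Rmult_le_compat_l; nra).
    assert (e 0 * e 0 + B * B <= (Rabs (e 0) + B) * (Rabs (e 0) + B)) by nra.
    assert ((e 0 * e 0 + B * B) * exp k
       <= ((Rabs (e 0) + B) * (Rabs (e 0) + B)) * (exp k * exp k)).
    { apply Rmult_le_compat; nra. }
    nra. }
  apply Rsqr_incr_0_var.
  - unfold Rsqr. rewrite <- Rabs_mult, (Rabs_pos_eq (e u * e u)) by nra. exact Q3.
  - nra.
Qed.

(** * Expansions of the solutions of the radial equation *)

(* [G] is only used for [u] in [0, 1]; outside, [rho] is extended by constants. *)
Definition radial_arc (r s : R) (G : R -> R -> R -> R) (om : R -> R -> R)
    (rho : R -> R -> R -> R) : Prop :=
  forall lam x, dom s lam x ->
    rho lam 0 x = x * om lam x /\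
    (forall u, rho lam u x = rho lam (clamp u) x) /\
    (forall u, continuous (fun v => rho lam v x) u) /\
    (forall u, 0 < rho lam u x < r) /\
    (forall u, 0 < u < 1 -> is_derive (fun v => rho lam v x) u
       (rho lam u x * G lam u (rho lam u x))).

Lemma radial_dom r s G om rho lam x u :
  s <= r -> radial_arc r s G om rho -> dom s lam x -> dom r lam (rho lam u x).
Proof.
  intros Hs H Hd. destruct (H lam x Hd) as [_ [_ [_ [Hr _]]]].
  split; [|apply Hr]. destruct Hd. lra.
Qed.

(** f exp(-C u) decreases and f exp(C u) increases; u runs over an interval of length 1. *)
Lemma linear_growth (f df : R -> R) C :
  0 <= C ->
  (forall u, 0 < u < 1 -> is_derive f u (df u)) ->
  (forall u, 0 < f u) ->
  (forall u, 0 < u < 1 -> Rabs (df u) <= C * f u) ->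
  (forall u, continuous f u) ->
  forall u, 0 <= u <= 1 -> f 0 * exp (- C) <= f u <= f 0 * exp C.
Proof.
  intros HC D P B Cf u Hu.
  assert (Ce : forall k v, continuous (fun u => f u * exp (k * u)) v).
  { intros k v. apply (continuous_mult (K := R_AbsRing) f (fun u => exp (k * u))); [apply Cf|].
    apply (ex_derive_continuous (fun u => exp (k * u))). auto_derive. trivial. }
  assert (De : forall k v, 0 < v < 1 ->
    is_derive (fun u => f u * exp (k * u)) v ((df v + k * f v) * exp (k * v))).
  { intros k v Hv. specialize (D v Hv). auto_derive.
    - repeat split; exists (df v); exact D.
    - rewrite (is_derive_unique (fun x : R => f x) v (df v) D). ring. }
  assert (Up : f u * exp (- C * u) <= f 0 * exp (- C * 0)).
  { apply (derive_nonpos_le (fun u => f u * exp (- C * u))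
      (fun v => (df v + - C * f v) * exp (- C * v))); [lra| | |]; auto.
    - intros; apply De; lra.
    - intros v Hv. specialize (B v ltac:(lra)). pose proof (Rle_abs (df v)).
      pose proof (exp_pos (- C * v)). nra. }
  assert (Lo : - (f u * exp (C * u)) <= - (f 0 * exp (C * 0))).
  { apply (derive_nonpos_le (fun u => - (f u * exp (C * u)))
      (fun v => - ((df v + C * f v) * exp (C * v)))); [lra| | |].
    - intros v Hv. apply (is_derive_opp (fun u => f u * exp (C * u))). apply De. lra.
    - intros v Hv. specialize (B v ltac:(lra)). pose proof (Rabs_maj2 (df v)).
      pose proof (exp_pos (C * v)). nra.
    - intros. apply (continuous_opp (V := R_NormedModule)). apply Ce. }
  rewrite Rmult_0_r, exp_0, Rmult_1_r in Up, Lo.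
  assert (M : forall a b, a <= b -> exp a <= exp b).
  { intros a b [Hlt| ->]; [left; apply exp_increasing; exact Hlt|lra]. }
  pose proof (M (C * u) C ltac:(nra)) as M1.
  pose proof (M (- C) (- C * u) ltac:(nra)) as M2.
  pose proof (P 0). pose proof (P u).
  assert (E : exp (- C * u) * exp (C * u) = 1).
  { rewrite <- exp_plus. replace (- C * u + C * u) with 0 by ring. apply exp_0. }
  pose proof (exp_pos (- C * u)). pose proof (exp_pos (C * u)).
  assert (E1 : f u = f u * exp (- C * u) * exp (C * u)) by (rewrite Rmult_assoc, E; ring).
  assert (E2 : f u = f u * exp (C * u) * exp (- C * u))
    by (rewrite Rmult_assoc, (Rmult_comm (exp (C * u))), E; ring).
  split.
  - rewrite E2. apply Rmult_le_compat; try lra. left; apply exp_pos.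
  - rewrite E1. apply Rmult_le_compat; try lra. nra.
Qed.

Lemma radial_bounds r s G om rho kappa K :
  0 < r -> 0 < kappa -> s <= r -> tame r G -> radial_arc r s G om rho ->
  (forall lam x, dom s lam x -> kappa <= om lam x <= K) ->
  exists kappa' K', 0 < kappa' /\ forall lam u x, dom s lam x ->
    kappa' * x <= rho lam u x <= K' * x.
Proof.
  intros Hr Hk Hs [C [HC [B _]]] A Hom.
  exists (kappa * exp (- C)), (K * exp C). split.
  { apply Rmult_lt_0_compat; [lra|apply exp_pos]. }
  intros lam u x Hd.
  pose proof (fun u => radial_dom r s G om rho lam x u Hs A Hd) as Hrd.
  destruct (A lam x Hd) as [A0 [A1 [A2 [A3 A4]]]].
  destruct (Hom lam x Hd).
  destruct (linear_growth (fun v => rho lam v x)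
    (fun v => rho lam v x * G lam v (rho lam v x)) C HC A4
    (fun u => proj1 (A3 u))) with (u := clamp u) as [L1 L2]; auto.
  - intros v Hv. rewrite Rabs_mult, Rabs_pos_eq by (specialize (A3 v); lra).
    rewrite Rmult_comm. apply Rmult_le_compat_r; [specialize (A3 v); lra|auto].
  - apply clamp_range.
  - rewrite <- A1, A0 in L1, L2. destruct Hd as [_ Hx].
    pose proof (exp_pos C). pose proof (exp_pos (- C)). split.
    + eapply Rle_trans; [|exact L1].
      replace (kappa * exp (- C) * x) with (x * kappa * exp (- C)) by ring.
      apply Rmult_le_compat_r; [lra|]. apply Rmult_le_compat_l; lra.
    + eapply Rle_trans; [exact L2|].
      replace (K * exp C * x) with (x * K * exp C) by ring.
      apply Rmult_le_compat_r; [lra|]. apply Rmult_le_compat_l; lra.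
Qed.

(** x (rho/x - rho'/y) = (rho - rho') - (rho'/y)(x - y): dividing a Lipschitz function of size O(x)
    by x costs exactly the factor x that [tame] allows. *)
Lemma div_x_tame s rho K L :
  0 <= K -> 0 <= L ->
  (forall lam u x, dom s lam x -> 0 <= rho lam u x <= K * x) ->
  (forall lam u x mu v y, dom s lam x -> dom s mu y ->
     Rabs (rho lam u x - rho mu v y) <= L * gap lam u x mu v y) ->
  tame s (fun lam u x => rho lam u x / x).
Proof.
  intros HK HL HB HLip. exists (K + L). split; [lra|].
  assert (HB' : forall lam u x, dom s lam x -> 0 <= rho lam u x / x <= K).
  { intros lam u x Hd. pose proof (HB lam u x Hd) as HB'. destruct Hd as [_ Hx]. split.
    - apply Rmult_le_pos; [lra|left; apply Rinv_0_lt_compat; lra].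
    - apply (Rmult_le_reg_r x); [lra|]. unfold Rdiv. rewrite Rmult_assoc, Rinv_l by lra. lra. }
  split.
  - intros lam u x Hd. specialize (HB' lam u x Hd). rewrite Rabs_pos_eq; lra.
  - intros lam u x mu v y Hd Hd'. specialize (HLip lam u x mu v y Hd Hd').
    specialize (HB' mu v y Hd').
    pose proof (gap_ge0 s lam u x mu v y Hd) as Hg.
    assert (Hxy : Rabs (x - y) <= gap lam u x mu v y).
    { unfold gap. destruct Hd. pose proof (Rabs_pos (lam - mu)). pose proof (Rabs_pos (u - v)). nra. }
    destruct Hd as [_ Hx]. destruct Hd' as [_ Hy].
    rewrite <- (Rabs_pos_eq x) at 1 by lra. rewrite <- Rabs_mult.
    replace (x * (rho lam u x / x - rho mu v y / y)) with
      ((rho lam u x - rho mu v y) - rho mu v y / y * (x - y)) by (field; lra).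
    unfold Rminus at 1. eapply Rle_trans; [apply Rabs_triang|].
    rewrite Rabs_Ropp, Rabs_mult, (Rabs_pos_eq (rho mu v y / y)) by lra.
    assert (rho mu v y / y * Rabs (x - y) <= K * gap lam u x mu v y).
    { apply Rmult_le_compat; try lra. apply Rabs_pos. }
    lra.
Qed.

(** The field is rho G: its factor rho absorbs the Lipschitz constant of order 1/rho of G, so the
    right-hand side is honestly Lipschitz in rho. Variation in u is bounded through the equation,
    variation in (lam, x) by Gronwall, and the division by x comes last. *)
Lemma radial_tame r s G om rho kappa :
  0 < r -> 0 < s -> 0 < kappa -> s <= r -> tame r G -> radial_arc r s G om rho ->
  tame s (fun lam _ x => om lam x) ->
  (forall lam x, dom s lam x -> kappa <= om lam x) ->
  tame s (fun lam u x => rho lam u x / x) /\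
  exists kappa', 0 < kappa' /\ forall lam u x, dom s lam x -> kappa' <= rho lam u x / x.
Proof.
  intros Hr Hs0 Hk Hs TG A [C1 [HC1 [Bom Lom]]] Hom.
  destruct (radial_bounds r s G om rho kappa C1 Hr Hk Hs TG A) as [k' [K [Hk' HB]]].
  { intros lam x Hd. split; [auto|]. specialize (Bom lam 0 x Hd).
    pose proof (Rle_abs (om lam x)). lra. }
  assert (HK : 0 <= K).
  { assert (Hd : dom s 0 (s / 2)) by (split; [rewrite Rabs_R0|]; lra).
    specialize (HB 0 0 (s / 2) Hd). assert (0 < k' * (s / 2)) by nra. nra. }
  destruct TG as [C [HC [B L]]].
  split.
  2:{ exists k'. split; [exact Hk'|]. intros lam u x Hd. destruct (HB lam u x Hd) as [H1 _].
      destruct Hd as [_ Hx]. apply (Rmult_le_reg_r x); [lra|].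
      unfold Rdiv. rewrite Rmult_assoc, Rinv_l by lra. lra. }
  assert (Lu : forall lam x, dom s lam x -> forall u v,
     Rabs (rho lam u x - rho lam v x) <= K * C * x * Rabs (u - v)).
  { intros lam x Hd.
    pose proof (fun u => radial_dom r s G om rho lam x u Hs A Hd) as Hrd.
    destruct (A lam x Hd) as [A0 [A1 [A2 [A3 A4]]]].
    assert (W : forall u v, 0 <= u <= 1 -> 0 <= v <= 1 -> u <= v ->
       Rabs (rho lam u x - rho lam v x) <= K * C * x * (v - u)).
    { intros u v Hu Hv Huv.
      assert (Db : forall t, Rabs (rho lam t x * G lam t (rho lam t x)) <= K * C * x).
      { intros t. rewrite Rabs_mult, Rabs_pos_eq by (specialize (A3 t); lra).
        replace (K * C * x) with (K * x * C) by ring.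
        apply Rmult_le_compat; try apply Rabs_pos; [specialize (A3 t); lra|apply HB; auto|auto]. }
      apply Rabs_le. split.
      - cut (rho lam v x + - (K * C * x) * v <= rho lam u x + - (K * C * x) * u); [nra|].
        apply (derive_nonpos_le (fun t => rho lam t x + - (K * C * x) * t)
          (fun t => rho lam t x * G lam t (rho lam t x) + - (K * C * x))); auto.
        + intros t Ht. apply (is_derive_plus (fun t => rho lam t x)).
          * apply A4. lra.
          * evar_last; [apply is_derive_scal; apply is_derive_id|]. unfold one; simpl; ring.
        + intros t _. specialize (Db t). apply Rabs_le_between in Db. lra.
        + intros t _. apply (continuous_plus (V := R_NormedModule)); [apply A2|].
          apply (continuous_scal_r (V := R_NormedModule)), continuous_id.
      - cut (- rho lam v x + - (K * C * x) * v <= - rho lam u x + - (K * C * x) * u); [nra|].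
        apply (derive_nonpos_le (fun t => - rho lam t x + - (K * C * x) * t)
          (fun t => - (rho lam t x * G lam t (rho lam t x)) + - (K * C * x))); auto.
        + intros t Ht. apply (is_derive_plus (fun t => - rho lam t x)).
          * apply (is_derive_opp (fun t => rho lam t x)). apply A4. lra.
          * evar_last; [apply is_derive_scal; apply is_derive_id|]. unfold one; simpl; ring.
        + intros t _. specialize (Db t). apply Rabs_le_between in Db. lra.
        + intros t _. apply (continuous_plus (V := R_NormedModule));
            [apply (continuous_opp (V := R_NormedModule)); apply A2|].
          apply (continuous_scal_r (V := R_NormedModule)), continuous_id. }
    intros u v. rewrite (A1 u), (A1 v).
    assert (0 <= K * C * x) by (destruct Hd; assert (0 <= K * C) by nra; nra).
    apply Rle_trans with (K * C * x * Rabs (clamp u - clamp v)).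
    - pose proof (clamp_range u). pose proof (clamp_range v).
      destruct (Rle_dec (clamp u) (clamp v)).
      + rewrite (Rabs_left1 (clamp u - clamp v)) by lra.
        rewrite Ropp_minus_distr. apply W; lra.
      + rewrite Rabs_minus_sym, (Rabs_pos_eq (clamp u - clamp v)) by lra.
        apply W; lra.
    - apply Rmult_le_compat_l; [lra|apply clamp_lip]. }
  (* Gronwall for the difference of two arcs. The rate 2C collects the variation and the size of G;
     the forcing K C g is the effect of lam, with rho <= K x; the initial values differ by at most 2
     C1 g. *)
  assert (Lx : forall lam x mu y, dom s lam x -> dom s mu y -> forall u,
     Rabs (rho lam u x - rho mu u y)
       <= (2 * C1 + K * C) * exp (2 * (2 * C) + 1) * (Rabs (x - y) + x * Rabs (lam - mu))).
  { intros lam x mu y Hd Hd' u.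
    pose proof (fun u => radial_dom r s G om rho lam x u Hs A Hd) as Hrd.
    pose proof (fun u => radial_dom r s G om rho mu y u Hs A Hd') as Hrd'.
    destruct (A lam x Hd) as [A0 [A1 [A2 [A3 A4]]]].
    destruct (A mu y Hd') as [E0 [E1 [E2 [E3 E4]]]].
    assert (Hx : 0 < x) by (destruct Hd; lra).
    set (g := Rabs (x - y) + x * Rabs (lam - mu)).
    assert (Hg : 0 <= g).
    { unfold g. pose proof (Rabs_pos (x - y)). pose proof (Rabs_pos (lam - mu)). nra. }
    assert (Hlm : x * Rabs (lam - mu) <= g).
    { unfold g. pose proof (Rabs_pos (x - y)). lra. }
    rewrite A1, E1.
    eapply Rle_trans.
    { apply (gronwall (fun u => rho lam u x - rho mu u y)
        (fun u => rho lam u x * G lam u (rho lam u x) - rho mu u y * G mu u (rho mu u y))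
        (2 * C) (K * C * g)); [lra| | | | |apply clamp_range].
      - assert (0 <= K * C) by nra. nra.
      - intros v Hv. apply (is_derive_minus (fun v => rho lam v x)); auto.
      - intros v Hv.
        replace (rho lam v x * G lam v (rho lam v x) - rho mu v y * G mu v (rho mu v y)) with
          (rho lam v x * (G lam v (rho lam v x) - G mu v (rho mu v y))
           + (rho lam v x - rho mu v y) * G mu v (rho mu v y)) by ring.
        eapply Rle_trans; [apply Rabs_triang|]. rewrite !Rabs_mult.
        rewrite (Rabs_pos_eq (rho lam v x)) by (specialize (A3 v); lra).
        specialize (L lam v _ mu v _ (Hrd v) (Hrd' v)). unfold gap in L.
        rewrite Rminus_diag, Rabs_R0, Rplus_0_r in L.
        assert (Rabs (rho lam v x - rho mu v y) * Rabs (G mu v (rho mu v y))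
           <= Rabs (rho lam v x - rho mu v y) * C)
          by (apply Rmult_le_compat_l; [apply Rabs_pos|auto]).
        assert (rho lam v x * Rabs (lam - mu) <= K * g).
        { apply Rle_trans with (K * x * Rabs (lam - mu)).
          - apply Rmult_le_compat_r; [apply Rabs_pos|]. apply HB; auto.
          - rewrite Rmult_assoc. apply Rmult_le_compat_l; auto. }
        assert (C * (rho lam v x * Rabs (lam - mu)) <= C * (K * g))
          by (apply Rmult_le_compat_l; auto).
        lra.
      - intros v. apply (continuous_minus (V := R_NormedModule)); auto. }
    cbv beta.
    assert (H0 : Rabs (rho lam 0 x - rho mu 0 y) <= 2 * C1 * g).
    { rewrite A0, E0.
      replace (x * om lam x - y * om mu y) with
        (x * (om lam x - om mu y) + (x - y) * om mu y) by ring.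
      eapply Rle_trans; [apply Rabs_triang|].
      rewrite !Rabs_mult, (Rabs_pos_eq x) by lra.
      specialize (Lom lam 0 x mu 0 y Hd Hd'). unfold gap in Lom.
      rewrite Rminus_diag, Rabs_R0, Rplus_0_r in Lom. fold g in Lom.
      assert (Rabs (x - y) * Rabs (om mu y) <= g * C1).
      { apply Rmult_le_compat; try apply Rabs_pos.
        - unfold g. pose proof (Rabs_pos (lam - mu)). nra.
        - apply (Bom mu 0 y Hd'). }
      lra. }
    replace ((2 * C1 + K * C) * exp (2 * (2 * C) + 1) * g) with
      ((2 * C1 + K * C) * g * exp (2 * (2 * C) + 1)) by ring.
    apply Rmult_le_compat_r; [left; apply exp_pos|]. lra. }
  set (M := (2 * C1 + K * C) * exp (2 * (2 * C) + 1)).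
  assert (HM : 0 <= M).
  { apply Rmult_le_pos; [|left; apply exp_pos]. assert (0 <= K * C) by nra. lra. }
  apply (div_x_tame s rho K (M + K * C)).
  - exact HK.
  - assert (0 <= K * C) by nra. lra.
  - intros lam u x Hd. split; [|apply HB; auto].
    destruct (A lam x Hd) as [_ [_ [_ [A3 _]]]]. specialize (A3 u). lra.
  - intros lam u x mu v y Hd Hd'.
    replace (rho lam u x - rho mu v y) with
      ((rho lam u x - rho lam v x) + (rho lam v x - rho mu v y)) by ring.
    eapply Rle_trans; [apply Rabs_triang|].
    specialize (Lu lam x Hd u v). specialize (Lx lam x mu y Hd Hd' v). fold M in Lx.
    unfold gap. destruct Hd as [_ Hx].
    pose proof (Rabs_pos (x - y)). pose proof (Rabs_pos (lam - mu)).
    pose proof (Rabs_pos (u - v)). assert (0 <= K * C) by nra.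
    assert (0 <= M * (x * Rabs (u - v))) by (apply Rmult_le_pos; nra).
    assert (0 <= K * C * (Rabs (x - y) + x * Rabs (lam - mu))) by (apply Rmult_le_pos; nra).
    nra.
Qed.

Lemma exp_lip M x y :
  Rabs x <= M -> Rabs y <= M -> Rabs (exp x - exp y) <= exp M * Rabs (x - y).
Proof.
  intros Hx Hy.
  destruct (MVT_gen exp y x exp) as [c [Hc E]].
  - intros. apply is_derive_Reals, derivable_pt_lim_exp.
  - intros. apply derivable_continuous_pt, derivable_pt_exp.
  - rewrite E, Rabs_mult. apply Rmult_le_compat_r; [apply Rabs_pos|].
    rewrite Rabs_pos_eq by (left; apply exp_pos).
    apply Rabs_le_between in Hx. apply Rabs_le_between in Hy.
    assert (c <= M).
    { eapply Rle_trans; [apply Hc|]. apply Rmax_lub; lra. }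
    destruct (Req_dec c M) as [->|]; [lra|left; apply exp_increasing; lra].
Qed.

Lemma tame_exp r phi : tame r phi -> tame r (fun lam u x => exp (phi lam u x)).
Proof.
  intros [C [HC [B L]]]. pose proof (exp_pos C) as HeC.
  exists (exp C + exp C * C). split; [nra|split].
  - intros. rewrite Rabs_pos_eq by (left; apply exp_pos).
    specialize (B lam u x H). apply Rabs_le_between in B.
    assert (exp (phi lam u x) <= exp C).
    { destruct (Req_dec (phi lam u x) C) as [->|]; [lra|left; apply exp_increasing; lra]. }
    nra.
  - intros. specialize (L lam u x mu v y H H0).
    pose proof (gap_ge0 r lam u x mu v y H) as Hg.
    pose proof (exp_lip C _ _ (B lam u x H) (B mu v y H0)) as E.
    destruct H as [_ [Hx _]].
    apply Rle_trans with (exp C * (x * Rabs (phi lam u x - phi mu v y))).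
    + rewrite <- Rmult_assoc, (Rmult_comm (exp C)), Rmult_assoc.
      apply Rmult_le_compat_l; lra.
    + apply Rle_trans with (exp C * (C * gap lam u x mu v y)).
      * apply Rmult_le_compat_l; lra.
      * nra.
Qed.

(** The circularity of the integral equation for [zeta] is harmless: its right-hand side carries a
    factor x, which is worth one order. Continuity and Lipschitz bounds for the first round come
    from [radial_tame]. *)
Lemma radial_smooth r s G om rho kappa :
  0 < s -> 0 < kappa -> s <= r -> smooth r G -> radial_arc r s G om rho ->
  smooth s (fun lam _ x => om lam x) ->
  (forall lam x, dom s lam x -> kappa <= om lam x) ->
  smooth s (fun lam u x => rho lam u x / x) /\
  exists kappa', 0 < kappa' /\ forall lam u x, dom s lam x -> kappa' <= rho lam u x / x.
Proof.
  intros Hs0 Hk Hs SG A Som Hom.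
  destruct (radial_tame r s G om rho kappa) as [T [k' [Hk' Hpsi]]]; auto;
    [lra|exact (SG 0%nat)|exact (Som 0%nat)|].
  split; [|exists k'; auto].
  destruct (smooth_split r G ltac:(lra) SG) as [G0 [G1 [TG0 [SG1 EG]]]].
  pose (psi := fun lam u x : R => rho lam u x / x).
  assert (Hcomp : forall lam u x, dom s lam x ->
            k' <= psi lam u x /\ x * psi lam u x < r).
  { intros lam u x Hd. split; [apply Hpsi; auto|].
    destruct (radial_dom r s G om rho lam x u Hs A Hd) as [_ H].
    destruct Hd as [_ Hx].
    replace (x * psi lam u x) with (rho lam u x) by (unfold psi; field; lra). lra. }
  pose (E := fun lam u : R => RInt (G0 lam) 0 (clamp u)).
  assert (TE : tame s (fun lam u _ => E lam u)).
  { apply (tame_le r); [exact Hs|].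
    apply (tame_RInt r (fun lam u _ => G0 lam u)). exact TG0. }
  assert (TmE : tame s (fun lam u _ => (-1) * E lam u)).
  { apply (tame_mult s (fun _ _ _ => -1)); [apply tame_const|exact TE]. }
  pose proof (tame_exp _ _ TE) as TexpE. pose proof (tame_exp _ _ TmE) as TexpmE.
  cbv beta in TexpE, TexpmE.
  assert (Siom : smooth s (fun lam _ x => / om lam x)).
  { intros m. apply (taylor_inv s m kappa (fun lam _ x => om lam x)); auto. }
  pose (zeta := fun lam u x : R => psi lam u x * / om lam x * exp ((-1) * E lam u)).
  assert (Tz : tame s zeta).
  { apply (tame_mult s (fun lam u x => psi lam u x * / om lam x)
             (fun lam u _ => exp ((-1) * E lam u))); [|exact TexpmE].
    apply (tame_mult s psi (fun lam _ x => / om lam x)); [exact T|apply (Siom 0%nat)]. }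
  assert (Epsi : forall lam u x, dom s lam x ->
            psi lam u x = om lam x * exp (E lam u) * zeta lam u x).
  { intros lam u x Hd. pose proof (Hom lam x Hd).
    assert (X : exp (E lam u) * exp ((-1) * E lam u) = 1).
    { rewrite <- exp_plus. replace (E lam u + -1 * E lam u) with 0 by ring. apply exp_0. }
    unfold zeta.
    replace (om lam x * exp (E lam u) * (psi lam u x * / om lam x * exp (-1 * E lam u)))
      with (psi lam u x * (om lam x * / om lam x) * (exp (E lam u) * exp ((-1) * E lam u)))
      by ring.
    rewrite X, Rinv_r by lra. ring. }
  pose (q := fun lam u x : R =>
    exp (E lam u) * (zeta lam u x * zeta lam u x) * G1 lam u (x * psi lam u x)).
  assert (Sq : forall m, taylor s m zeta -> taylor s m psi -> taylor s m q).
  { intros m Hz Hp.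
    apply (taylor_mult s m (fun lam u x => exp (E lam u) * (zeta lam u x * zeta lam u x))
      (fun lam u x => G1 lam u (x * psi lam u x))).
    - apply (taylor_mult s m (fun lam u x => exp (E lam u))).
      + apply (taylor_coef s m (fun lam u => exp (E lam u))). exact TexpE.
      + apply taylor_mult; auto.
    - apply (taylor_comp r s m k'); auto. }
  assert (Ez : forall lam u x, dom s lam x ->
     zeta lam u x = 1 + x * (om lam x * RInt (fun v => q lam v x) 0 (clamp u))).
  { intros lam u x Hd.
    pose proof (tame_ex_RInt s q lam x) as Eq.
    assert (Tq : tame s q) by (apply (Sq 0%nat); auto).
    pose proof (tame_continuous s q lam x Tq Hd) as Cq.
    pose proof (tame_continuous s zeta lam x Tz Hd) as Cz.
    pose proof (radial_dom r s G om rho lam x) as Hrd.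
    assert (Hrho : forall v, rho lam v x = x * psi lam v x).
    { intros v. destruct Hd as [_ Hx]. unfold psi. field. lra. }
    pose proof (Hom lam x Hd) as Homx.
    destruct (A lam x Hd) as [A0 [A1 [A2 [A3 A4]]]].
    pose (I := fun v : R => RInt (fun w => q lam w x) 0 v).
    assert (DI : forall v, is_derive I v (q lam v x)).
    { intros v. apply (is_derive_RInt (V := R_NormedModule) (fun w => q lam w x) I 0 v);
        [|apply Cq].
      apply filter_forall. intros w. apply (RInt_correct (V := R_CompleteNormedModule)).
      eapply tame_ex_RInt; eauto. }
    assert (Hdr : dom r lam x) by (eapply dom_le; eauto).
    pose (J := fun v : R => RInt (G0 lam) 0 v).
    assert (DJ : forall v, is_derive J v (G0 lam v)).
    { intros v. apply (is_derive_RInt (V := R_NormedModule) (G0 lam) J 0 v).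
      - apply filter_forall. intros w. apply (RInt_correct (V := R_CompleteNormedModule)).
        apply (tame_ex_RInt r (fun lam u _ => G0 lam u) lam x 0 w TG0 Hdr).
      - apply (tame_continuous r (fun lam u _ => G0 lam u) lam x TG0 Hdr). }
    assert (DIc : forall v, ex_derive I v) by (intros v; eexists; apply DI).
    assert (DJc : forall v, ex_derive J v) by (intros v; eexists; apply DJ).
    assert (EJ : forall v, 0 <= v <= 1 -> E lam v = J v).
    { intros v Hv. unfold E, J. rewrite clamp_id by lra. reflexivity. }
    (* [zeta] on [0, 1] written without [clamp], so that it can be differentiated. *)
    pose (Z := fun v : R => rho lam v x * (/ x * / om lam x) * exp ((-1) * J v)).
    assert (EZ : forall v, 0 <= v <= 1 -> zeta lam v x = Z v).
    { intros v Hv. unfold zeta, psi, Z. rewrite EJ by exact Hv. unfold Rdiv. ring. }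
    assert (Ec : zeta lam u x = zeta lam (clamp u) x).
    { unfold zeta, psi, E. rewrite (A1 u).
      rewrite (clamp_id (clamp u)) by apply clamp_range. reflexivity. }
    pose proof (clamp_range u) as Hcu.
    rewrite Ec, (EZ (clamp u) Hcu).
    (* The integral equation in differential form: this combination has zero derivative. The terms
       in G_0 cancel against the exponential factor, and what is left vanishes because exp(J)
       exp(-J) = 1 and x om times its inverse is 1. *)
    cut (Z (clamp u) - x * om lam x * I (clamp u) = Z 0 - x * om lam x * I 0).
    { intros F. unfold I in F.
      rewrite (RInt_point (V := R_CompleteNormedModule)) in F.
      unfold zero in F; simpl in F.
      assert (Z 0 = 1).
      { unfold Z, J. rewrite (RInt_point (V := R_CompleteNormedModule)).
        unfold zero; simpl. rewrite Rmult_0_r, exp_0, A0.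
        destruct Hd as [_ Hx]. field. lra. }
      lra. }
    apply (derive_zero_eq (fun v => Z v - x * om lam x * I v)
      (fun v => (rho lam v x * G lam v (rho lam v x)) * (/ x * / om lam x) * exp ((-1) * J v)
        + rho lam v x * (/ x * / om lam x) * ((- G0 lam v) * exp ((-1) * J v))
        - x * om lam x * q lam v x)); [lra| | |].
    - intros v Hv. apply (is_derive_minus Z).
      + assert (D4 := A4 v ltac:(lra)). assert (D5 := DJ v).
        unfold Z. auto_derive.
        * repeat split; [eexists; exact D4|apply DJc].
        * rewrite (is_derive_unique (fun w : R => rho lam w x) v _ D4).
          rewrite (is_derive_unique (fun w : R => J w) v _ D5). ring.
      + evar_last; [apply is_derive_scal; apply DI|]. reflexivity.
    - intros v Hv.
      assert (Hd' := radial_dom r s G om rho lam x v Hs A Hd).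
      rewrite (EG lam v _ Hd'). unfold q. rewrite EZ by lra. rewrite EJ by lra.
      rewrite <- Hrho. unfold Z.
      assert (X : exp (J v) * exp ((-1) * J v) = 1).
      { rewrite <- exp_plus. replace (J v + -1 * J v) with 0 by ring. apply exp_0. }
      set (e1 := exp (J v)) in *. set (e2 := exp (-1 * J v)) in *.
      assert (Xk : x * om lam x * (/ x * / om lam x) = 1)
        by (destruct Hd as [_ Hx]; field; lra).
      set (k := / x * / om lam x) in *. set (w := rho lam v x) in *.
      set (g := G1 lam v w).
      transitivity (w * w * k * g * e2 * (1 - (e1 * e2) * (x * om lam x * k))); [ring|].
      rewrite X, Xk. ring.
    - intros v _. apply (continuous_minus (V := R_NormedModule)).
      + apply (continuous_mult (K := R_AbsRing)
          (fun v => rho lam v x * (/ x * / om lam x)) (fun v => exp ((-1) * J v))).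
        * apply (continuous_mult (K := R_AbsRing) (fun v => rho lam v x));
            [apply A2|apply continuous_const].
        * apply (ex_derive_continuous (fun v => exp ((-1) * J v))).
          auto_derive. apply DJc.
      + apply (continuous_scal_r (V := R_NormedModule) (x * om lam x) I).
        apply (ex_derive_continuous I). apply DIc. }
  assert (Spsi : forall m, taylor s m zeta -> taylor s m psi).
  { intros m Hz. eapply taylor_ext; [intros; symmetry; apply Epsi; auto|].
    apply (taylor_mult s m (fun lam u x => om lam x * exp (E lam u))); [|exact Hz].
    apply (taylor_mult s m (fun lam _ x => om lam x)); [apply Som|].
    apply (taylor_coef s m (fun lam u => exp (E lam u))). exact TexpE. }
  (* The bootstrap: order m of [zeta] gives order m of [psi] and of [q], hence order m of the
     integral, and the factor x raises it to m + 1. *)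
  assert (Sz : forall m, taylor s m zeta).
  { induction m as [|m IH]; [exact Tz|].
    eapply taylor_ext; [intros; symmetry; apply Ez; auto|].
    apply (taylor_plus s (S m) (fun _ _ _ => 1)).
    - apply (taylor_coef s (S m) (fun _ _ => 1)), tame_const.
    - apply taylor_mulx. apply (taylor_mult s m (fun lam _ x => om lam x)); [apply Som|].
      apply taylor_RInt. apply Sq; auto. }
  intros m. apply Spsi, Sz.
Qed.

(** * The angular variable as a new time *)

(** Isolates the first time a level is reached, so that a bound valid below the level can be shown
    to persist. *)
Lemma first_exit (f : R -> R) a b r :
  a <= b -> (forall t, continuous f t) -> f a < r -> r <= f b ->
  exists s, a <= s <= b /\ r <= f s /\ forall t, a <= t < s -> f t < r.
Proof.
  intros Hab Cf Ha Hb.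
  destruct (completeness (fun s => a <= s <= b /\ forall t, a <= t <= s -> f t < r))
    as [s [Hub Hlub]].
  - exists b. intros s [Hs _]. lra.
  - exists a. split; [lra|]. intros t Ht. replace t with a by lra. exact Ha.
  - assert (Has : a <= s).
    { apply Hub. split; [lra|]. intros t Ht. replace t with a by lra. exact Ha. }
    assert (Hsb : s <= b) by (apply Hlub; intros z [Hz _]; lra).
    assert (Hlt : forall t, a <= t < s -> f t < r).
    { intros t Ht. apply Rnot_le_lt. intros Hle.
      assert (s <= t); [|lra].
      apply Hlub. intros z [Hz1 Hz2]. apply Rnot_lt_le. intros Hzt.
      specialize (Hz2 t ltac:(lra)). lra. }
    exists s. split; [lra|split; [|exact Hlt]].
    apply Rnot_lt_le. intros Hfs.
    assert (Hloc : locally s (fun t => f t < r)).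
    { apply (Cf s (fun y => y < r)). apply (open_lt r). exact Hfs. }
    destruct Hloc as [eps Heps].
    assert (Hsb' : s <> b) by (intros ->; lra).
    pose proof (cond_pos eps) as Hpos.
    assert (Rmin b (s + eps / 2) <= s).
    { apply Hub. split.
      - split; [apply Rmin_glb; lra|apply Rmin_l].
      - intros t [Ht1 Ht2]. destruct (Rlt_dec t s); [apply Hlt; lra|].
        apply Heps. change (Rabs (t - s) < eps).
        pose proof (Rmin_r b (s + eps / 2)). rewrite Rabs_pos_eq; lra. }
    assert (s < Rmin b (s + eps / 2)) by (apply Rmin_glb_lt; lra). lra.
Qed.

(** Only a local right inverse with a Lipschitz bound is required: that bound makes the increment k
    of T small with h, and the difference quotient of T is the inverse of the chord slope h/k of
    w. *)
Lemma is_derive_inverse (w T : R -> R) v d kappa eta :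
  0 < kappa -> 0 < eta -> is_derive w (T v) d -> kappa <= d ->
  (forall h, Rabs h < eta -> w (T (v + h)) = v + h) ->
  (forall h, Rabs h < eta -> kappa * Rabs (T (v + h) - T v) <= Rabs h) ->
  is_derive T v (/ d).
Proof.
  intros Hk Heta Dw Hd Hw HT. apply is_derive_Reals in Dw. apply is_derive_Reals.
  assert (Hw0 : w (T v) = v).
  { specialize (Hw 0). rewrite Rplus_0_r in Hw. apply Hw. rewrite Rabs_R0. exact Heta. }
  intros eps Heps.
  assert (Hkk : 0 < eps * (kappa * kappa)) by (apply Rmult_lt_0_compat; nra).
  (* The bound kappa/2 keeps the chord slope above kappa/2; then the error e2/2 divided by kappa
     times kappa/2 is e2 / kappa^2, at most eps. *)
  set (e2 := Rmin (eps * (kappa * kappa)) (kappa / 2)).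
  assert (He2 : 0 < e2) by (apply Rmin_glb_lt; lra).
  destruct (Dw (e2 / 2) ltac:(lra)) as [del Hdel].
  pose proof (cond_pos del) as Hdelp.
  assert (Hdd : 0 < Rmin eta (kappa * del)) by (apply Rmin_glb_lt; nra).
  exists (mkposreal _ Hdd). simpl. intros h Hh Hhd.
  assert (Hh1 : Rabs h < eta) by (eapply Rlt_le_trans; [exact Hhd|apply Rmin_l]).
  assert (Hh2 : Rabs h < kappa * del) by (eapply Rlt_le_trans; [exact Hhd|apply Rmin_r]).
  set (k := T (v + h) - T v) in *.
  specialize (HT h Hh1). fold k in HT.
  assert (Hk0 : k <> 0).
  { intros E. apply Hh. assert (T (v + h) = T v) by (unfold k in E; lra).
    specialize (Hw h Hh1). rewrite H, Hw0 in Hw. lra. }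
  assert (Hkd : Rabs k < del).
  { apply (Rmult_lt_reg_l kappa); lra. }
  specialize (Hdel k Hk0 Hkd).
  replace (T v + k) with (T (v + h)) in Hdel by (unfold k; ring).
  rewrite Hw, Hw0 in Hdel by exact Hh1.
  replace (v + h - v) with h in Hdel by ring.
  assert (Hslope : kappa / 2 <= h / k).
  { apply Rabs_lt_between in Hdel. pose proof (Rmin_r (eps * (kappa * kappa)) (kappa / 2)).
    fold e2 in H. lra. }
  assert (Hsl0 : 0 < h / k) by lra.
  replace (k / h - / d) with ((d - h / k) * (/ d * / (h / k))).
  2:{ field. repeat split; auto; lra. }
  rewrite Rabs_mult, Rabs_minus_sym, (Rabs_pos_eq (/ d * _)).
  2:{ apply Rmult_le_pos; left; apply Rinv_0_lt_compat; lra. }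
  apply Rlt_le_trans with (e2 / 2 * (/ d * / (h / k))).
  { apply Rmult_lt_compat_r; [|exact Hdel].
    apply Rmult_lt_0_compat; apply Rinv_0_lt_compat; lra. }
  apply Rle_trans with (e2 / 2 * (/ kappa * / (kappa / 2))).
  { apply Rmult_le_compat_l; [lra|]. apply Rmult_le_compat.
    - left; apply Rinv_0_lt_compat; lra.
    - left; apply Rinv_0_lt_compat; lra.
    - apply Rinv_le_contravar; lra.
    - apply Rinv_le_contravar; lra. }
  replace (e2 / 2 * (/ kappa * / (kappa / 2))) with (e2 * / (kappa * kappa)) by (field; lra).
  apply (Rmult_le_reg_r (kappa * kappa)); [nra|].
  rewrite Rmult_assoc, Rinv_l by nra. rewrite Rmult_1_r. apply Rmin_l.
Qed.

(* With [rho = y1 + y2] and [w = y2 / rho], the field in the open first quadrant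
   becomes [rho' = rho N(w, rho)], [w' = D(w, rho)], and [w] serves as the new time. *)
Lemma quarter_turn (r kappa M : R) (N D F1 F2 : R -> R -> R) (y1 y2 : R -> R)
    (t0 t1 p q : R) :
  0 < kappa -> 0 <= M -> t0 < t1 ->
  (forall u z, 0 <= u <= 1 -> 0 < z < r ->
     F1 (z * (1 - u)) (z * u) + F2 (z * (1 - u)) (z * u) = z * N u z /\
     (1 - u) * F2 (z * (1 - u)) (z * u) - u * F1 (z * (1 - u)) (z * u) = z * D u z /\
     kappa <= D u z /\ Rabs (N u z) <= M * D u z) ->
  (forall t, continuous y1 t) -> (forall t, continuous y2 t) ->
  (forall t, 0 < y1 t + y2 t) ->
  (forall t, t0 < t < t1 -> 0 < y1 t /\ 0 < y2 t /\
     is_derive y1 t (F1 (y1 t) (y2 t)) /\ is_derive y2 t (F2 (y1 t) (y2 t))) ->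
  y1 t0 = p -> y2 t0 = 0 -> y1 t1 = 0 -> y2 t1 = q -> p * exp M < r ->
  exists rho : R -> R,
    rho 0 = p /\ rho 1 = q /\ (forall u, rho u = rho (clamp u)) /\
    (forall u, continuous rho u) /\ (forall u, 0 < rho u <= p * exp M) /\
    (forall u, 0 < u < 1 -> is_derive rho u (rho u * (N u (rho u) / D u (rho u)))).
Proof.
  intros Hk HM Ht HF C1 C2 P DY Y10 Y20 Y11 Y21 Hp.
  set (rho := fun t => y1 t + y2 t). set (w := fun t => y2 t / rho t).
  assert (Crho : forall t, continuous rho t).
  { intros t. apply (continuous_plus (V := R_NormedModule)); auto. }
  assert (Hrho : forall t, 0 < rho t) by exact P.
  assert (Cw : forall t, continuous w t).
  { intros t. apply (continuous_mult (K := R_AbsRing) y2 (fun t => / rho t)); [apply C2|].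
    apply continuous_comp; [apply Crho|].
    apply continuity_pt_filterlim, continuity_pt_inv; [|specialize (Hrho t); lra].
    apply derivable_continuous_pt, derivable_pt_id. }
  assert (W0 : w t0 = 0) by (unfold w; rewrite Y20; unfold Rdiv; ring).
  assert (W1 : w t1 = 1).
  { unfold w, rho. pose proof (P t1). rewrite Y11 in *. field. lra. }
  assert (Wr : forall t, t0 < t < t1 -> 0 < w t < 1).
  { intros t Hi. destruct (DY t Hi) as [A1 [A2 _]]. pose proof (Hrho t).
    unfold w. split; [apply Rdiv_lt_0_compat; lra|].
    apply (Rmult_lt_reg_r (rho t)); [lra|]. unfold Rdiv, rho in *.
    rewrite Rmult_assoc, Rinv_l by lra. lra. }
  assert (Wc : forall t, t0 <= t <= t1 -> 0 <= w t <= 1).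
  { intros t Hi. destruct (Req_dec t t0) as [->|]; [lra|].
    destruct (Req_dec t t1) as [->|]; [lra|]. specialize (Wr t). lra. }
  assert (DR : forall t, t0 < t < t1 -> rho t < r ->
     is_derive rho t (rho t * N (w t) (rho t)) /\ is_derive w t (D (w t) (rho t)) /\
     kappa <= D (w t) (rho t) /\ Rabs (N (w t) (rho t)) <= M * D (w t) (rho t)).
  { intros t Hi Hlt. destruct (DY t Hi) as [A1 [A2 [A3 A4]]].
    pose proof (Hrho t) as Hpt. pose proof (Wr t Hi).
    destruct (HF (w t) (rho t) ltac:(lra) ltac:(lra)) as [B1 [B2 [B3 B4]]].
    assert (E1 : rho t * (1 - w t) = y1 t) by (unfold w, rho in *; field; lra).
    assert (E2 : rho t * w t = y2 t) by (unfold w, rho in *; field; lra).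
    rewrite E1, E2 in B1, B2.
    assert (Drho : is_derive rho t (rho t * N (w t) (rho t))).
    { rewrite <- B1. apply (is_derive_plus y1 y2); auto. }
    refine (conj Drho (conj _ (conj B3 B4))).
    evar_last; [apply (is_derive_div y2 rho); [exact A4|exact Drho|lra]|].
    rewrite <- B1.
    apply (Rmult_eq_reg_l (rho t)); [|lra]. rewrite <- B2.
    set (f1 := F1 (y1 t) (y2 t)). set (f2 := F2 (y1 t) (y2 t)).
    rewrite <- E2. field. lra. }
  (* rho exp(-M w) decreases since |N| <= M D. As w only runs from 0 to 1, the growth factor exp(M)
     does not involve the duration of the crossing. *)
  assert (Bd : forall s, t0 <= s <= t1 -> (forall t, t0 < t < s -> rho t < r) ->
            rho s <= p * exp M).
  { intros s Hs Hlt.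
    assert (H : rho s * exp (- M * w s) <= rho t0 * exp (- M * w t0)).
    { apply (derive_nonpos_le (fun t => rho t * exp (- M * w t))
        (fun t => (rho t * (N (w t) (rho t) - M * D (w t) (rho t))) * exp (- M * w t)));
        [lra| | |].
      - intros t Hi. destruct (DR t ltac:(lra) ltac:(apply Hlt; lra)) as [A1 [A2 _]].
        auto_derive.
        + repeat split; eexists; eassumption.
        + rewrite (is_derive_unique (fun x : R => rho x) t _ A1).
          rewrite (is_derive_unique (fun x : R => w x) t _ A2). ring.
      - intros t Hi. destruct (DR t ltac:(lra) ltac:(apply Hlt; lra)) as [_ [_ [_ A4]]].
        pose proof (Rle_abs (N (w t) (rho t))). pose proof (exp_pos (- M * w t)).
        pose proof (Hrho t).
        assert (rho t * (N (w t) (rho t) - M * D (w t) (rho t)) <= 0) by nra. nra.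
      - intros t _. apply (continuous_mult (K := R_AbsRing) rho (fun t => exp (- M * w t)));
          [apply Crho|].
        apply (continuous_comp (fun t => - M * w t) exp).
        + apply (continuous_scal_r (V := R_NormedModule) (- M) w). apply Cw.
        + apply (ex_derive_continuous exp). auto_derive. trivial. }
    assert (E0 : rho t0 = p) by (unfold rho; rewrite Y10, Y20; ring).
    rewrite W0, E0, Rmult_0_r, exp_0, Rmult_1_r in H.
    assert (E : exp (- M * w s) * exp (M * w s) = 1).
    { rewrite <- exp_plus. replace (- M * w s + M * w s) with 0 by ring. apply exp_0. }
    assert (Ew : exp (M * w s) <= exp M).
    { specialize (Wc s Hs). assert (M * w s <= M) by nra.
      destruct (Req_dec (M * w s) M) as [->|]; [lra|left; apply exp_increasing; lra]. }
    pose proof (exp_pos (M * w s)). pose proof (Hrho t0).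
    replace (rho s) with (rho s * exp (- M * w s) * exp (M * w s))
      by (rewrite Rmult_assoc, E; ring).
    apply Rmult_le_compat; try lra.
    apply Rmult_le_pos; [left; apply Hrho|left; apply exp_pos]. }
  assert (Hp0 : 0 < p) by (specialize (P t0); rewrite Y10, Y20 in P; lra).
  (* Continuity argument: at a first exit the bound p exp(M) < r would already hold, a
     contradiction. *)
  assert (Hlt : forall t, t0 <= t <= t1 -> rho t < r).
  { intros t Hi. apply Rnot_le_lt. intros Hle.
    destruct (first_exit rho t0 t r) as [s [Hs [Hs1 Hs2]]]; auto; [lra| |].
    - apply Rle_lt_trans with (p * exp M); [|exact Hp]. apply Bd; [lra|intros; lra].
    - assert (rho s <= p * exp M); [|lra]. apply Bd; [lra|]. intros; apply Hs2; lra. }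
  assert (Inc : forall s t, t0 <= s <= t -> t <= t1 -> kappa * (t - s) <= w t - w s).
  { intros s t Hs Htt.
    cut (- w t + kappa * t <= - w s + kappa * s); [lra|].
    apply (derive_nonpos_le (fun t => - w t + kappa * t)
      (fun t => - D (w t) (rho t) + kappa)); [lra| | |].
    - intros z Hz. destruct (DR z ltac:(lra) ltac:(apply Hlt; lra)) as [_ [A2 _]].
      apply (is_derive_plus (fun t => - w t)); [apply (is_derive_opp w); exact A2|].
      evar_last; [apply is_derive_scal, is_derive_id|]. unfold one; simpl; ring.
    - intros z Hz. destruct (DR z ltac:(lra) ltac:(apply Hlt; lra)) as [_ [_ [A3 _]]]. lra.
    - intros z _. apply (continuous_plus (V := R_NormedModule) (fun t => - w t)).
      + apply (continuous_opp (V := R_NormedModule)), Cw.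
      + apply (continuous_scal_r (V := R_NormedModule)), continuous_id. }
  assert (Inv : forall s t, t0 <= s <= t1 -> t0 <= t <= t1 ->
            kappa * Rabs (t - s) <= Rabs (w t - w s)).
  { intros s t Hs Htt. destruct (Rle_dec s t).
    - specialize (Inc s t ltac:(lra) ltac:(lra)).
      pose proof (Rle_abs (w t - w s)). rewrite (Rabs_pos_eq (t - s)); lra.
    - specialize (Inc t s ltac:(lra) ltac:(lra)).
      pose proof (Rle_abs (w s - w t)). rewrite Rabs_minus_sym, (Rabs_minus_sym (w t)).
      rewrite (Rabs_pos_eq (s - t)); lra. }
  (* The inverse of w, extended by constants through [clamp]; it exists by intermediate values, and
     is unique and Lipschitz because w grows at rate at least kappa. *)
  assert (Ex : forall v, {t | t0 <= t <= t1 /\ w t = clamp v}).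
  { intros v. destruct (IVT_gen w t0 t1 (clamp v)) as [t [Ht1 Ht2]].
    - intros t. apply continuity_pt_filterlim, Cw.
    - rewrite W0, W1, Rmin_left, Rmax_right by lra. apply clamp_range.
    - rewrite Rmin_left, Rmax_right in Ht1 by lra. exists t. auto. }
  set (T := fun v => proj1_sig (Ex v)).
  assert (HT : forall v, t0 <= T v <= t1 /\ w (T v) = clamp v)
    by (intros v; exact (proj2_sig (Ex v))).
  assert (Tinj : forall t v, t0 <= t <= t1 -> w t = clamp v -> T v = t).
  { intros t v Hi E. destruct (HT v) as [H1 H2].
    specialize (Inv t (T v) Hi H1). rewrite H2, E, Rminus_diag, Rabs_R0 in Inv.
    pose proof (Rabs_pos (T v - t)).
    assert (Rabs (T v - t) = 0) by nra.
    destruct (Req_dec (T v - t) 0); [lra|]. exfalso. eapply Rabs_no_R0; eauto. }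
  assert (Tlip : forall v v', kappa * Rabs (T v - T v') <= Rabs (v - v')).
  { intros v v'. destruct (HT v) as [H1 H2]. destruct (HT v') as [H3 H4].
    eapply Rle_trans; [apply Inv; auto|]. rewrite H2, H4. apply clamp_lip. }
  assert (CT : forall v, continuous T v).
  { apply (lipschitz_continuous T (/ kappa)). intros v v'.
    apply (Rmult_le_reg_l kappa); [lra|]. rewrite <- Rmult_assoc, Rinv_r by lra.
    rewrite Rmult_1_l. apply Tlip. }
  assert (T0 : T 0 = t0) by (apply Tinj; [lra|rewrite clamp_id by lra; exact W0]).
  assert (T1 : T 1 = t1) by (apply Tinj; [lra|rewrite clamp_id by lra; exact W1]).
  exists (fun v => rho (T v)).
  split; [|split; [|split; [|split; [|split; [split|]]]]].
  - rewrite T0. unfold rho. rewrite Y10, Y20. ring.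
  - rewrite T1. unfold rho. rewrite Y11, Y21. ring.
  - intros u. f_equal. apply Tinj; [apply HT|].
    destruct (HT (clamp u)) as [_ ->]. apply clamp_id, clamp_range.
  - intros u. apply (continuous_comp T rho); auto.
  - apply Hrho.
  - apply Bd; [apply HT|]. intros t Hi. apply Hlt. destruct (HT u). lra.
  - intros u Hu.
    destruct (HT u) as [H1 H2]. rewrite clamp_id in H2 by lra.
    assert (Hi : t0 < T u < t1).
    { split; apply Rnot_le_lt; intros Hle.
      - assert (E : T u = t0) by lra. rewrite E, W0 in H2. lra.
      - assert (E : T u = t1) by lra. rewrite E, W1 in H2. lra. }
    destruct (DR (T u) Hi ltac:(apply Hlt; lra)) as [A1 [A2 [A3 A4]]].
    rewrite H2 in A1, A2, A3.
    assert (DT : is_derive T u (/ D u (rho (T u)))).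
    { apply (is_derive_inverse w T u _ kappa (Rmin u (1 - u))); auto.
      - apply Rmin_glb_lt; lra.
      - intros h Hh. pose proof (Rmin_l u (1 - u)). pose proof (Rmin_r u (1 - u)).
        apply Rabs_lt_between in Hh.
        destruct (HT (u + h)) as [_ ->]. apply clamp_id. lra.
      - intros h _. replace (Rabs h) with (Rabs (u + h - u)) by (f_equal; ring). apply Tlip. }
    evar_last; [apply (is_derive_comp rho T); [exact A1|exact DT]|].
    unfold scal; simpl; unfold mult; simpl. field. lra.
Qed.

(** * Expansions of analytic functions along rays *)

(** The degree-n part of the series with its monomials replaced by arbitrary weights. Dividing the
    series by a power of z along a ray only changes the weight. *)
Definition weighted_part (c W : nat -> nat -> nat -> R) (n : nat) : R :=
  sum_n (fun i => sum_n (fun j => c i j (n - i - j)%nat * W i j (n - i - j)%nat) (n - i)) n.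

Lemma sum_n_eq (f g : nat -> R) n :
  (forall i, f i = g i :> R) -> sum_n f n = sum_n g n :> R.
Proof. intros H. apply sum_n_ext. exact H. Qed.

Lemma sum_n_lin (f g : nat -> R) a b n :
  sum_n (fun i => a * f i + b * g i) n = a * sum_n f n + b * sum_n g n :> R.
Proof.
  induction n as [|n IH]; [rewrite !sum_O; ring|].
  rewrite !sum_Sn, IH. unfold plus; simpl. ring.
Qed.

Lemma sum_n_abs_le (f g : nat -> R) n :
  (forall i, Rabs (f i) <= g i) -> Rabs (sum_n f n) <= sum_n g n.
Proof.
  intros H. induction n as [|n IH]; [rewrite !sum_O; auto|].
  rewrite !sum_Sn. unfold plus; simpl.
  eapply Rle_trans; [apply Rabs_triang|]. apply Rplus_le_compat; auto.
Qed.

Lemma weighted_part_lin c W W' a b n :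
  weighted_part c (fun i j m => a * W i j m + b * W' i j m) n
  = a * weighted_part c W n + b * weighted_part c W' n.
Proof.
  unfold weighted_part. rewrite <- sum_n_lin. apply sum_n_eq. intros i.
  rewrite <- sum_n_lin. apply sum_n_eq. intros j. ring.
Qed.

Lemma weighted_part_le c W r K n :
  (forall i j m, Rabs (W i j m) <= K * r ^ (i + j + m)) ->
  Rabs (weighted_part c W n)
    <= K * homogeneous_part (fun i j m => Rabs (c i j m)) n r r r.
Proof.
  intros HW. unfold weighted_part, homogeneous_part.
  replace (K * _) with (K * sum_n (fun i => sum_n (fun j =>
     Rabs (c i j (n - i - j)%nat) * r ^ i * r ^ j * r ^ (n - i - j)) (n - i)) n
     + 0 * sum_n (fun _ => 0) n) by ring.
  rewrite <- sum_n_lin. apply sum_n_abs_le. intros i.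
  replace (_ + _) with (K * sum_n (fun j =>
     Rabs (c i j (n - i - j)%nat) * r ^ i * r ^ j * r ^ (n - i - j)) (n - i)
     + 0 * sum_n (fun _ => 0) (n - i)) by ring.
  rewrite <- sum_n_lin. apply sum_n_abs_le. intros j.
  rewrite Rabs_mult. specialize (HW i j (n - i - j)%nat).
  rewrite !pow_add in HW.
  pose proof (Rabs_pos (c i j (n - i - j)%nat)).
  replace (_ + _) with (Rabs (c i j (n - i - j)%nat) * (K * (r ^ i * r ^ j * r ^ (n - i - j))))
    by ring.
  apply Rmult_le_compat_l; auto.
Qed.

(** The factor q on the left avoids the exponent n - 1. *)
Lemma pow_lip q x y n :
  0 <= q -> Rabs x <= q -> Rabs y <= q ->
  q * Rabs (x ^ n - y ^ n) <= INR n * q ^ n * Rabs (x - y).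
Proof.
  intros Hq Hx Hy. induction n as [|n IH].
  - simpl. rewrite Rminus_diag, Rabs_R0. lra.
  - rewrite S_INR. simpl pow.
    replace (x * x ^ n - y * y ^ n) with (x * (x ^ n - y ^ n) + (x - y) * y ^ n) by ring.
    eapply Rle_trans; [apply Rmult_le_compat_l; [lra|apply Rabs_triang]|].
    rewrite !Rabs_mult.
    assert (Rabs (y ^ n) <= q ^ n).
    { rewrite <- RPow_abs. apply pow_incr. split; [apply Rabs_pos|exact Hy]. }
    assert (Rabs x * (q * Rabs (x ^ n - y ^ n)) <= q * (INR n * q ^ n * Rabs (x - y))).
    { apply Rmult_le_compat; auto using Rabs_pos.
      apply Rmult_le_pos; [lra|apply Rabs_pos]. }
    assert (q * (Rabs (x - y) * Rabs (y ^ n)) <= q * (Rabs (x - y) * q ^ n)).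
    { apply Rmult_le_compat_l; [lra|]. apply Rmult_le_compat_l; [apply Rabs_pos|exact H]. }
    lra.
Qed.

Lemma INR_le_pow2 n : INR n <= 2 ^ n.
Proof.
  induction n as [|n IH]; [simpl; lra|]. rewrite S_INR. simpl.
  pose proof (pow_R1_Rle 2 n ltac:(lra)). lra.
Qed.

Lemma pow_abs_le q x n : Rabs x <= q -> Rabs (x ^ n) <= q ^ n.
Proof.
  intros H. rewrite <- RPow_abs. apply pow_incr. split; [apply Rabs_pos|exact H].
Qed.

Definition direction (e : R -> R) : Prop :=
  (forall u, Rabs (e u) <= 1) /\ forall u v, Rabs (e u - e v) <= Rabs (u - v).

(** On the ray z (e1 u, e2 u) the monomial of degree d = i + j in the plane contributes z^d; [T d z]
    stands in its place. *)
Definition weight (T : nat -> R -> R) (e1 e2 : R -> R) (lam u z : R) (i j m : nat) : R :=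
  T (i + j)%nat z * (e1 u ^ i * e2 u ^ j) * lam ^ m.

(** Halving the radius pays for the differentiations. In u the Lipschitz constant i + j of the
    directions is at most 2^(i+j), which the factor 2^d in the bound on [T] absorbs; in lam the
    factor m is absorbed by (r/2)^m, at the price of 2/r. Everything is dominated by the series at
    (r, r, r). *)
Lemma weighted_tame c r K T e1 e2 :
  0 < r -> 0 <= K -> direction e1 -> direction e2 ->
  ex_series (fun n => homogeneous_part (fun i j m => Rabs (c i j m)) n r r r) ->
  (forall d z, 0 < z < r / 2 -> 2 ^ d * Rabs (T d z) <= K * r ^ d) ->
  (forall d z z', 0 < z < r / 2 -> 0 < z' < r / 2 ->
     Rabs (T d z - T d z') <= K * r ^ d * Rabs (z - z')) ->
  tame (r / 2) (fun lam u z => Series (weighted_part c (weight T e1 e2 lam u z))) /\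
  forall lam u z, dom (r / 2) lam z ->
    ex_series (weighted_part c (weight T e1 e2 lam u z)).
Proof.
  intros Hr HK [B1 L1] [B2 L2] Hc BT LT.
  set (A := fun n => homogeneous_part (fun i j m => Rabs (c i j m)) n r r r).
  assert (Rp : forall n, 0 < r ^ n) by (intros; apply pow_lt; exact Hr).
  assert (E1 : forall d z, 0 < z < r / 2 -> Rabs (T d z) <= K * r ^ d).
  { intros d z Hz. eapply Rle_trans; [|apply (BT d z Hz)].
    pose proof (pow_R1_Rle 2 d ltac:(lra)). pose proof (Rabs_pos (T d z)). nra. }
  assert (Be : forall u i j, Rabs (e1 u ^ i * e2 u ^ j) <= 1).
  { intros. rewrite Rabs_mult. pose proof (pow_abs_le 1 _ i (B1 u)) as P1.
    pose proof (pow_abs_le 1 _ j (B2 u)) as P2. rewrite pow1 in P1, P2.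
    pose proof (Rabs_pos (e1 u ^ i)). pose proof (Rabs_pos (e2 u ^ j)). nra. }
  assert (Le : forall u v i j,
     Rabs (e1 u ^ i * e2 u ^ j - e1 v ^ i * e2 v ^ j) <= 2 ^ (i + j) * Rabs (u - v)).
  { intros. pose proof (pow_lip 1 _ _ i ltac:(lra) (B1 u) (B1 v)) as P1.
    pose proof (pow_lip 1 _ _ j ltac:(lra) (B2 u) (B2 v)) as P2.
    rewrite pow1 in P1, P2.
    pose proof (pow_abs_le 1 _ i (B1 u)) as P3.
    pose proof (pow_abs_le 1 _ j (B2 v)) as P4. rewrite pow1 in P3, P4.
    replace (e1 u ^ i * e2 u ^ j - e1 v ^ i * e2 v ^ j) with
      (e1 u ^ i * (e2 u ^ j - e2 v ^ j) + (e1 u ^ i - e1 v ^ i) * e2 v ^ j) by ring.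
    eapply Rle_trans; [apply Rabs_triang|]. rewrite !Rabs_mult.
    pose proof (Rabs_pos (e1 u ^ i)). pose proof (Rabs_pos (e2 v ^ j)).
    pose proof (Rabs_pos (e1 u ^ i - e1 v ^ i)). pose proof (Rabs_pos (e2 u ^ j - e2 v ^ j)).
    pose proof (pos_INR i). pose proof (pos_INR j). pose proof (Rabs_pos (u - v)).
    assert (Rabs (e1 u ^ i - e1 v ^ i) <= INR i * Rabs (u - v)).
    { specialize (L1 u v). nra. }
    assert (Rabs (e2 u ^ j - e2 v ^ j) <= INR j * Rabs (u - v)).
    { specialize (L2 u v). nra. }
    assert (INR i + INR j <= 2 ^ (i + j)) by (rewrite <- plus_INR; apply INR_le_pow2).
    nra. }
  assert (Bl : forall lam m, Rabs lam < r / 2 -> Rabs (lam ^ m) <= r ^ m).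
  { intros. apply pow_abs_le. lra. }
  assert (Ll : forall lam mu m, Rabs lam < r / 2 -> Rabs mu < r / 2 ->
     Rabs (lam ^ m - mu ^ m) <= 2 / r * r ^ m * Rabs (lam - mu)).
  { intros lam mu m H1 H2.
    pose proof (pow_lip (r / 2) lam mu m ltac:(lra) ltac:(lra) ltac:(lra)) as P.
    assert (INR m * (r / 2) ^ m <= r ^ m).
    { replace (r ^ m) with (2 ^ m * (r / 2) ^ m)
        by (rewrite <- Rpow_mult_distr; f_equal; field).
      apply Rmult_le_compat_r; [apply pow_le; lra|apply INR_le_pow2]. }
    apply (Rmult_le_reg_l (r / 2)); [lra|]. eapply Rle_trans; [exact P|].
    replace (r / 2 * (2 / r * r ^ m * Rabs (lam - mu))) with (r ^ m * Rabs (lam - mu))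
      by (field; lra).
    apply Rmult_le_compat_r; [apply Rabs_pos|exact H]. }
  assert (BW : forall lam u z, dom (r / 2) lam z -> forall i j m,
     Rabs (weight T e1 e2 lam u z i j m) <= K * r ^ (i + j + m)).
  { intros lam u z [Hl Hz] i j m. unfold weight. rewrite !Rabs_mult, (pow_add r (i + j)).
    specialize (E1 (i + j)%nat z Hz). specialize (Be u i j). specialize (Bl lam m Hl).
    rewrite Rabs_mult in Be.
    replace (K * (r ^ (i + j) * r ^ m)) with (K * r ^ (i + j) * 1 * r ^ m) by ring.
    assert (0 <= Rabs (e1 u ^ i) * Rabs (e2 u ^ j)) by (apply Rmult_le_pos; apply Rabs_pos).
    apply Rmult_le_compat; auto using Rabs_pos.
    - apply Rmult_le_pos; [apply Rabs_pos|auto].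
    - apply Rmult_le_compat; auto using Rabs_pos. }
  assert (LW : forall lam u z mu v z', dom (r / 2) lam z -> dom (r / 2) mu z' -> forall i j m,
     Rabs (weight T e1 e2 lam u z i j m - weight T e1 e2 mu v z' i j m)
       <= (K * (1 + 2 / r) * (Rabs (z - z') + Rabs (u - v) + Rabs (lam - mu)))
          * r ^ (i + j + m)).
  { intros lam u z mu v z' [Hl Hz] [Hl' Hz'] i j m. unfold weight.
    rewrite (pow_add r (i + j)).
    pose proof (LT (i + j)%nat z z' Hz Hz') as LT'.
    pose proof (Be u i j) as Beu. pose proof (Be v i j) as Bev.
    pose proof (Bl lam m Hl) as Bll. specialize (Le u v i j).
    specialize (Ll lam mu m Hl Hl'). specialize (E1 (i + j)%nat z' Hz').
    specialize (BT (i + j)%nat z' Hz').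
    set (t := T (i + j)%nat z) in *. set (t' := T (i + j)%nat z') in *.
    set (e := e1 u ^ i * e2 u ^ j) in *. set (e' := e1 v ^ i * e2 v ^ j) in *.
    set (k := lam ^ m) in *. set (k' := mu ^ m) in *.
    set (P := r ^ (i + j)) in *. set (Q := r ^ m) in *.
    assert (HP : 0 < P) by apply Rp. assert (HQ : 0 < Q) by apply Rp.
    assert (H2r : 0 < 2 / r) by (apply Rdiv_lt_0_compat; lra).
    replace (t * e * k - t' * e' * k') with
      ((t - t') * (e * k) + (t' * (e - e')) * k + (t' * e') * (k - k')) by ring.
    eapply Rle_trans; [apply Rabs_triang|].
    eapply Rle_trans; [apply Rplus_le_compat_r, Rabs_triang|].
    rewrite (Rabs_mult (t - t')), (Rabs_mult (t' * (e - e'))), (Rabs_mult (t' * e')).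
    rewrite (Rabs_mult e), (Rabs_mult t' (e - e')), (Rabs_mult t' e').
    assert (Rabs (t - t') * (Rabs e * Rabs k) <= (K * P * Rabs (z - z')) * (1 * Q)).
    { apply Rmult_le_compat; auto using Rabs_pos.
      - apply Rmult_le_pos; apply Rabs_pos.
      - apply Rmult_le_compat; auto using Rabs_pos. }
    assert (Rabs t' * Rabs (e - e') * Rabs k <= (K * P * Rabs (u - v)) * Q).
    { apply Rmult_le_compat; auto using Rabs_pos.
      - apply Rmult_le_pos; apply Rabs_pos.
      - apply Rle_trans with (Rabs t' * (2 ^ (i + j) * Rabs (u - v))).
        + apply Rmult_le_compat_l; [apply Rabs_pos|exact Le].
        + replace (Rabs t' * (2 ^ (i + j) * Rabs (u - v))) with
            (2 ^ (i + j) * Rabs t' * Rabs (u - v)) by ring.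
          apply Rmult_le_compat_r; [apply Rabs_pos|exact BT]. }
    assert (Rabs t' * Rabs e' * Rabs (k - k')
       <= (K * P * 1) * (2 / r * Q * Rabs (lam - mu))).
    { apply Rmult_le_compat; auto using Rabs_pos.
      - apply Rmult_le_pos; apply Rabs_pos.
      - apply Rmult_le_compat; auto using Rabs_pos. }
    assert (0 <= K * P * Q) by (apply Rmult_le_pos; [apply Rmult_le_pos|]; lra).
    pose proof (Rabs_pos (z - z')). pose proof (Rabs_pos (u - v)).
    pose proof (Rabs_pos (lam - mu)).
    assert (0 <= K * P * Q * Rabs (lam - mu)) by (apply Rmult_le_pos; auto).
    assert (0 <= K * P * Q * (2 / r * (Rabs (z - z') + Rabs (u - v))))
      by (apply Rmult_le_pos; [auto|apply Rmult_le_pos; lra]).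
    lra. }
  assert (EX : forall W k, (forall i j m, Rabs (W i j m) <= k * r ^ (i + j + m)) ->
     ex_series (weighted_part c W) /\ Rabs (Series (weighted_part c W)) <= k * Series A).
  { intros W k HW.
    assert (HA2 : ex_series (fun n => k * A n)) by (apply (ex_series_scal_l k A); exact Hc).
    assert (Hle : forall n, Rabs (weighted_part c W n) <= k * A n).
    { intros n. exact (weighted_part_le c W r k n HW). }
    assert (HAbs : ex_series (fun n => Rabs (weighted_part c W n))).
    { apply (ex_series_le (K := R_AbsRing) (V := R_CompleteNormedModule)
        (fun n => Rabs (weighted_part c W n)) (fun n => k * A n)); [|exact HA2].
      intros n. unfold norm; simpl; unfold abs; simpl. rewrite Rabs_Rabsolu. apply Hle. }
    split.
    - apply ex_series_Rabs. exact HAbs.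
    - eapply Rle_trans; [apply Series_Rabs; exact HAbs|].
      rewrite <- Series_scal_l. apply Series_le; [|exact HA2].
      intros n. split; [apply Rabs_pos|apply Hle]. }
  assert (HSA : 0 <= Series A).
  { destruct (EX (fun _ _ _ => 0) 1) as [_ H].
    - intros. rewrite Rabs_R0. specialize (Rp (i + j + m)%nat). lra.
    - pose proof (Rabs_pos (Series (weighted_part c (fun _ _ _ => 0)))). lra. }
  split.
  - assert (H2r : 0 < 2 / r) by (apply Rdiv_lt_0_compat; lra).
    set (k := K * (1 + 2 / r)).
    assert (Hk0 : 0 <= k) by (apply Rmult_le_pos; lra).
    exists (k * Series A * (1 + r)). split.
    { apply Rmult_le_pos; [apply Rmult_le_pos|]; lra. }
    split.
    + intros lam u z Hd. eapply Rle_trans; [apply (EX _ K), BW, Hd|].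
      assert (0 <= K * Series A) by (apply Rmult_le_pos; lra).
      assert (0 <= K * Series A * (2 / r)) by (apply Rmult_le_pos; lra).
      assert (0 <= K * Series A * (2 / r) * r) by (apply Rmult_le_pos; lra).
      unfold k. nra.
    + intros lam u z mu v z' Hd Hd'.
      rewrite <- Series_minus; [|apply (EX _ K), BW, Hd|apply (EX _ K), BW, Hd'].
      rewrite (Series_ext _ (weighted_part c (fun i j m =>
        1 * weight T e1 e2 lam u z i j m + (-1) * weight T e1 e2 mu v z' i j m))).
      2:{ intros n. rewrite weighted_part_lin. ring. }
      set (g := Rabs (z - z') + Rabs (u - v) + Rabs (lam - mu)).
      assert (Hg : z * g <= (1 + r) * gap lam u z mu v z').
      { unfold g, gap. destruct Hd as [_ Hz].
        pose proof (Rabs_pos (z - z')). pose proof (Rabs_pos (u - v)).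
        pose proof (Rabs_pos (lam - mu)).
        assert (z * Rabs (z - z') <= r * Rabs (z - z'))
          by (apply Rmult_le_compat_r; lra).
        assert (0 <= r * (z * (Rabs (lam - mu) + Rabs (u - v)))).
        { apply Rmult_le_pos; [lra|]. apply Rmult_le_pos; lra. }
        lra. }
      destruct (EX (fun i j m =>
        1 * weight T e1 e2 lam u z i j m + (-1) * weight T e1 e2 mu v z' i j m) (k * g))
        as [_ H].
      * intros. replace (_ + _) with
          (weight T e1 e2 lam u z i j m - weight T e1 e2 mu v z' i j m) by ring.
        apply LW; auto.
      * apply Rle_trans with (z * (k * g * Series A)).
        { apply Rmult_le_compat_l; [destruct Hd; lra|exact H]. }
        replace (z * (k * g * Series A)) with (k * Series A * (z * g)) by ring.
        rewrite (Rmult_assoc (k * Series A)). apply Rmult_le_compat_l; [|exact Hg].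
        apply Rmult_le_pos; lra.
  - intros lam u z Hd. apply (EX _ K), BW, Hd.
Qed.

(** z^d / z^s with the terms of degree below s dropped: the weight of the s-th Taylor remainder
    along a ray. [unit_pow] below selects the terms of degree exactly s, that is, the s-th
    coefficient. *)
Definition shifted_pow (s d : nat) (z : R) : R := if (s <=? d)%nat then z ^ (d - s) else 0.

Definition unit_pow (s d : nat) (z : R) : R := if (d =? s)%nat then 1 else 0.

Lemma shifted_pow_split s d z :
  shifted_pow s d z = unit_pow s d z + z * shifted_pow (S s) d z.
Proof.
  unfold shifted_pow, unit_pow.
  destruct (Nat.leb_spec s d), (Nat.eqb_spec d s), (Nat.leb_spec (S s) d); try lia; try ring.
  - subst. rewrite Nat.sub_diag. simpl. ring.
  - replace (d - s)%nat with (S (d - S s)) by lia. simpl. ring.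
Qed.

(** Splitting off the terms of degree s in the plane turns the s-th remainder series into
    coefficient plus z times the next one; the expansion of g is the case s = 0. The radius is fixed
    before the directions, so one radius serves all quadrants. *)
Lemma analytic_smooth g :
  analytic_at g origin 0 ->
  exists r, 0 < r /\ forall e1 e2, direction e1 -> direction e2 ->
    smooth r (fun lam u z => g (z * e1 u, z * e2 u) lam).
Proof.
  intros [r [c [Hr [Hc Hg]]]]. exists (r / 2). split; [lra|].
  intros e1 e2 D1 D2.
  (* Origin of the constant (2/r)^s: on z < r/2 the quantity 2^d z^(d-s) is at most 2^s r^(d-s),
     which is (2/r)^s r^d. *)
  assert (S2 : forall s d, (s <= d)%nat -> (2 / r) ^ s * r ^ d = 2 ^ s * r ^ (d - s)).
  { intros s d Hsd. replace d with (s + (d - s))%nat at 1 by lia.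
    rewrite pow_add, <- Rmult_assoc, <- Rpow_mult_distr. f_equal.
    f_equal. field. lra. }
  assert (H2r : forall s, 0 < (2 / r) ^ s)
    by (intros; apply pow_lt, Rdiv_lt_0_compat; lra).
  assert (Rp : forall n, 0 < r ^ n) by (intros; apply pow_lt; exact Hr).
  assert (HS : forall s,
    tame (r / 2) (fun lam u z => Series (weighted_part c (weight (shifted_pow s) e1 e2 lam u z))) /\
    forall lam u z, dom (r / 2) lam z ->
      ex_series (weighted_part c (weight (shifted_pow s) e1 e2 lam u z))).
  { intros s. apply (weighted_tame c r ((2 / r) ^ s * (1 + 2 / r))); auto.
    - assert (0 < 2 / r) by (apply Rdiv_lt_0_compat; lra).
      apply Rmult_le_pos; [left; auto|lra].
    - intros d z Hz. assert (0 < 2 / r) by (apply Rdiv_lt_0_compat; lra).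
      unfold shifted_pow. destruct (Nat.leb_spec s d).
      + rewrite Rabs_pos_eq by (apply pow_le; lra).
        apply Rle_trans with ((2 / r) ^ s * r ^ d).
        * rewrite S2 by assumption.
          replace d with (s + (d - s))%nat at 1 by lia. rewrite pow_add, Rmult_assoc.
          apply Rmult_le_compat_l; [apply pow_le; lra|]. rewrite <- Rpow_mult_distr.
          apply pow_incr. lra.
        * specialize (H2r s). specialize (Rp d).
          assert (0 < (2 / r) ^ s * r ^ d) by (apply Rmult_lt_0_compat; auto).
          assert (0 <= (2 / r) * ((2 / r) ^ s * r ^ d)) by (apply Rmult_le_pos; lra). lra.
      + rewrite Rabs_R0, Rmult_0_r. apply Rmult_le_pos; [|left; auto].
        apply Rmult_le_pos; [left; auto|lra].
    - intros d z z' Hz Hz'. assert (0 < 2 / r) by (apply Rdiv_lt_0_compat; lra).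
      unfold shifted_pow. destruct (Nat.leb_spec s d).
      + pose proof (pow_lip (r / 2) z z' (d - s) ltac:(lra)
          ltac:(rewrite Rabs_pos_eq; lra) ltac:(rewrite Rabs_pos_eq; lra)) as P.
        assert (INR (d - s) * (r / 2) ^ (d - s) <= r ^ (d - s)).
        { replace (r ^ (d - s)) with (2 ^ (d - s) * (r / 2) ^ (d - s))
            by (rewrite <- Rpow_mult_distr; f_equal; field).
          apply Rmult_le_compat_r; [apply pow_le; lra|apply INR_le_pow2]. }
        pose proof (Rabs_pos (z - z')).
        assert (Rabs (z ^ (d - s) - z' ^ (d - s)) <= 2 / r * r ^ (d - s) * Rabs (z - z')).
        { apply (Rmult_le_reg_l (r / 2)); [lra|]. eapply Rle_trans; [exact P|].
          replace (r / 2 * (2 / r * r ^ (d - s) * Rabs (z - z')))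
            with (r ^ (d - s) * Rabs (z - z')) by (field; lra).
          apply Rmult_le_compat_r; auto. }
        eapply Rle_trans; [eassumption|]. apply Rmult_le_compat_r; [auto|].
        replace ((2 / r) ^ s * (1 + 2 / r) * r ^ d)
          with ((1 + 2 / r) * ((2 / r) ^ s * r ^ d)) by ring.
        rewrite S2 by assumption.
        pose proof (pow_R1_Rle 2 s ltac:(lra)). specialize (Rp (d - s)%nat).
        apply Rmult_le_compat; [lra|lra|lra|]. nra.
      + rewrite Rminus_diag, Rabs_R0. apply Rmult_le_pos; [|apply Rabs_pos].
        apply Rmult_le_pos; [|left; auto]. apply Rmult_le_pos; [left; auto|lra]. }
  assert (HU : forall s,
    tame (r / 2) (fun lam u z => Series (weighted_part c (weight (unit_pow s) e1 e2 lam u z))) /\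
    forall lam u z, dom (r / 2) lam z ->
      ex_series (weighted_part c (weight (unit_pow s) e1 e2 lam u z))).
  { intros s. apply (weighted_tame c r ((2 / r) ^ s)); auto.
    - left; auto.
    - intros d z Hz. unfold unit_pow. destruct (Nat.eqb_spec d s).
      + subst. rewrite S2 by lia. rewrite Nat.sub_diag, Rabs_R1. simpl. lra.
      + rewrite Rabs_R0, Rmult_0_r. apply Rmult_le_pos; left; auto.
    - intros d z z' Hz Hz'. unfold unit_pow.
      replace (_ - _) with 0 by (destruct (d =? s)%nat; ring).
      rewrite Rabs_R0. apply Rmult_le_pos; [|apply Rabs_pos].
      apply Rmult_le_pos; left; auto. }
  assert (Main : forall m s,
    taylor (r / 2) m (fun lam u z => Series (weighted_part c (weight (shifted_pow s) e1 e2 lam u z)))).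
  { induction m as [|m IH]; intros s; [apply HS|].
    exists (fun lam u => Series (weighted_part c (weight (unit_pow s) e1 e2 lam u 0))),
      (fun lam u z => Series (weighted_part c (weight (shifted_pow (S s)) e1 e2 lam u z))).
    split; [|split; [apply IH|]].
    - exact (proj1 (HU s)).
    - intros lam u z Hd.
      change (weight (unit_pow s) e1 e2 lam u 0) with (weight (unit_pow s) e1 e2 lam u z).
      rewrite <- Series_scal_l, <- Series_plus.
      + apply Series_ext. intros n.
        rewrite <- (Rmult_1_l (weighted_part c (weight (unit_pow s) e1 e2 lam u z) n)).
        rewrite <- weighted_part_lin. unfold weighted_part.
        apply sum_n_eq. intros i. apply sum_n_eq. intros j.
        unfold weight. rewrite shifted_pow_split. ring.
      + apply HU; auto.
      + apply (ex_series_scal_l z (weighted_part c (weight (shifted_pow (S s)) e1 e2 lam u z))).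
        apply HS; auto. }
  intros m. apply (taylor_ext _ m _ _) with (2 := Main m 0%nat).
  intros lam u z [Hl Hz]. apply is_series_unique.
  assert (Bz : forall e, Rabs e <= 1 -> Rabs (z * e) < r).
  { intros e He. rewrite Rabs_mult, (Rabs_pos_eq z) by lra. pose proof (Rabs_pos e). nra. }
  specialize (Hg (z * e1 u) (z * e2 u) lam (Bz _ (proj1 D1 u)) (Bz _ (proj1 D2 u)) ltac:(lra)).
  simpl in Hg. rewrite !Rplus_0_l in Hg.
  eapply is_series_ext; [|exact Hg]. intros n.
  unfold homogeneous_part, weighted_part. apply sum_n_eq. intros i. apply sum_n_eq. intros j.
  unfold weight, shifted_pow. simpl. rewrite Nat.sub_0_r, pow_add, !Rpow_mult_distr. ring.
Qed.

(** * The vector fields in the four quadrants *)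

(** Smallness o(x) at each fixed (lam, u), without uniformity, annihilates the first two...
    coefficients only in part: it kills the coefficient of order 0 in H, and then that of H/x. Hence
    H is x^2 times a tame function, and the bound becomes uniform. *)
Lemma smooth_div_x r H :
  0 < r -> smooth r H ->
  (forall lam u, Rabs lam < r -> forall eps, 0 < eps ->
     exists del, 0 < del /\ forall x, 0 < x < del -> Rabs (H lam u x) <= eps * x) ->
  smooth r (fun lam u x => H lam u x / x) /\
  exists C, 0 <= C /\ forall lam u x, dom r lam x -> Rabs (H lam u x / x) <= C * x.
Proof.
  intros Hr SH Hs.
  destruct (smooth_split r H Hr SH) as [p [psi [Tp [Spsi EH]]]].
  destruct (Spsi 0%nat) as [C [HC [B _]]].
  assert (Ep : forall lam u, Rabs lam < r -> p lam u = 0).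
  { intros lam u Hl. destruct (Hs lam u Hl 1 ltac:(lra)) as [del [Hdel Hsm]].
    apply Rle_antisym.
    - cut (0 <= - p lam u); [lra|].
      apply (coef_limit r del _ (fun x => - psi lam u x + 1) (C + 1)); auto.
      + intros x Hx. eapply Rle_trans; [apply Rabs_triang|].
        rewrite Rabs_Ropp, Rabs_R1. specialize (B lam u x (conj Hl Hx)). lra.
      + intros x Hx Hxd. specialize (Hsm x ltac:(lra)).
        rewrite EH in Hsm by (split; assumption). apply Rabs_le_between in Hsm. lra.
    - apply (coef_limit r del _ (fun x => psi lam u x + 1) (C + 1)); auto.
      + intros x Hx. eapply Rle_trans; [apply Rabs_triang|].
        rewrite Rabs_R1. specialize (B lam u x (conj Hl Hx)). lra.
      + intros x Hx Hxd. specialize (Hsm x ltac:(lra)).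
        rewrite EH in Hsm by (split; assumption). apply Rabs_le_between in Hsm. lra. }
  assert (Epsi : forall lam u x, dom r lam x -> psi lam u x = H lam u x / x).
  { intros lam u x Hd. rewrite (EH lam u x Hd), Ep by apply Hd. destruct Hd. field. lra. }
  split; [intros m; eapply taylor_ext; [exact Epsi|apply Spsi]|].
  destruct (smooth_split r psi Hr Spsi) as [p' [psi' [_ [Spsi' EH']]]].
  destruct (Spsi' 0%nat) as [C' [HC' [B' _]]].
  assert (Ep' : forall lam u, Rabs lam < r -> p' lam u = 0).
  { intros lam u Hl.
    assert (Hm : forall eps, 0 < eps -> - eps <= p' lam u /\ - eps <= - p' lam u).
    { intros eps Heps. destruct (Hs lam u Hl eps Heps) as [del [Hdel Hsm]].
      assert (Hx' : forall x, 0 < x < r -> x < del ->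
                - eps <= p' lam u + x * psi' lam u x <= eps).
      { intros x Hx Hxd. rewrite <- EH' by (split; assumption).
        rewrite Epsi by (split; assumption). specialize (Hsm x ltac:(lra)).
        apply Rabs_le_between. unfold Rdiv. rewrite Rabs_mult.
        rewrite (Rabs_pos_eq (/ x)) by (left; apply Rinv_0_lt_compat; lra).
        apply (Rmult_le_reg_r x); [lra|]. rewrite Rmult_assoc, Rinv_l by lra. lra. }
      split.
      - apply (coef_limit r del _ (fun x => psi' lam u x) C'); auto.
        + intros x Hx. apply B'. split; assumption.
        + intros x Hx Hxd. apply Hx'; auto.
      - apply (coef_limit r del _ (fun x => - psi' lam u x) C'); auto.
        + intros x Hx. rewrite Rabs_Ropp. apply B'. split; assumption.
        + intros x Hx Hxd. specialize (Hx' x Hx Hxd). lra. }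
    destruct (Rtotal_order (p' lam u) 0) as [Hlt|[|Hgt]]; auto.
    - specialize (Hm (- p' lam u / 2) ltac:(lra)). lra.
    - specialize (Hm (p' lam u / 2) ltac:(lra)). lra. }
  exists C'. split; [exact HC'|]. intros lam u x Hd.
  rewrite <- Epsi, (EH' lam u x Hd), Ep' by (auto; apply Hd).
  rewrite Rplus_0_l, Rabs_mult, Rabs_pos_eq by (destruct Hd; lra).
  rewrite Rmult_comm. apply Rmult_le_compat_r; [destruct Hd; lra|auto].
Qed.

Lemma local_lipschitz (I : R -> Prop) f r0 :
  0 < r0 -> (forall t, Rabs t < r0 -> I t) -> smooth_on I f ->
  exists r K, 0 < r <= r0 /\ 0 <= K /\
    forall s t, Rabs s < r -> Rabs t < r -> Rabs (f s - f t) <= K * Rabs (s - t).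
Proof.
  intros Hr0 HI Hf.
  assert (H0 : I 0) by (apply HI; rewrite Rabs_R0; exact Hr0).
  (* A second derivative at 0 makes the first one continuous there, hence bounded nearby. *)
  assert (Dc : continuous (Derive f) 0).
  { apply (ex_derive_continuous (Derive f)). exact (Hf 2%nat 0 H0). }
  destruct (Dc (fun y => Rabs y < Rabs (Derive f 0) + 1)) as [eps Heps].
  { apply (locally_le_locally_norm (Derive f 0)). exists (mkposreal 1 Rlt_0_1).
    intros y Hy. unfold ball_norm in Hy. simpl in Hy.
    change (Rabs (y - Derive f 0) < 1) in Hy.
    replace y with ((y - Derive f 0) + Derive f 0) by ring.
    eapply Rle_lt_trans; [apply Rabs_triang|]. lra. }
  pose proof (cond_pos eps).
  exists (Rmin eps r0), (Rabs (Derive f 0) + 1).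
  split; [split; [apply Rmin_glb_lt; lra|apply Rmin_r]|].
  split; [pose proof (Rabs_pos (Derive f 0)); lra|].
  intros s t Hs Ht.
  assert (Hz : forall z, Rmin t s <= z <= Rmax t s -> Rabs z < Rmin eps r0).
  { intros z Hz. apply Rabs_lt_between in Hs. apply Rabs_lt_between in Ht.
    apply Rabs_lt_between. unfold Rmin at 1, Rmax in Hz.
    destruct (Rle_dec t s); lra. }
  assert (Hd : forall z, Rabs z < Rmin eps r0 -> is_derive f z (Derive f z)).
  { intros z Hz'. apply Derive_correct. apply (Hf 1%nat z). apply HI.
    eapply Rlt_le_trans; [exact Hz'|apply Rmin_r]. }
  destruct (MVT_gen f t s (Derive f)) as [z [Hz1 Hz2]].
  - intros z Hz'. apply Hd, Hz. lra.
  - intros z Hz'. apply continuity_pt_filterlim, (ex_derive_continuous f).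
    eexists. apply Hd, Hz, Hz'.
  - rewrite Hz2, Rabs_mult. apply Rmult_le_compat_r; [apply Rabs_pos|]. left.
    apply Heps. change (Rabs (z - 0) < eps). rewrite Rminus_0_r.
    eapply Rlt_le_trans; [apply Hz, Hz1|apply Rmin_l].
Qed.

Lemma lipschitz_tame r f K :
  0 < r -> 0 <= K ->
  (forall s t, Rabs s < r -> Rabs t < r -> Rabs (f s - f t) <= K * Rabs (s - t)) ->
  tame r (fun lam _ _ => f lam).
Proof.
  intros Hr HK HL. exists (Rabs (f 0) + K * r + K).
  pose proof (Rabs_pos (f 0)). assert (0 <= K * r) by nra.
  split; [lra|]. split.
  - intros lam _ x [Hl _]. specialize (HL lam 0 Hl ltac:(rewrite Rabs_R0; exact Hr)).
    rewrite Rminus_0_r in HL.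
    replace (f lam) with ((f lam - f 0) + f 0) by ring.
    eapply Rle_trans; [apply Rabs_triang|].
    assert (K * Rabs lam <= K * r) by (apply Rmult_le_compat_l; lra). lra.
  - intros lam u x mu v y Hd Hd'. pose proof (gap_ge0 r lam u x mu v y Hd) as Hg.
    assert (x * Rabs (f lam - f mu) <= K * gap lam u x mu v y).
    { destruct Hd as [Hl [Hx _]]. destruct Hd' as [Hm _]. specialize (HL lam mu Hl Hm).
      apply Rle_trans with (x * (K * Rabs (lam - mu))).
      - apply Rmult_le_compat_l; lra.
      - unfold gap. pose proof (Rabs_pos (x - y)). pose proof (Rabs_pos (u - v)).
        assert (0 <= K * (x * Rabs (u - v))) by (apply Rmult_le_pos; nra). nra. }
    nra.
Qed.

Lemma lipschitz_pos f r K :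
  0 < r -> 0 <= K -> 0 < f 0 ->
  (forall s t, Rabs s < r -> Rabs t < r -> Rabs (f s - f t) <= K * Rabs (s - t)) ->
  exists r', 0 < r' <= r /\ forall t, Rabs t < r' -> f 0 / 2 <= f t.
Proof.
  intros Hr HK H0 HL.
  assert (Hq : 0 < f 0 / (2 * (K + 1))) by (apply Rdiv_lt_0_compat; lra).
  exists (Rmin r (f 0 / (2 * (K + 1)))). split; [split; [apply Rmin_glb_lt; lra|apply Rmin_l]|].
  intros t Ht.
  assert (Ht1 : Rabs t < r) by (eapply Rlt_le_trans; [exact Ht|apply Rmin_l]).
  assert (Ht2 : Rabs t < f 0 / (2 * (K + 1))) by (eapply Rlt_le_trans; [exact Ht|apply Rmin_r]).
  specialize (HL t 0 Ht1 ltac:(rewrite Rabs_R0; exact Hr)). rewrite Rminus_0_r in HL.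
  assert ((K + 1) * Rabs t <= f 0 / 2).
  { replace (f 0 / 2) with ((K + 1) * (f 0 / (2 * (K + 1)))) by (field; lra).
    apply Rmult_le_compat_l; lra. }
  pose proof (Rabs_pos t). apply Rabs_le_between in HL. nra.
Qed.

Lemma interval_ball l u :
  Rbar_lt l 0 -> Rbar_lt 0 u ->
  exists r, 0 < r /\ forall lam, Rabs lam < r -> open_interval l u lam.
Proof.
  intros Hl Hu.
  assert (exists r, 0 < r /\ forall lam, - r < lam -> Rbar_lt l lam) as [r1 [Hr1 H1]].
  { destruct l as [l| |]; simpl in *; [exists (- l); split; [lra|intros; lra]|tauto|].
    exists 1. split; [lra|auto]. }
  assert (exists r, 0 < r /\ forall lam, lam < r -> Rbar_lt lam u) as [r2 [Hr2 H2]].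
  { destruct u as [u| |]; simpl in *; [exists u; split; [lra|intros; lra]| |tauto].
    exists 1. split; [lra|auto]. }
  exists (Rmin r1 r2). split; [apply Rmin_glb_lt; auto|].
  intros lam Hlam. apply Rabs_lt_between in Hlam.
  pose proof (Rmin_l r1 r2). pose proof (Rmin_r r1 r2).
  split; [apply H1|apply H2]; lra.
Qed.

(* An isometric involution carrying the interior of region [i] to the open first
   quadrant, in such a way that the switched flow goes from the positive first
   half-axis to the positive second half-axis. *)
Definition quarter (i : mode) (x : plane) : plane :=
  match i with
  | M1 => (snd x, fst x)
  | M2 => (- fst x, snd x)
  | M3 => (- snd x, - fst x)
  | M4 => (fst x, - snd x)
  end.

Lemma quarter_involutive i x : quarter i (quarter i x) = x.
Proof. destruct i, x; simpl; rewrite ?Ropp_involutive; reflexivity. Qed.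

Definition quarter_rest (fbar : mode -> plane -> R -> plane) (i : mode) (lam : R)
    (y : plane) : plane :=
  quarter i (fbar i (quarter i y) lam).

(** The exchange of b and c between odd and even regions compensates the exchange of axes: after
    conjugation the linear part is the same in all four quadrants, and only the higher-order terms
    depend on [i]. *)
Lemma quarter_field a b c fbar i lam y1 y2 :
  quarter i (subsystem a b c fbar i (quarter i (y1, y2)) lam)
  = (- a * y1 - c lam * y2 + fst (quarter_rest fbar i lam (y1, y2)),
     b lam * y1 - a * y2 + snd (quarter_rest fbar i lam (y1, y2))).
Proof.
  unfold quarter_rest, subsystem.
  destruct i; simpl; f_equal; unfold plus; simpl; ring.
Qed.

Definition rest1 (fbar : mode -> plane -> R -> plane) (i : mode) (lam u z : R) : R :=
  fst (quarter_rest fbar i lam (z * (1 - clamp u), z * clamp u)).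

Definition rest2 (fbar : mode -> plane -> R -> plane) (i : mode) (lam u z : R) : R :=
  snd (quarter_rest fbar i lam (z * (1 - clamp u), z * clamp u)).

Definition radial_speed a (b c : R -> R) fbar i (lam u z : R) : R :=
  - a + (b lam * (1 - clamp u) - c lam * clamp u)
  + (rest1 fbar i lam u z / z + rest2 fbar i lam u z / z).

(** The damping -a acts along the ray and drops out; what remains of the linear part is a positive
    definite form in (1 - u, u). *)
Definition angular_speed (b c : R -> R) fbar i (lam u z : R) : R :=
  b lam * (1 - clamp u) * (1 - clamp u) + c lam * clamp u * clamp u
  + ((1 - clamp u) * (rest2 fbar i lam u z / z) - clamp u * (rest1 fbar i lam u z / z)).

Lemma quarter_speeds a b c fbar i lam u z :
  0 <= u <= 1 -> 0 < z ->
  let v := quarter i (subsystem a b c fbar i (quarter i (z * (1 - u), z * u)) lam) in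
  fst v + snd v = z * radial_speed a b c fbar i lam u z /\
  (1 - u) * snd v - u * fst v = z * angular_speed b c fbar i lam u z.
Proof.
  intros Hu Hz. cbv zeta. rewrite quarter_field. cbn [fst snd].
  unfold radial_speed, angular_speed, rest1, rest2. rewrite clamp_id by exact Hu.
  split; field; lra.
Qed.

Lemma rest_smooth fbar i (I : R -> Prop) :
  I 0 -> analytic_field_on I (fbar i) ->
  exists r, 0 < r /\ smooth r (rest1 fbar i) /\ smooth r (rest2 fbar i).
Proof.
  intros HI Han. destruct (Han origin 0 HI) as [H1 H2].
  destruct (analytic_smooth _ H1) as [r1 [Hr1 S1]].
  destruct (analytic_smooth _ H2) as [r2 [Hr2 S2]].
  assert (Dc : direction clamp).
  { split; [|exact clamp_lip]. intros u. pose proof (clamp_range u).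
    rewrite Rabs_pos_eq; lra. }
  assert (Dr : direction (fun u => 1 - clamp u)).
  { split.
    - intros u. pose proof (clamp_range u). rewrite Rabs_pos_eq; lra.
    - intros u v. replace (1 - clamp u - (1 - clamp v)) with (- (clamp u - clamp v)) by ring.
      rewrite Rabs_Ropp. apply clamp_lip. }
  assert (Dn : forall e, direction e -> direction (fun u => - e u)).
  { intros e [B L]. split.
    - intros u. rewrite Rabs_Ropp. apply B.
    - intros u v. replace (- e u - - e v) with (- (e u - e v)) by ring.
      rewrite Rabs_Ropp. apply L. }
  pose proof (Dn _ Dc) as Dnc. pose proof (Dn _ Dr) as Dnr.
  assert (Hmin1 : Rmin r1 r2 <= r1) by apply Rmin_l.
  assert (Hmin2 : Rmin r1 r2 <= r2) by apply Rmin_r.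
  assert (T1 : forall e1 e2, direction e1 -> direction e2 -> forall m,
     taylor (Rmin r1 r2) m (fun lam u z => fst (fbar i (z * e1 u, z * e2 u) lam))).
  { intros. eapply taylor_le; [exact Hmin1|]. apply S1; auto. }
  assert (T2 : forall e1 e2, direction e1 -> direction e2 -> forall m,
     taylor (Rmin r1 r2) m (fun lam u z => snd (fbar i (z * e1 u, z * e2 u) lam))).
  { intros. eapply taylor_le; [exact Hmin2|]. apply S2; auto. }
  assert (Neg : forall m phi, taylor (Rmin r1 r2) m phi ->
     taylor (Rmin r1 r2) m (fun lam u z => (-1) * phi lam u z)).
  { intros m phi Hphi. apply (taylor_mult _ m (fun _ _ _ => -1)); [|exact Hphi].
    apply (taylor_coef _ m (fun _ _ => -1)), tame_const. }
  exists (Rmin r1 r2). split; [apply Rmin_glb_lt; auto|].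
  unfold rest1, rest2, quarter_rest.
  (* [quarter] is linear, so it maps rays to rays; the components of the image directions are
     [clamp] and 1 - [clamp] up to sign. *)
  assert (Q : forall z u, quarter i (z * (1 - clamp u), z * clamp u) =
     (z * fst (quarter i (1 - clamp u, clamp u)), z * snd (quarter i (1 - clamp u, clamp u)))).
  { intros. destruct i; simpl; f_equal; ring. }
  split; intros m.
  - apply (taylor_ext _ m (fun lam u z => fst (quarter i (fbar i
      (z * fst (quarter i (1 - clamp u, clamp u)), z * snd (quarter i (1 - clamp u, clamp u))) lam)))).
    { intros. rewrite Q. reflexivity. }
    destruct i; simpl.
    + apply T2; auto.
    + eapply taylor_ext; [|apply Neg, (T1 (fun u => - (1 - clamp u)) clamp); auto].
      intros; simpl; ring.
    + eapply taylor_ext;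
        [|apply Neg, (T2 (fun u => - clamp u) (fun u => - (1 - clamp u))); auto].
      intros; simpl; ring.
    + apply (T1 (fun u => 1 - clamp u) (fun u => - clamp u)); auto.
  - apply (taylor_ext _ m (fun lam u z => snd (quarter i (fbar i
      (z * fst (quarter i (1 - clamp u, clamp u)), z * snd (quarter i (1 - clamp u, clamp u))) lam)))).
    { intros. rewrite Q. reflexivity. }
    destruct i; simpl.
    + apply T1; auto.
    + apply (T2 (fun u => - (1 - clamp u)) clamp); auto.
    + eapply taylor_ext;
        [|apply Neg, (T1 (fun u => - clamp u) (fun u => - (1 - clamp u))); auto].
      intros; simpl; ring.
    + eapply taylor_ext; [|apply Neg, (T2 (fun u => 1 - clamp u) (fun u => - clamp u)); auto].
      intros; simpl; ring.
Qed.

Lemma plane_norm (x : plane) :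
  Rabs (fst x) <= norm x /\ Rabs (snd x) <= norm x /\ norm x <= 2 * Rmax (Rabs (fst x)) (Rabs (snd x)).
Proof.
  destruct x as [x1 x2]. cbn [fst snd].
  destruct (norm_prod (U := R_NormedModule) (V := R_NormedModule) x1 x2) as [H1 H2].
  change (Rmax (Rabs x1) (Rabs x2) <= norm (x1, x2)) in H1.
  change (norm (x1, x2) <= sqrt 2 * Rmax (Rabs x1) (Rabs x2)) in H2.
  split; [eapply Rle_trans; [apply Rmax_l|exact H1]|].
  split; [eapply Rle_trans; [apply Rmax_r|exact H1]|].
  eapply Rle_trans; [exact H2|]. apply Rmult_le_compat_r.
  - eapply Rle_trans; [apply Rabs_pos|apply Rmax_l].
  - apply Rle_trans with (sqrt (Rsqr 2)); [|rewrite sqrt_Rsqr; lra].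
    apply sqrt_le_1_alt. unfold Rsqr. lra.
Qed.

Lemma rest_small fbar i lam u :
  is_domin (locally origin) (fun x : plane => x) (fun x : plane => fbar i x lam) ->
  forall eps, 0 < eps -> exists del, 0 < del /\ forall z, 0 < z < del ->
    Rabs (rest1 fbar i lam u z) <= eps * z /\ Rabs (rest2 fbar i lam u z) <= eps * z.
Proof.
  (* Half of eps, because a point of the ray has norm at most 2z. *)
  intros Hd eps Heps. assert (He2 : 0 < eps / 2) by lra.
  destruct (Hd (mkposreal _ He2)) as [del Hdel]. simpl in Hdel.
  exists del. split; [apply cond_pos|]. intros z Hz.
  pose proof (clamp_range u) as Hc.
  set (y := quarter i (z * (1 - clamp u), z * clamp u)).
  assert (Hy : Rabs (fst y) <= z /\ Rabs (snd y) <= z).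
  { assert (0 <= z * (1 - clamp u) <= z) by nra. assert (0 <= z * clamp u <= z) by nra.
    unfold y. destruct i; cbn [quarter fst snd]; rewrite ?Rabs_Ropp;
      split; rewrite Rabs_pos_eq; lra. }
  assert (Hball : ball origin del y).
  { split; simpl; unfold ball; simpl; unfold AbsRing_ball, abs, minus, plus, opp; simpl;
      rewrite Ropp_0, Rplus_0_r; lra. }
  specialize (Hdel y Hball).
  destruct (plane_norm y) as [_ [_ Hn]]. destruct (plane_norm (fbar i y lam)) as [N1 [N2 _]].
  assert (Rmax (Rabs (fst y)) (Rabs (snd y)) <= z) by (apply Rmax_lub; apply Hy).
  assert (Hb : norm (fbar i y lam) <= eps * z).
  { eapply Rle_trans; [exact Hdel|].
    replace (eps * z) with (eps / 2 * (2 * z)) by field.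
    apply Rmult_le_compat_l; lra. }
  unfold rest1, rest2, quarter_rest. fold y.
  destruct i; simpl; rewrite ?Rabs_Ropp; lra.
Qed.

Lemma tame_clamp r : tame r (fun _ u _ => clamp u).
Proof.
  exists 1. split; [lra|split].
  - intros _ u _ _. pose proof (clamp_range u). rewrite Rabs_pos_eq; lra.
  - intros lam u x mu v y [_ [Hx _]] _. pose proof (clamp_lip u v). unfold gap.
    pose proof (Rabs_pos (x - y)). pose proof (Rabs_pos (lam - mu)). nra.
Qed.

(** Near the origin the linear part keeps the angular speed away from 0. This allows u as time
    variable, makes the quotient of the speeds smooth, and gives [M] as the bound on the radial
    speed over the lower bound k/4. *)
Lemma mode_bounds l u0 a b c fbar i :
  Rbar_lt l 0 -> Rbar_lt 0 u0 ->
  smooth_on (open_interval l u0) b -> smooth_on (open_interval l u0) c ->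
  0 < b 0 -> 0 < c 0 ->
  analytic_field_on (open_interval l u0) (fbar i) ->
  (forall lam, open_interval l u0 lam ->
     is_domin (locally origin) (fun x : plane => x) (fun x : plane => fbar i x lam)) ->
  exists r M, 0 < r /\ 0 <= M /\
    smooth r (fun lam u z => radial_speed a b c fbar i lam u z / angular_speed b c fbar i lam u z) /\
    exists kappa, 0 < kappa /\ forall lam u z, dom r lam z ->
      kappa <= angular_speed b c fbar i lam u z /\
      Rabs (radial_speed a b c fbar i lam u z) <= M * angular_speed b c fbar i lam u z.
Proof.
  intros Hl Hu Sb Sc Hb0 Hc0 Han Hsm.
  destruct (interval_ball l u0 Hl Hu) as [r0 [Hr0 HI]].
  destruct (rest_smooth fbar i (open_interval l u0)) as [r1 [Hr1 [S1 S2]]]; auto.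
  { apply HI. rewrite Rabs_R0. exact Hr0. }
  destruct (local_lipschitz _ b r0 Hr0 HI Sb) as [r2 [Kb [Hr2 [HKb Lb]]]].
  destruct (local_lipschitz _ c r0 Hr0 HI Sc) as [r3 [Kc [Hr3 [HKc Lc]]]].
  destruct (lipschitz_pos b r2 Kb ltac:(lra) HKb Hb0 Lb) as [r4 [Hr4 Pb]].
  destruct (lipschitz_pos c r3 Kc ltac:(lra) HKc Hc0 Lc) as [r5 [Hr5 Pc]].
  set (r6 := Rmin r1 (Rmin r4 r5)).
  assert (Hr6 : 0 < r6) by (unfold r6; repeat apply Rmin_glb_lt; lra).
  assert (H61 : r6 <= r1) by apply Rmin_l.
  assert (H64 : r6 <= r4) by (eapply Rle_trans; [apply Rmin_r|apply Rmin_l]).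
  assert (H65 : r6 <= r5) by (eapply Rle_trans; [apply Rmin_r|apply Rmin_r]).
  assert (SS : forall phi, smooth r1 phi -> smooth r6 phi).
  { intros phi H m. apply (taylor_le r1); auto. }
  assert (Small : forall lam u, Rabs lam < r6 -> forall eps, 0 < eps ->
    exists del, 0 < del /\ forall z, 0 < z < del ->
     Rabs (rest1 fbar i lam u z) <= eps * z /\ Rabs (rest2 fbar i lam u z) <= eps * z).
  { intros lam u Hlam. apply rest_small, Hsm, HI. lra. }
  destruct (smooth_div_x r6 (rest1 fbar i) Hr6 (SS _ S1)) as [P1 [C1 [HC1 B1]]].
  { intros lam u Hlam eps Heps. destruct (Small lam u Hlam eps Heps) as [del [Hdel H]].
    exists del. split; [exact Hdel|]. intros x Hx. apply H. exact Hx. }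
  destruct (smooth_div_x r6 (rest2 fbar i) Hr6 (SS _ S2)) as [P2 [C2 [HC2 B2]]].
  { intros lam u Hlam eps Heps. destruct (Small lam u Hlam eps Heps) as [del [Hdel H]].
    exists del. split; [exact Hdel|]. intros x Hx. apply H. exact Hx. }
  set (k := Rmin (b 0 / 2) (c 0 / 2)).
  assert (Hk : 0 < k) by (apply Rmin_glb_lt; lra).
  (* Chosen so that the higher-order terms, at most (C1 + C2) z, consume no more than k/4. *)
  set (r := Rmin r6 (k / (4 * (C1 + C2 + 1)))).
  assert (Hq : 0 < k / (4 * (C1 + C2 + 1))) by (apply Rdiv_lt_0_compat; lra).
  assert (Hr : 0 < r) by (apply Rmin_glb_lt; lra).
  assert (Hrr6 : r <= r6) by apply Rmin_l.
  assert (Hrq : r <= k / (4 * (C1 + C2 + 1))) by apply Rmin_r.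
  assert (Ang : forall lam u z, dom r lam z -> k / 4 <= angular_speed b c fbar i lam u z).
  { intros lam u z Hd. assert (Hd6 : dom r6 lam z) by (eapply dom_le; eauto).
    specialize (B1 lam u z Hd6). specialize (B2 lam u z Hd6).
    destruct Hd as [Hlam Hz].
    assert (Hb : k <= b lam) by (eapply Rle_trans; [apply Rmin_l|apply Pb; lra]).
    assert (Hc : k <= c lam) by (eapply Rle_trans; [apply Rmin_r|apply Pc; lra]).
    pose proof (clamp_range u) as Hcl. unfold angular_speed.
    set (s := clamp u) in *. set (f1 := rest1 fbar i lam u z / z) in *.
    set (f2 := rest2 fbar i lam u z / z) in *.
    assert (z * (C1 + C2 + 1) <= k / 4).
    { replace (k / 4) with (k / (4 * (C1 + C2 + 1)) * (C1 + C2 + 1)) by (field; lra).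
      apply Rmult_le_compat_r; lra. }
    (* From (1 - s)^2 + s^2 >= 1/2. *)
    assert (k / 2 <= b lam * (1 - s) * (1 - s) + c lam * s * s).
    { apply Rle_trans with (k * ((1 - s) * (1 - s)) + k * (s * s)).
      - pose proof (Rle_0_sqr (1 - 2 * s)) as Hs. unfold Rsqr in Hs. nra.
      - assert (k * ((1 - s) * (1 - s)) <= b lam * ((1 - s) * (1 - s)))
          by (apply Rmult_le_compat_r; nra).
        assert (k * (s * s) <= c lam * (s * s)) by (apply Rmult_le_compat_r; nra). lra. }
    apply Rabs_le_between in B1. apply Rabs_le_between in B2.
    assert (- (C2 * z) <= (1 - s) * f2) by nra.
    assert (s * f1 <= C1 * z) by nra.
    nra. }
  assert (Tb : tame r6 (fun lam _ _ => b lam)).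
  { apply (tame_le r2); [lra|]. apply (lipschitz_tame r2 b Kb); auto; lra. }
  assert (Tc : tame r6 (fun lam _ _ => c lam)).
  { apply (tame_le r3); [lra|]. apply (lipschitz_tame r3 c Kc); auto; lra. }
  pose proof (tame_clamp r6) as Tcl.
  assert (Trc : tame r6 (fun _ u _ => 1 - clamp u)).
  { apply (tame_ext r6 (fun lam u x => 1 + (-1) * clamp u)); [intros; ring|].
    apply (tame_plus r6 (fun _ _ _ => 1)); [apply tame_const|].
    apply (tame_mult r6 (fun _ _ _ => -1)); [apply tame_const|exact Tcl]. }
  assert (Coef : forall m p, tame r6 (fun lam u _ => p lam u) ->
            taylor r m (fun lam u _ => p lam u)).
  { intros m p Tp. apply taylor_coef. apply (tame_le r6); auto. }
  assert (P1' : smooth r (fun lam u x => rest1 fbar i lam u x / x)).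
  { intros m. apply (taylor_le r6); auto. }
  assert (P2' : smooth r (fun lam u x => rest2 fbar i lam u x / x)).
  { intros m. apply (taylor_le r6); auto. }
  assert (SN : smooth r (radial_speed a b c fbar i)).
  { intros m. unfold radial_speed.
    apply (taylor_plus r m
      (fun lam u _ => - a + (b lam * (1 - clamp u) - c lam * clamp u))
      (fun lam u z => rest1 fbar i lam u z / z + rest2 fbar i lam u z / z)).
    - apply (Coef m (fun lam u => - a + (b lam * (1 - clamp u) - c lam * clamp u))).
      apply (tame_ext r6 (fun lam u _ =>
        - a + (b lam * (1 - clamp u) + (-1) * (c lam * clamp u)))); [intros; ring|].
      apply (tame_plus r6 (fun _ _ _ => - a)); [apply tame_const|].
      apply (tame_plus r6 (fun lam u _ => b lam * (1 - clamp u))).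
      + apply (tame_mult r6 (fun lam _ _ => b lam)); auto.
      + apply (tame_mult r6 (fun _ _ _ => -1)); [apply tame_const|].
        apply (tame_mult r6 (fun lam _ _ => c lam)); auto.
    - apply taylor_plus; auto. }
  assert (SD : smooth r (angular_speed b c fbar i)).
  { intros m. unfold angular_speed.
    apply (taylor_plus r m
      (fun lam u _ => b lam * (1 - clamp u) * (1 - clamp u) + c lam * clamp u * clamp u)
      (fun lam u z => (1 - clamp u) * (rest2 fbar i lam u z / z)
                      - clamp u * (rest1 fbar i lam u z / z))).
    - apply (Coef m (fun lam u =>
        b lam * (1 - clamp u) * (1 - clamp u) + c lam * clamp u * clamp u)).
      apply (tame_plus r6 (fun lam u _ => b lam * (1 - clamp u) * (1 - clamp u))).
      + apply (tame_mult r6 (fun lam u _ => b lam * (1 - clamp u))); auto.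
        apply (tame_mult r6 (fun lam _ _ => b lam)); auto.
      + apply (tame_mult r6 (fun lam u _ => c lam * clamp u)); auto.
        apply (tame_mult r6 (fun lam _ _ => c lam)); auto.
    - apply (taylor_ext r m (fun lam u z => (1 - clamp u) * (rest2 fbar i lam u z / z)
        + (-1) * (clamp u * (rest1 fbar i lam u z / z)))); [intros; ring|].
      apply taylor_plus.
      + apply (taylor_mult r m (fun _ u _ => 1 - clamp u)); [|apply P2'].
        apply (Coef m (fun _ u => 1 - clamp u)); exact Trc.
      + apply (taylor_mult r m (fun _ _ _ => -1)).
        * apply (Coef m (fun _ _ => -1)), tame_const.
        * apply (taylor_mult r m (fun _ u _ => clamp u)); [|apply P1'].
          apply (Coef m (fun _ u => clamp u)); exact Tcl. }
  destruct (SN 0%nat) as [CN [HCN [BN _]]].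
  exists r, (CN / (k / 4)).
  assert (HM : 0 <= CN / (k / 4)).
  { apply Rmult_le_pos; [exact HCN|left; apply Rinv_0_lt_compat; lra]. }
  split; [exact Hr|split; [exact HM|split]].
  - intros m. apply taylor_mult; [apply SN|].
    apply (taylor_inv r m (k / 4)); [lra|exact Ang|apply SD].
  - exists (k / 4). split; [lra|]. intros lam u z Hd. split; [apply Ang, Hd|].
    eapply Rle_trans; [apply BN, Hd|].
    apply Rle_trans with (CN / (k / 4) * (k / 4)); [right; field; lra|].
    apply Rmult_le_compat_l; [exact HM|apply Ang, Hd].
Qed.

(** * From a trajectory around the origin to four radial arcs *)

Definition turns (G : R -> R -> R) (bound p q : R) (rho : R -> R) : Prop :=
  rho 0 = p /\ rho 1 = q /\ (forall u, rho u = rho (clamp u)) /\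
  (forall u, continuous rho u) /\ (forall u, 0 < rho u <= bound) /\
  (forall u, 0 < u < 1 -> is_derive rho u (rho u * G u (rho u))).

Lemma region_quarter i x :
  region i x -> ~ on_half_axis x -> 0 < fst (quarter i x) /\ 0 < snd (quarter i x).
Proof.
  intros Hr Hn.
  assert (Hx : x <> origin).
  { intros ->. destruct i; simpl in Hr; lra. }
  assert (H1 : fst x <> 0) by (intros E; apply Hn; split; auto).
  assert (H2 : snd x <> 0) by (intros E; apply Hn; split; auto).
  destruct i; simpl in *; lra.
Qed.

Lemma is_derive_fst (x : R -> plane) t v :
  is_derive x t v -> is_derive (fun s => fst (x s)) t (fst v).
Proof.
  intros H.
  apply (filterdiff_ext_lin (fun s => fst (x s)) (fun y : R => fst (scal y v))).
  - apply (filterdiff_comp' (U := R_NormedModule)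
      (V := prod_NormedModule R_AbsRing R_NormedModule R_NormedModule) (W := R_NormedModule)
      x fst t (fun y : R => scal y v) fst H).
    apply filterdiff_linear, is_linear_fst.
  - intros y. reflexivity.
Qed.

Lemma is_derive_snd (x : R -> plane) t v :
  is_derive x t v -> is_derive (fun s => snd (x s)) t (snd v).
Proof.
  intros H.
  apply (filterdiff_ext_lin (fun s => snd (x s)) (fun y : R => snd (scal y v))).
  - apply (filterdiff_comp' (U := R_NormedModule)
      (V := prod_NormedModule R_AbsRing R_NormedModule R_NormedModule) (W := R_NormedModule)
      x snd t (fun y : R => scal y v) snd H).
    apply filterdiff_linear, is_linear_snd.
  - intros y. reflexivity.
Qed.

Lemma is_derive_quarter i (x : R -> plane) t v :
  is_derive x t v ->
  is_derive (fun s => fst (quarter i (x s))) t (fst (quarter i v)) /\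
  is_derive (fun s => snd (quarter i (x s))) t (snd (quarter i v)).
Proof.
  intros H. pose proof (is_derive_fst x t v H) as H1. pose proof (is_derive_snd x t v H) as H2.
  pose proof (is_derive_opp _ _ _ H1) as H3. pose proof (is_derive_opp _ _ _ H2) as H4.
  destruct i; simpl; split; assumption.
Qed.

(** Freezes a curve outside [s, t]: [quarter_turn] asks for continuity at every time, while a
    solution is known only on its time interval. *)
Definition clip (s t tau : R) : R := Rmax s (Rmin t tau).

Lemma clip_range s t tau : s <= t -> s <= clip s t tau <= t.
Proof. intros. unfold clip, Rmax, Rmin. repeat destruct Rle_dec; lra. Qed.

Lemma clip_id s t tau : s <= tau <= t -> clip s t tau = tau.
Proof. intros. unfold clip, Rmax, Rmin. repeat destruct Rle_dec; lra. Qed.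

Lemma clip_continuous s t tau : continuous (clip s t) tau.
Proof.
  apply (lipschitz_continuous (clip s t) 1). intros u v.
  unfold clip, Rmax, Rmin, Rabs. repeat destruct Rle_dec; repeat destruct Rcase_abs; lra.
Qed.

Lemma continuous_on_clip (J : R -> Prop) (x : R -> plane) s t :
  s <= t -> (forall tau, s <= tau <= t -> J tau) -> continuous_on J x ->
  forall tau, continuous (fun w => x (clip s t w)) tau.
Proof.
  intros Hst HJ Hx tau.
  apply (filterlim_comp _ _ _ (clip s t) x (locally tau) (within J (locally (clip s t tau)))).
  - intros P HP. unfold within in HP.
    pose proof (clip_continuous s t tau _ HP) as HQ.
    unfold filtermap in *. eapply filter_imp; [|exact HQ].
    intros w Hw. apply Hw, HJ, clip_range, Hst.
  - apply Hx, HJ, clip_range, Hst.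
Qed.

Lemma continuous_quarter i (x : R -> plane) tau :
  continuous x tau ->
  continuous (fun w => fst (quarter i (x w))) tau /\
  continuous (fun w => snd (quarter i (x w))) tau.
Proof.
  intros H.
  assert (H1 : continuous (fun w => fst (x w)) tau).
  { apply (continuous_comp x fst); [exact H|]. destruct (x tau). apply continuous_fst. }
  assert (H2 : continuous (fun w => snd (x w)) tau).
  { apply (continuous_comp x snd); [exact H|]. destruct (x tau). apply continuous_snd. }
  pose proof (continuous_opp (V := R_NormedModule) _ _ H1) as H3.
  pose proof (continuous_opp (V := R_NormedModule) _ _ H2) as H4.
  destruct i; simpl; split; assumption.
Qed.

(** The crossing of region [i], conjugated to the first quadrant and frozen outside [s, t], meets
    the hypotheses of [quarter_turn]. *)
Lemma travel_turns a b c fbar lam r kappa M i x T s t p q :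
  0 < kappa -> 0 <= M -> Rabs lam < r ->
  (forall u z, dom r lam z ->
     kappa <= angular_speed b c fbar i lam u z /\
     Rabs (radial_speed a b c fbar i lam u z) <= M * angular_speed b c fbar i lam u z) ->
  solution (subsystem a b c fbar) lam (fun tau => 0 <= tau <= T) x ->
  0 <= s -> s < t -> t <= T -> travels_in i x s t ->
  quarter i (x s) = (p, 0) -> quarter i (x t) = (0, q) -> 0 < p -> 0 < q ->
  p * exp M < r ->
  exists rho, turns (fun u z => radial_speed a b c fbar i lam u z
                                / angular_speed b c fbar i lam u z) (p * exp M) p q rho.
Proof.
  intros Hk HM Hlam HB [Cx [D [HD1 [HD2 HD3]]]] Hs Hst HtT Htr Ep Eq Hp Hq Hsm.
  set (y := fun tau => quarter i (x (clip s t tau))).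
  set (F := fun y1 y2 => quarter i (subsystem a b c fbar i (quarter i (y1, y2)) lam)).
  assert (Ey : forall tau, s <= tau <= t -> y tau = quarter i (x tau)).
  { intros tau Htau. unfold y. rewrite clip_id by exact Htau. reflexivity. }
  assert (Cy : forall tau, continuous (fun w => x (clip s t w)) tau).
  { apply (continuous_on_clip (fun tau => 0 <= tau <= T)); auto; [lra|]. intros; lra. }
  assert (Pos : forall tau, s < tau < t -> 0 < fst (quarter i (x tau)) /\ 0 < snd (quarter i (x tau))).
  { intros tau Htau. destruct (Htr tau Htau). apply region_quarter; auto. }
  apply (quarter_turn r kappa M (radial_speed a b c fbar i lam) (angular_speed b c fbar i lam)
    (fun y1 y2 => fst (F y1 y2)) (fun y1 y2 => snd (F y1 y2))
    (fun tau => fst (y tau)) (fun tau => snd (y tau)) s t p q); auto.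
  - intros u z Hu Hz.
    destruct (quarter_speeds a b c fbar i lam u z Hu (proj1 Hz)) as [E1 E2].
    destruct (HB u z) as [B1 B2]; [split; auto|]. auto.
  - intros tau. apply (continuous_quarter i (fun w => x (clip s t w))), Cy.
  - intros tau. apply (continuous_quarter i (fun w => x (clip s t w))), Cy.
  (* At the two ends the curve is on a half-axis, at (p, 0) or (0, q), and the sum of its
     coordinates is still positive. *)
  - intros tau. pose proof (clip_range s t tau ltac:(lra)) as Hc.
    unfold y. set (w := clip s t tau) in *.
    destruct (Req_dec w s) as [->|]; [rewrite Ep; simpl; lra|].
    destruct (Req_dec w t) as [->|]; [rewrite Eq; simpl; lra|].
    destruct (Pos w); lra.
  - intros tau Htau. destruct (Pos tau Htau) as [P1 P2].
    rewrite Ey by lra. split; [exact P1|split; [exact P2|]].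
    destruct (Htr tau Htau) as [R1 R2].
    (* Switching times lie on half-axes, so none occurs during the crossing. *)
    assert (HDt : ~ D tau) by (intros Hd; apply R2, HD1; [lra|exact Hd]).
    assert (HJ : locally tau (fun w => 0 <= w <= T)).
    { assert (Hm : 0 < Rmin (tau - s) (t - tau)) by (apply Rmin_glb_lt; lra).
      exists (mkposreal _ Hm). intros w Hw. change (Rabs (w - tau) < Rmin (tau - s) (t - tau)) in Hw.
      pose proof (Rmin_l (tau - s) (t - tau)). pose proof (Rmin_r (tau - s) (t - tau)).
      apply Rabs_lt_between in Hw. lra. }
    destruct (HD3 tau HJ HDt) as [Hder _].
    destruct (is_derive_quarter i x tau _ (Hder i R1)) as [Q1 Q2].
    assert (Hloc : locally tau (fun w => quarter i (x w) = y w)).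
    { assert (Hm : 0 < Rmin (tau - s) (t - tau)) by (apply Rmin_glb_lt; lra).
      exists (mkposreal _ Hm). intros w Hw. change (Rabs (w - tau) < Rmin (tau - s) (t - tau)) in Hw.
      pose proof (Rmin_l (tau - s) (t - tau)). pose proof (Rmin_r (tau - s) (t - tau)).
      apply Rabs_lt_between in Hw. symmetry. apply Ey. lra. }
    assert (EF : quarter i (subsystem a b c fbar i (x tau) lam)
               = F (fst (quarter i (x tau))) (snd (quarter i (x tau)))).
    { unfold F. rewrite <- surjective_pairing, quarter_involutive. reflexivity. }
    rewrite EF in Q1, Q2. split.
    + eapply is_derive_ext_loc; [|exact Q1].
      eapply filter_imp; [|exact Hloc]. intros w Hw. cbv beta. rewrite Hw. reflexivity.
    + eapply is_derive_ext_loc; [|exact Q2].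
      eapply filter_imp; [|exact Hloc]. intros w Hw. cbv beta. rewrite Hw. reflexivity.
  - cbv beta. rewrite Ey, Ep by lra. reflexivity.
  - cbv beta. rewrite Ey, Ep by lra. reflexivity.
  - cbv beta. rewrite Ey, Eq by lra. reflexivity.
  - cbv beta. rewrite Ey, Eq by lra. reflexivity.
Qed.

(** The clockwise order is 4, 3, 2, 1, and the exit point (0, q) of one quadrant is the entry point
    (q, 0) of the next in its own coordinates. Each crossing costs a factor exp(M), hence its fourth
    power in the smallness condition. *)
Lemma return_turns a b c fbar lam r M p q :
  0 <= M -> Rabs lam < r ->
  (forall i, exists kappa, 0 < kappa /\ forall lam u z, dom r lam z ->
     kappa <= angular_speed b c fbar i lam u z /\
     Rabs (radial_speed a b c fbar i lam u z) <= M * angular_speed b c fbar i lam u z) ->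
  0 < p -> p * exp M * exp M * exp M * exp M < r ->
  first_return (subsystem a b c fbar) lam p q ->
  exists rho4 rho3 rho2 rho1 : R -> R,
    let G i u z := radial_speed a b c fbar i lam u z / angular_speed b c fbar i lam u z in
    let B := p * exp M * exp M * exp M * exp M in
    turns (G M4) B p (rho4 1) rho4 /\ turns (G M3) B (rho4 1) (rho3 1) rho3 /\
    turns (G M2) B (rho3 1) (rho2 1) rho2 /\ turns (G M1) B (rho2 1) q rho1.
Proof.
  intros HM Hlam HB Hp Hsm [x [t1 [t2 [t3 [t4 H]]]]].
  destruct H as [H01 [H12 [H23 [H34 [Sol [X0 [T4 [X1 [T3 [X2 [T2 [X3 [T1 [X4 Hq]]]]]]]]]]]]]].
  assert (E1 : 1 <= exp M).
  { destruct HM as [HM| <-]; [pose proof (exp_ineq1 M ltac:(lra)); lra|rewrite exp_0; lra]. }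
  assert (Grow : forall z, 0 <= z -> z <= z * exp M) by (intros; nra).
  assert (Mono : forall z w, z <= w -> z * exp M <= w * exp M)
    by (intros; apply Rmult_le_compat_r; lra).
  assert (G1 : p <= p * exp M) by (apply Grow; lra).
  assert (G2 : p * exp M <= p * exp M * exp M) by (apply Grow; lra).
  assert (G3 : p * exp M * exp M <= p * exp M * exp M * exp M) by (apply Grow; lra).
  assert (G4 : p * exp M * exp M * exp M <= p * exp M * exp M * exp M * exp M) by (apply Grow; lra).
  assert (Turn : forall i s t p' q', 0 <= s -> s < t -> t <= t4 -> travels_in i x s t ->
    quarter i (x s) = (p', 0) -> quarter i (x t) = (0, q') -> 0 < p' -> 0 < q' ->
    p' * exp M < r ->
    exists rho, turns (fun u z => radial_speed a b c fbar i lam u z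
                                / angular_speed b c fbar i lam u z) (p' * exp M) p' q' rho).
  { intros i s t p' q'. destruct (HB i) as [kappa [Hk HBi]]. intros.
    eapply (travel_turns a b c fbar lam r kappa M i x t4 s t); eauto. }
  (* All four arcs are given the same bound, so that one radius serves the four applications of
     [turn_smooth]. *)
  assert (Weak : forall G B B' p' q' rho, B <= B' -> turns G B p' q' rho -> turns G B' p' q' rho).
  { intros G B B' p' q' rho HBB [A1 [A2 [A3 [A4 [A5 A6]]]]].
    split; [auto|split; [auto|split; [auto|split; [auto|split; [|auto]]]]].
    intros u. destruct (A5 u). split; [auto|lra]. }
  destruct (Turn M4 0 t1 p (- snd (x t1))) as [rho4 R4]; auto; try lra.
  { rewrite X0. simpl. f_equal. ring. }
  { simpl. destruct X1 as [-> _]. reflexivity. }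
  pose proof R4 as [_ [E4 [_ [_ [B4 _]]]]]. specialize (B4 1).
  destruct (Turn M3 t1 t2 (- snd (x t1)) (- fst (x t2))) as [rho3 R3]; auto; try lra.
  { simpl. destruct X1 as [-> _]. f_equal. ring. }
  { simpl. destruct X2 as [_ ->]. f_equal. ring. }
  { rewrite <- E4. pose proof (Mono _ _ (proj2 B4)). lra. }
  pose proof R3 as [_ [E3 [_ [_ [B3 _]]]]]. specialize (B3 1).
  pose proof (Mono _ _ (proj2 B4)) as L4. rewrite E4 in L4.
  destruct (Turn M2 t2 t3 (- fst (x t2)) (snd (x t3))) as [rho2 R2]; auto; try lra.
  { simpl. destruct X2 as [_ ->]. reflexivity. }
  { simpl. destruct X3 as [-> _]. f_equal. ring. }
  { rewrite <- E3. pose proof (Mono _ _ (proj2 B3)). pose proof (Mono _ _ L4). lra. }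
  pose proof R2 as [_ [E2 [_ [_ [B2 _]]]]]. specialize (B2 1).
  pose proof (Mono _ _ (proj2 B3)) as L3. rewrite E3 in L3.
  pose proof (Mono _ _ L4) as L4'. pose proof (Mono _ _ L3) as L3'. pose proof (Mono _ _ L4') as L4''.
  pose proof (Mono _ _ (proj2 B2)) as L2. rewrite E2 in L2.
  destruct (Turn M1 t3 t4 (snd (x t3)) q) as [rho1 R1]; auto; try lra.
  { simpl. destruct X3 as [-> _]. reflexivity. }
  { simpl. rewrite X4. reflexivity. }
  exists rho4, rho3, rho2, rho1. cbv zeta.
  rewrite E4, E3, E2.
  split; [|split; [|split]].
  - apply (Weak _ (p * exp M)); [lra|exact R4].
  - apply (Weak _ (- snd (x t1) * exp M)); [lra|exact R3].
  - apply (Weak _ (- fst (x t2) * exp M)); [lra|exact R2].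
  - apply (Weak _ (snd (x t3) * exp M)); [lra|exact R1].
Qed.

(** * The return map *)

Definition turn_rate a (b c : R -> R) fbar i (lam u z : R) : R :=
  radial_speed a b c fbar i lam u z / angular_speed b c fbar i lam u z.

Lemma uniform_over_modes (P : mode -> R -> R -> Prop) :
  (forall i r r' M M', 0 < r' <= r -> M <= M' -> P i r M -> P i r' M') ->
  (forall i, exists r M, 0 < r /\ 0 <= M /\ P i r M) ->
  exists r M, 0 < r /\ 0 <= M /\ forall i, P i r M.
Proof.
  intros Mono H.
  destruct (H M1) as [r1 [K1 [A1 [B1 C1]]]]. destruct (H M2) as [r2 [K2 [A2 [B2 C2]]]].
  destruct (H M3) as [r3 [K3 [A3 [B3 C3]]]]. destruct (H M4) as [r4 [K4 [A4 [B4 C4]]]].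
  exists (Rmin (Rmin r1 r2) (Rmin r3 r4)), (K1 + K2 + K3 + K4).
  assert (0 < Rmin (Rmin r1 r2) (Rmin r3 r4)) by (repeat apply Rmin_glb_lt; auto).
  pose proof (Rmin_l (Rmin r1 r2) (Rmin r3 r4)). pose proof (Rmin_r (Rmin r1 r2) (Rmin r3 r4)).
  pose proof (Rmin_l r1 r2). pose proof (Rmin_r r1 r2).
  pose proof (Rmin_l r3 r4). pose proof (Rmin_r r3 r4).
  split; [assumption|split; [lra|]]. intros [| | |].
  - apply (Mono M1 r1 _ K1); auto; lra.
  - apply (Mono M2 r2 _ K2); auto; lra.
  - apply (Mono M3 r3 _ K3); auto; lra.
  - apply (Mono M4 r4 _ K4); auto; lra.
Qed.

(** Transports the expansion of the entry radius over x, with its positive lower bound, to the exit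
    radius; iterated over the four quadrants. *)
Lemma turn_smooth r s G (bound : R -> R) om (om' : R -> R -> R) (rho : R -> R -> R -> R) kappa :
  0 < s -> 0 < kappa -> s <= r -> smooth r G ->
  (forall x, 0 < x < s -> bound x < r) ->
  (forall lam x, dom s lam x ->
     turns (G lam) (bound x) (x * om lam x) (x * om' lam x) (fun u => rho lam u x)) ->
  smooth s (fun lam _ x => om lam x) ->
  (forall lam x, dom s lam x -> kappa <= om lam x) ->
  smooth s (fun lam _ x => om' lam x) /\
  exists kappa', 0 < kappa' /\ forall lam x, dom s lam x -> kappa' <= om' lam x.
Proof.
  intros Hs Hk Hsr SG Hb HT Som Hom.
  destruct (radial_smooth r s G om rho kappa) as [S [k' [Hk' B']]]; auto.
  { intros lam x Hd. destruct (HT lam x Hd) as [E0 [_ [E1 [E2 [E3 E4]]]]].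
    split; [exact E0|split; [exact E1|split; [exact E2|split; [|exact E4]]]].
    intros u. destruct (E3 u). specialize (Hb x (proj2 Hd)). cbv beta in *. lra. }
  assert (E : forall lam x, dom s lam x -> rho lam 1 x / x = om' lam x).
  { intros lam x Hd. destruct (HT lam x Hd) as [_ [E1 _]]. cbv beta in E1. rewrite E1.
    destruct Hd as [_ Hx]. field. lra. }
  split.
  - intros m. apply (taylor_ext s m (fun lam _ x => rho lam 1 x / x)); [intros; auto|].
    apply (taylor_reparam s m (fun _ => 1) (fun lam u x => rho lam u x / x)); [|apply S].
    intros u v. rewrite Rminus_diag, Rabs_R0. apply Rabs_pos.
  - exists k'. split; [exact Hk'|]. intros lam x Hd. rewrite <- E by exact Hd. apply B', Hd.
Qed.

Lemma return_factor l u a b c fbar pi :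
  Rbar_lt l 0 -> Rbar_lt 0 u ->
  smooth_on (open_interval l u) b -> smooth_on (open_interval l u) c ->
  (forall lam, open_interval l u lam -> 0 < b lam) ->
  (forall lam, open_interval l u lam -> 0 < c lam) ->
  (forall i, analytic_field_on (open_interval l u) (fbar i)) ->
  (forall i lam, open_interval l u lam ->
     is_domin (locally origin) (fun x : plane => x) (fun x : plane => fbar i x lam)) ->
  is_poincare_map (subsystem a b c fbar) (open_interval l u) pi ->
  exists s, 0 < s /\ (forall lam, Rabs lam < s -> open_interval l u lam) /\
    (forall lam x, dom s lam x -> first_return (subsystem a b c fbar) lam x (pi x lam)) /\
    smooth s (fun lam _ x => pi x lam / x).
Proof.
  intros Hl Hu Sb Sc Pb Pc Han Hsm [eta [Heta Hpi]].
  destruct (interval_ball l u Hl Hu) as [r0 [Hr0 HI]].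
  assert (I0 : open_interval l u 0) by (apply HI; rewrite Rabs_R0; exact Hr0).
  destruct (uniform_over_modes (fun i r M => smooth r (turn_rate a b c fbar i) /\
    exists kappa, 0 < kappa /\ forall lam u z, dom r lam z ->
     kappa <= angular_speed b c fbar i lam u z /\
     Rabs (radial_speed a b c fbar i lam u z) <= M * angular_speed b c fbar i lam u z))
    as [r [M [Hr [HM HP]]]].
  { intros i r r' M M' Hr HMM [S [k [Hk B]]]. split.
    - intros m. apply (taylor_le r); [lra|auto].
    - exists k. split; [exact Hk|]. intros lam v z Hd.
      destruct (B lam v z) as [B1 B2]; [eapply dom_le; eauto; lra|].
      split; [exact B1|]. eapply Rle_trans; [exact B2|]. apply Rmult_le_compat_r; lra. }
  { intros i. apply (mode_bounds l u a b c fbar i); auto. }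
  set (K := exp M * exp M * exp M * exp M).
  assert (HK : 1 <= K).
  { assert (1 <= exp M).
    { destruct HM as [HM| <-]; [pose proof (exp_ineq1 M ltac:(lra)); lra|rewrite exp_0; lra]. }
    unfold K. assert (1 <= exp M * exp M) by nra. assert (1 <= exp M * exp M * exp M) by nra. nra. }
  assert (HrK : 0 < r / K) by (apply Rdiv_lt_0_compat; lra).
  set (s := Rmin (r / K) (Rmin r0 eta)).
  assert (Hs : 0 < s) by (unfold s; repeat apply Rmin_glb_lt; auto).
  assert (Hs1 : s <= r / K) by apply Rmin_l.
  assert (Hs2 : s <= r0) by (eapply Rle_trans; [apply Rmin_r|apply Rmin_l]).
  assert (Hs3 : s <= eta) by (eapply Rle_trans; [apply Rmin_r|apply Rmin_r]).
  assert (HsK : forall x, x < s -> x * K < r).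
  { intros x Hx. replace r with (r / K * K) by (field; lra). apply Rmult_lt_compat_r; lra. }
  assert (Hsr : s <= r).
  { eapply Rle_trans; [exact Hs1|]. apply (Rmult_le_reg_r K); [lra|].
    unfold Rdiv. rewrite Rmult_assoc, Rinv_l by lra. nra. }
  assert (FR : forall lam x, dom s lam x ->
            first_return (subsystem a b c fbar) lam x (pi x lam)).
  { intros lam x [Hlam Hx].
    destruct (Hpi lam (HI lam ltac:(lra)) ltac:(lra)) as [_ H]. apply H. lra. }
  exists s. split; [exact Hs|split; [intros; apply HI; lra|split; [exact FR|]]].
  set (Q := fun lam x (w : (R -> R) * (R -> R) * ((R -> R) * (R -> R))) =>
    let '(rho4, rho3, (rho2, rho1)) := w in
    turns (turn_rate a b c fbar M4 lam) (x * K) x (rho4 1) rho4 /\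
    turns (turn_rate a b c fbar M3 lam) (x * K) (rho4 1) (rho3 1) rho3 /\
    turns (turn_rate a b c fbar M2 lam) (x * K) (rho3 1) (rho2 1) rho2 /\
    turns (turn_rate a b c fbar M1 lam) (x * K) (rho2 1) (pi x lam) rho1).
  assert (HQ : forall lam x, dom s lam x -> exists w, Q lam x w).
  { intros lam x Hd.
    replace (x * K) with (x * exp M * exp M * exp M * exp M) in * by (unfold K; ring).
    destruct (return_turns a b c fbar lam r M x (pi x lam)) as [f4 [f3 [f2 [f1 H]]]]; auto.
    - destruct Hd. lra.
    - intros i. destruct (HP i) as [_ [k [Hk B]]]. exists k. auto.
    - destruct Hd; lra.
    - replace (x * exp M * exp M * exp M * exp M) with (x * K) by (unfold K; ring).
      apply HsK. destruct Hd; lra.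
    - exists (f4, f3, (f2, f1)). unfold Q.
      replace (x * K) with (x * exp M * exp M * exp M * exp M) by (unfold K; ring).
      exact H. }
  (* The arcs are chosen separately for each (lam, x). Their regularity in the parameters is not
     built into the choice: it follows from the equation and the initial values. *)
  set (w := fun lam x => epsilon (inhabits ((id, id, (id, id)))) (Q lam x)).
  assert (Hw : forall lam x, dom s lam x -> Q lam x (w lam x)).
  { intros lam x Hd. apply epsilon_spec, HQ, Hd. }
  set (rho4 := fun lam u x : R => fst (fst (w lam x)) u).
  set (rho3 := fun lam u x : R => snd (fst (w lam x)) u).
  set (rho2 := fun lam u x : R => fst (snd (w lam x)) u).
  set (rho1 := fun lam u x : R => snd (snd (w lam x)) u).
  assert (Hrho : forall lam x, dom s lam x ->
    turns (turn_rate a b c fbar M4 lam) (x * K) (x * 1) (x * (rho4 lam 1 x / x))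
      (fun u => rho4 lam u x) /\
    turns (turn_rate a b c fbar M3 lam) (x * K) (x * (rho4 lam 1 x / x)) (x * (rho3 lam 1 x / x))
      (fun u => rho3 lam u x) /\
    turns (turn_rate a b c fbar M2 lam) (x * K) (x * (rho3 lam 1 x / x)) (x * (rho2 lam 1 x / x))
      (fun u => rho2 lam u x) /\
    turns (turn_rate a b c fbar M1 lam) (x * K) (x * (rho2 lam 1 x / x)) (x * (pi x lam / x))
      (fun u => rho1 lam u x)).
  { intros lam x Hd. specialize (Hw lam x Hd).
    assert (Hx : x <> 0) by (destruct Hd; lra).
    assert (Ex : forall z, x * (z / x) = z) by (intros; field; exact Hx).
    rewrite !Ex, Rmult_1_r. unfold rho4, rho3, rho2, rho1.
    destruct (w lam x) as [[f4 f3] [f2 f1]]. exact Hw. }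
  assert (Hbd : forall x, 0 < x < s -> x * K < r) by (intros; apply HsK; lra).
  destruct (turn_smooth r s (turn_rate a b c fbar M4) (fun x => x * K) (fun _ _ => 1)
    (fun lam x => rho4 lam 1 x / x) rho4 1) as [S4 [k4 [Hk4 B4]]]; auto; try lra.
  { apply HP. } { apply Hrho. }
  { intros m. apply (taylor_coef s m (fun _ _ => 1)), tame_const. }
  { intros; lra. }
  destruct (turn_smooth r s (turn_rate a b c fbar M3) (fun x => x * K)
    (fun lam x => rho4 lam 1 x / x)
    (fun lam x => rho3 lam 1 x / x) rho3 k4) as [S3 [k3 [Hk3 B3]]]; auto.
  { apply HP. } { apply Hrho. }
  destruct (turn_smooth r s (turn_rate a b c fbar M2) (fun x => x * K)
    (fun lam x => rho3 lam 1 x / x)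
    (fun lam x => rho2 lam 1 x / x) rho2 k3) as [S2 [k2 [Hk2 B2]]]; auto.
  { apply HP. } { apply Hrho. }
  destruct (turn_smooth r s (turn_rate a b c fbar M1) (fun x => x * K)
    (fun lam x => rho2 lam 1 x / x)
    (fun lam x => pi x lam / x) rho1 k2) as [S1 _]; auto.
  { apply HP. } { apply Hrho. }
Qed.

(** * Periodic extension of a closed solution *)

Definition wrap (T t : R) : R := t - T * IZR (Int_part (t / T)).

Lemma wrap_range T t : 0 < T -> 0 <= wrap T t < T.
Proof.
  intros HT. destruct (base_Int_part (t / T)) as [H1 H2]. unfold wrap.
  replace t with (T * (t / T)) at 1 3 by (field; lra).
  split; [nra|]. nra.
Qed.

Lemma wrap_eq T t (n : Z) : 0 < T -> 0 <= t - T * IZR n < T -> wrap T t = t - T * IZR n.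
Proof.
  intros HT H. unfold wrap. rewrite <- (Int_part_spec (t / T) n); [reflexivity|].
  assert (E : t / T = IZR n + (t - T * IZR n) / T) by (field; lra).
  assert (0 <= (t - T * IZR n) / T < 1).
  { split.
    - apply Rmult_le_pos; [lra|left; apply Rinv_0_lt_compat; lra].
    - apply (Rmult_lt_reg_r T); [lra|]. unfold Rdiv. rewrite Rmult_assoc, Rinv_l by lra. lra. }
  lra.
Qed.

Lemma wrap_period T t : 0 < T -> wrap T (t + T) = wrap T t.
Proof.
  intros HT. pose proof (wrap_range T t HT) as H.
  rewrite (wrap_eq T (t + T) (Int_part (t / T) + 1)); auto; unfold wrap in *;
    rewrite plus_IZR; lra.
Qed.

Lemma wrap_near_interior T t s :
  0 < T -> Rabs (s - t) < Rmin (wrap T t) (T - wrap T t) -> wrap T s = s - t + wrap T t.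
Proof.
  intros HT Hs. pose proof (Rmin_l (wrap T t) (T - wrap T t)).
  pose proof (Rmin_r (wrap T t) (T - wrap T t)). apply Rabs_lt_between in Hs.
  rewrite (wrap_eq T s (Int_part (t / T))); auto; unfold wrap in *; lra.
Qed.

Lemma wrap_near_end T t s :
  0 < T -> wrap T t = 0 -> Rabs (s - t) < T ->
  (t <= s -> wrap T s = s - t) /\ (s < t -> wrap T s = s - t + T).
Proof.
  intros HT Ht Hs. apply Rabs_lt_between in Hs. unfold wrap in Ht. split; intros Hst.
  - rewrite (wrap_eq T s (Int_part (t / T))); auto; lra.
  - rewrite (wrap_eq T s (Int_part (t / T) - 1)); auto; rewrite minus_IZR; lra.
Qed.

(** At multiples of T the one-sided derivatives may differ. The closing point lies on a half-axis,
    so these times may be declared switching times. *)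
Lemma periodic_extension f lam x T :
  0 < T -> solution f lam (fun t => 0 <= t <= T) x -> x 0 = x T -> on_half_axis (x 0) ->
  solution f lam (fun _ => True) (fun t => x (wrap T t)).
Proof.
  intros HT [Cx [D [HD1 [HD2 HD3]]]] E Hax.
  pose proof (fun t => wrap_range T t HT) as Hw.
  assert (Cc : forall t, continuous (fun s => x (clip 0 T s)) t).
  { apply (continuous_on_clip (fun t => 0 <= t <= T)); auto; lra. }
  assert (Int : forall t, wrap T t <> 0 -> locally t (fun s => wrap T s = s - t + wrap T t)).
  { intros t Ht. pose proof (Hw t).
    assert (Hm : 0 < Rmin (wrap T t) (T - wrap T t)) by (apply Rmin_glb_lt; lra).
    exists (mkposreal _ Hm). intros s Hs. apply wrap_near_interior; auto. }
  assert (End : forall t, wrap T t = 0 -> locally t (fun s =>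
     Rabs (s - t) < T /\ (t <= s -> wrap T s = s - t) /\ (s < t -> wrap T s = s - t + T))).
  { intros t Ht. exists (mkposreal _ HT). intros s Hs. split; [exact Hs|].
    apply wrap_near_end; auto. }
  assert (Cshift : forall t k, continuous (fun s => x (clip 0 T (s - t + k))) t).
  { intros t k. apply (continuous_comp (fun s => s - t + k) (fun s => x (clip 0 T s))); [|apply Cc].
    apply (continuous_plus (V := R_NormedModule)); [|apply continuous_const].
    apply (continuous_minus (V := R_NormedModule)); [apply continuous_id|apply continuous_const]. }
  split.
  - intros t _ P HP.
    assert (HX : locally t (fun s => P (x (wrap T s)))).
    { destruct (Req_dec (wrap T t) 0) as [Ht|Ht].
      (* At a multiple of T the extension follows the start of x on the right and its end on the
         left; the two branches agree because x 0 = x T. *)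
      - assert (L0 : locally t (fun s => P (x (clip 0 T (s - t + 0))))).
        { apply (Cshift t 0). replace (t - t + 0) with 0 by ring.
          rewrite clip_id by lra. rewrite Ht in HP. exact HP. }
        assert (L1 : locally t (fun s => P (x (clip 0 T (s - t + T))))).
        { apply (Cshift t T). replace (t - t + T) with T by ring.
          rewrite clip_id by lra. rewrite Ht, E in HP. exact HP. }
        generalize (filter_and _ _ (End t Ht) (filter_and _ _ L0 L1)).
        apply filter_imp. intros s [[Hs [H1 H2]] [P0 P1]].
        apply Rabs_lt_between in Hs. destruct (Rle_dec t s).
        + rewrite H1 by lra. rewrite clip_id in P0 by lra. rewrite Rplus_0_r in P0. exact P0.
        + rewrite H2 by lra. rewrite clip_id in P1 by lra. exact P1.
      - assert (L : locally t (fun s => P (x (clip 0 T (s - t + wrap T t))))).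
        { apply (Cshift t (wrap T t)). replace (t - t + wrap T t) with (wrap T t) by ring.
          rewrite clip_id by (specialize (Hw t); lra). exact HP. }
        generalize (filter_and _ _ (Int t Ht) L). apply filter_imp. intros s [H1 H2].
        pose proof (Hw s) as Hws. rewrite H1 in Hws. rewrite clip_id in H2 by lra.
        rewrite H1. exact H2. }
    unfold filtermap, within. eapply filter_imp; [|exact HX]. auto.
  - exists (fun t => D (wrap T t) \/ wrap T t = 0). split; [|split].
    + intros t _ [Ht|Ht]; [|rewrite Ht; exact Hax].
      apply HD1; [specialize (Hw t); lra|exact Ht].
    + intros t _. unfold locally', within. destruct (Req_dec (wrap T t) 0) as [Ht|Ht].
      * destruct (HD2 0 ltac:(lra)) as [e0 H0]. destruct (HD2 T ltac:(lra)) as [e1 H1].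
        assert (L : locally t (fun s => Rabs (s - t) < Rmin e0 e1)).
        { assert (Hm : 0 < Rmin e0 e1) by (apply Rmin_glb_lt; apply cond_pos).
          exists (mkposreal _ Hm). intros s Hs. exact Hs. }
        generalize (filter_and _ _ (End t Ht) L). apply filter_imp.
        intros s [[Hs [W0 W1]] Hse] Hst.
        pose proof (Rmin_l e0 e1). pose proof (Rmin_r e0 e1).
        apply Rabs_lt_between in Hs. destruct (Rle_dec t s).
        -- rewrite W0 by lra. intros [Hd|Hd]; [|lra].
           apply (H0 (s - t)); [|lra|exact Hd].
           change (Rabs (s - t - 0) < e0). rewrite Rminus_0_r. lra.
        -- rewrite W1 by lra. intros [Hd|Hd]; [|lra].
           apply (H1 (s - t + T)); [|lra|exact Hd].
           change (Rabs (s - t + T - T) < e1). replace (s - t + T - T) with (s - t) by ring. lra.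
      * pose proof (Hw t). destruct (HD2 (wrap T t) ltac:(lra)) as [e0 H0].
        assert (L : locally t (fun s => Rabs (s - t) < Rmin e0 (wrap T t))).
        { assert (Hm : 0 < Rmin e0 (wrap T t)) by (apply Rmin_glb_lt; [apply cond_pos|lra]).
          exists (mkposreal _ Hm). intros s Hs. exact Hs. }
        generalize (filter_and _ _ (Int t Ht) L). apply filter_imp.
        intros s [Hs Hse] Hst.
        pose proof (Rmin_l e0 (wrap T t)). pose proof (Rmin_r e0 (wrap T t)).
        rewrite Hs. intros [Hd|Hd].
        -- apply (H0 (s - t + wrap T t)); [|lra|exact Hd].
           change (Rabs (s - t + wrap T t - wrap T t) < e0).
           replace (s - t + wrap T t - wrap T t) with (s - t) by ring. lra.
        -- apply Rabs_lt_between in Hse. lra.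
    + intros t _ HnD.
      assert (Ht : wrap T t <> 0) by tauto.
      pose proof (Hw t) as Hwt.
      assert (HJ : locally (wrap T t) (fun s => 0 <= s <= T)).
      { assert (Hm : 0 < Rmin (wrap T t) (T - wrap T t)) by (apply Rmin_glb_lt; lra).
        exists (mkposreal _ Hm). intros s Hs.
        change (Rabs (s - wrap T t) < Rmin (wrap T t) (T - wrap T t)) in Hs.
        pose proof (Rmin_l (wrap T t) (T - wrap T t)).
        pose proof (Rmin_r (wrap T t) (T - wrap T t)). apply Rabs_lt_between in Hs. lra. }
      destruct (HD3 (wrap T t) HJ) as [K1 K2]; [tauto|].
      assert (Sh : forall v : plane, is_derive x (wrap T t) v ->
                is_derive (fun s => x (wrap T s)) t v).
      { intros v Hv.
        apply (is_derive_ext_loc (fun s => x (s - t + wrap T t))).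
        - eapply filter_imp; [|exact (Int t Ht)]. intros s Hs. cbv beta. rewrite Hs. reflexivity.
        - rewrite <- (scal_one v). apply (is_derive_comp x (fun s => s - t + wrap T t)).
          + replace (t - t + wrap T t) with (wrap T t) by ring. exact Hv.
          + auto_derive; [trivial|reflexivity]. }
      split; [intros i Hi; apply Sh, K1, Hi|intros Ho; apply Sh, K2, Ho].
Qed.

Lemma fixed_point_periodic f lam p :
  first_return f lam p p ->
  exists gamma, nontrivial_periodic_orbit f lam gamma /\ gamma (p, 0).
Proof.
  intros [x [t1 [t2 [t3 [t4 [H01 [H12 [H23 [H34 [Sol [X0 H]]]]]]]]]]].
  destruct H as [_ [_ [_ [_ [_ [_ [_ [X4 Hp]]]]]]]].
  assert (HT : 0 < t4) by lra.
  assert (Hne : (p, 0) <> origin) by (intros E; injection E; lra).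
  exists (fun q => exists t, x (wrap t4 t) = q).
  assert (Hg : exists t, x (wrap t4 t) = (p, 0)).
  { exists 0. rewrite (wrap_eq t4 0 0) by lra. rewrite Rmult_0_r, Rminus_0_r. exact X0. }
  split; [split|exact Hg].
  - exists (fun t => x (wrap t4 t)), t4. split; [exact HT|split; [|split]].
    + apply periodic_extension; auto.
      * rewrite X0, X4. reflexivity.
      * rewrite X0. split; [exact Hne|right; reflexivity].
    + intros t. rewrite wrap_period by exact HT. reflexivity.
    + intros q. reflexivity.
  - intros Hall. apply Hne, Hall, Hg.
Qed.

(** * Fixed points of the return map *)

Lemma coef_zero r x0 p (psi : R -> R) C C0 :
  0 < r -> 0 < x0 ->
  (forall x, 0 < x < r -> Rabs (psi x) <= C) ->
  (forall x, 0 < x < r -> x < x0 -> Rabs (p + x * psi x) <= C0 * x) -> p = 0.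
Proof.
  intros Hr Hx0 B H. apply Rle_antisym.
  - cut (0 <= - p); [lra|].
    apply (coef_limit r x0 _ (fun x => - psi x + C0) (C + Rabs C0)); auto.
    + intros x Hx. eapply Rle_trans; [apply Rabs_triang|]. rewrite Rabs_Ropp.
      specialize (B x Hx). lra.
    + intros x Hx Hxx. specialize (H x Hx Hxx). apply Rabs_le_between in H. lra.
  - apply (coef_limit r x0 _ (fun x => psi x + C0) (C + Rabs C0)); auto.
    + intros x Hx. eapply Rle_trans; [apply Rabs_triang|]. specialize (B x Hx). lra.
    + intros x Hx Hxx. specialize (H x Hx Hxx). apply Rabs_le_between in H. lra.
Qed.

Lemma pow_S_le x m : 0 < x <= 1 -> 0 < x ^ S m <= x.
Proof.
  intros Hx. split; [apply pow_lt; lra|]. simpl.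
  assert (x ^ m <= 1) by (rewrite <- (pow1 m); apply pow_incr; lra).
  assert (0 < x ^ m) by (apply pow_lt; lra). nra.
Qed.

(** The bound O(x^m) may have constants depending on lam: it only serves to annihilate coefficients
    one lam at a time. The uniformity of the final remainder is that of the expansion. *)
Lemma taylor_vanish r m Om :
  0 < r -> taylor r (S m) Om ->
  (forall lam u, Rabs lam < r -> exists C x0, 0 < x0 /\
     forall x, 0 < x < r -> x < x0 -> Rabs (Om lam u x) <= C * x ^ m) ->
  exists q psi, tame r (fun lam u _ => q lam u) /\ tame r psi /\
    forall lam u x, dom r lam x -> Om lam u x = x ^ m * (q lam u + x * psi lam u x).
Proof.
  intros Hr. revert Om. induction m as [|m IH]; intros Om HT HB.
  - destruct HT as [p [psi [H1 [H2 H3]]]]. exists p, psi.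
    split; [exact H1|split; [exact H2|]]. intros. rewrite H3 by assumption. simpl. ring.
  - destruct HT as [p [psi [H1 [H2 H3]]]].
    destruct (taylor_tame _ _ _ H2) as [C1 [HC1 [B1 _]]].
    assert (Hp : forall lam u, Rabs lam < r -> p lam u = 0).
    { intros lam u Hl. destruct (HB lam u Hl) as [C [x0 [Hx0 B]]].
      apply (coef_zero r (Rmin x0 1) _ (fun x => psi lam u x) C1 (Rabs C)); auto.
      - apply Rmin_glb_lt; lra.
      - intros x Hx. apply B1. split; auto.
      - intros x Hx Hx1. pose proof (Rmin_l x0 1). pose proof (Rmin_r x0 1).
        specialize (B x Hx ltac:(lra)). rewrite H3 in B by (split; auto).
        eapply Rle_trans; [exact B|]. destruct (pow_S_le x m ltac:(lra)).
        pose proof (Rle_abs C). pose proof (Rabs_pos C).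
        apply Rle_trans with (Rabs C * x ^ S m); [apply Rmult_le_compat_r; lra|].
        apply Rmult_le_compat_l; lra. }
    destruct (IH psi H2) as [q [xi [Q1 [Q2 Q3]]]].
    { intros lam u Hl. destruct (HB lam u Hl) as [C [x0 [Hx0 B]]].
      exists C, x0. split; [exact Hx0|]. intros x Hx Hxx. specialize (B x Hx Hxx).
      rewrite H3, Hp, Rplus_0_l, Rabs_mult, Rabs_pos_eq in B; auto; [|lra|split; auto].
      simpl in B. apply (Rmult_le_reg_l x); [lra|]. lra. }
    exists q, xi. split; [exact Q1|split; [exact Q2|]].
    intros lam u x Hd. rewrite H3, Hp, Q3 by (auto; apply Hd). simpl. ring.
Qed.

(** A coefficient does not involve x, so the inequality can be read at the fixed value x = r/2,
    where the factor x is harmless. *)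
Lemma tame_coef_lipschitz r p :
  0 < r -> tame r (fun lam u _ => p lam u) ->
  exists C, 0 <= C /\ forall u lam mu, Rabs lam < r -> Rabs mu < r ->
    Rabs (p lam u - p mu u) <= C * Rabs (lam - mu).
Proof.
  intros Hr [C [HC [_ L]]]. exists C. split; [exact HC|].
  intros u lam mu Hl Hm.
  specialize (L lam u (r / 2) mu u (r / 2)). cbv beta in L.
  unfold gap in L. rewrite !Rminus_diag, Rabs_R0 in L.
  assert (L' := L ltac:(split; lra) ltac:(split; lra)).
  apply (Rmult_le_reg_l (r / 2)); lra.
Qed.

(* The remainder is only [o(x^k)] as [x] and [lam] tend to [0] jointly, so for fixed
   [lam <> 0] the coefficient [q lam] of [x^k] need not be [delta lam]. *)
Lemma return_normal_form s (pi : R -> R -> R) (Del delta : R -> R) (m : nat) :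
  0 < s -> smooth s (fun lam _ x => pi x lam / x) ->
  is_domin (within (fun p : R * R => 0 <= fst p) (locally (0, 0)))
       (fun p : R * R => fst p ^ S (S m))
       (fun p : R * R => pi (fst p) (snd p)
          - (Del (snd p) * fst p + delta (snd p) * fst p ^ S (S m))) ->
  exists r (q : R -> R) (psi : R -> R -> R) C, 0 < r <= s /\ 0 <= C /\ q 0 = delta 0 /\
    (forall lam mu, Rabs lam < r -> Rabs mu < r ->
       Rabs (Del lam - Del mu) <= C * Rabs (lam - mu) /\
       Rabs (q lam - q mu) <= C * Rabs (lam - mu)) /\
    (forall lam x, dom r lam x -> Rabs (psi lam x) <= C) /\
    (forall lam x mu y, dom r lam x -> dom r mu y ->
       x * Rabs (psi lam x - psi mu y) <= C * (Rabs (x - y) + x * Rabs (lam - mu))) /\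
    (forall lam x, dom r lam x ->
       pi x lam = x * (Del lam + x ^ S m * (q lam + x * psi lam x))).
Proof.
  intros Hs Spi Hdom.
  (* The assumed expansion divided by x, which is why the exponent drops to m + 1 = k - 1. *)
  assert (Hexp : forall eps, 0 < eps -> exists del, 0 < del /\ forall lam x,
     Rabs lam < del -> 0 < x < del ->
     Rabs (pi x lam / x - (Del lam + delta lam * x ^ S m)) <= eps * x ^ S m).
  { intros eps Heps. destruct (Hdom (mkposreal _ Heps)) as [del Hdel]. simpl in Hdel.
    exists del. split; [apply cond_pos|]. intros lam x Hl Hx.
    assert (Hball : ball ((0, 0) : R * R) del (x, lam)).
    { split; simpl; unfold ball; simpl; unfold AbsRing_ball, abs, minus, plus, opp; simpl;
        rewrite Ropp_0, Rplus_0_r; [rewrite Rabs_pos_eq; lra|exact Hl]. }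
    specialize (Hdel (x, lam) Hball ltac:(simpl; lra)). simpl in Hdel.
    unfold norm in Hdel; simpl in Hdel. unfold abs in Hdel; simpl in Hdel.
    change (x * (x * x ^ m)) with (x * x ^ S m) in Hdel.
    change (x * x ^ m) with (x ^ S m) in Hdel.
    pose proof (pow_lt x (S m) ltac:(lra)) as Hp.
    rewrite (Rabs_pos_eq (x * x ^ S m)) in Hdel by nra.
    apply (Rmult_le_reg_l x); [lra|].
    rewrite <- (Rabs_pos_eq x) at 1 by lra. rewrite <- Rabs_mult.
    replace (x * (pi x lam / x - (Del lam + delta lam * x ^ S m))) with
      (pi x lam - (Del lam * x + delta lam * (x * x ^ S m))) by (field; lra).
    lra. }
  (* With eps = 1 the expansion already gives pi/x - Delta = O(x^(m+1)) at each lam; this identifies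
     the constant term and annihilates the coefficients of orders 1 to m. *)
  destruct (Hexp 1 Rlt_0_1) as [d1 [Hd1 H1]].
  set (r := Rmin s d1).
  assert (Hr : 0 < r) by (apply Rmin_glb_lt; auto).
  assert (Hrs : r <= s) by apply Rmin_l. assert (Hrd : r <= d1) by apply Rmin_r.
  assert (HT : taylor r (S (S m)) (fun lam _ x => pi x lam / x)).
  { apply (taylor_le s); auto. }
  destruct HT as [p [Om [Tp [TOm EOm]]]].
  destruct (taylor_tame _ _ _ TOm) as [C1 [HC1 [B1 _]]].
  assert (Bnd : forall lam x, Rabs lam < r -> 0 < x < r ->
     Rabs (pi x lam / x - Del lam) <= (1 + Rabs (delta lam)) * x ^ S m).
  { intros lam x Hl Hx. specialize (H1 lam x ltac:(lra) ltac:(lra)).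
    pose proof (pow_lt x (S m) ltac:(lra)) as Hp.
    replace (pi x lam / x - Del lam) with
      ((pi x lam / x - (Del lam + delta lam * x ^ S m)) + delta lam * x ^ S m) by ring.
    eapply Rle_trans; [apply Rabs_triang|].
    rewrite (Rabs_mult (delta lam)), (Rabs_pos_eq (x ^ S m)) by lra. lra. }
  assert (Ep : forall lam u, Rabs lam < r -> p lam u = Del lam).
  { intros lam u Hl. cut (p lam u - Del lam = 0); [lra|].
    apply (coef_zero r 1 _ (fun x => Om lam u x) C1 (1 + Rabs (delta lam))); auto; try lra.
    - intros x Hx. apply B1. split; auto.
    - intros x Hx Hx1. specialize (Bnd lam x Hl Hx).
      rewrite (EOm lam u) in Bnd by (split; auto).
      replace (p lam u - Del lam + x * Om lam u x) with (p lam u + x * Om lam u x - Del lam)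
        by ring.
      eapply Rle_trans; [exact Bnd|]. destruct (pow_S_le x m ltac:(lra)).
      pose proof (Rabs_pos (delta lam)). apply Rmult_le_compat_l; lra. }
  destruct (taylor_vanish r m Om Hr TOm) as [q [psi [Tq [Tpsi Eq]]]].
  { intros lam u Hl. exists (1 + Rabs (delta lam)), 1. split; [lra|]. intros x Hx _.
    specialize (Bnd lam x Hl Hx). rewrite (EOm lam u), Ep in Bnd by (auto; split; auto).
    replace (Del lam + x * Om lam u x - Del lam) with (x * Om lam u x) in Bnd by ring.
    rewrite Rabs_mult, Rabs_pos_eq in Bnd by lra. simpl in Bnd.
    apply (Rmult_le_reg_l x); [lra|]. lra. }
  destruct (tame_coef_lipschitz r p Hr Tp) as [Cp [HCp Lp]].
  destruct (tame_coef_lipschitz r q Hr Tq) as [Cq [HCq Lq]].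
  destruct Tpsi as [C2 [HC2 [B2 L2]]].
  assert (EQ : forall lam x, dom r lam x ->
    pi x lam / x = Del lam + x ^ S m * (q lam 0 + x * psi lam 0 x)).
  { intros lam x Hd. rewrite (EOm lam 0 x Hd), (Eq lam 0 x Hd), Ep by apply Hd. simpl. ring. }
  exists r, (fun lam => q lam 0), (fun lam x => psi lam 0 x), (Cp + Cq + C2).
  split; [lra|split; [lra|split; [|split; [|split; [|split]]]]].
  - assert (H0 : Rabs 0 < r) by (rewrite Rabs_R0; exact Hr).
    (* At lam = 0 the small-o bound can be used with every eps while x tends to 0, which pins down q
       0. *)
    assert (Hm : forall eps, 0 < eps -> delta 0 - eps <= q 0 0 /\ - delta 0 - eps <= - q 0 0).
    { intros eps Heps. destruct (Hexp eps Heps) as [del [Hdel H]].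
      assert (Hx' : forall x, 0 < x < r -> x < del ->
                delta 0 - eps <= q 0 0 + x * psi 0 0 x <= delta 0 + eps).
      { intros x Hx Hxd. specialize (H 0 x ltac:(rewrite Rabs_R0; lra) ltac:(lra)).
        rewrite EQ in H by (split; auto). pose proof (pow_lt x (S m) ltac:(lra)) as Hp.
        apply Rabs_le_between in H.
        split; apply (Rmult_le_reg_l (x ^ S m)); lra. }
      split.
      - apply (coef_limit r del _ (fun x => psi 0 0 x) C2); auto.
        + intros x Hx. apply B2. split; auto.
        + intros x Hx Hxd. apply Hx'; auto.
      - apply (coef_limit r del _ (fun x => - psi 0 0 x) C2); auto.
        + intros x Hx. rewrite Rabs_Ropp. apply B2. split; auto.
        + intros x Hx Hxd. specialize (Hx' x Hx Hxd). lra. }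
    destruct (Rtotal_order (q 0 0) (delta 0)) as [Hlt|[|Hgt]]; auto.
    + specialize (Hm ((delta 0 - q 0 0) / 2) ltac:(lra)). lra.
    + specialize (Hm ((q 0 0 - delta 0) / 2) ltac:(lra)). lra.
  - intros lam mu Hl Hm. specialize (Lp 0 lam mu Hl Hm). specialize (Lq 0 lam mu Hl Hm).
    rewrite !Ep in Lp by auto. pose proof (Rabs_pos (lam - mu)).
    assert (0 <= Cp * Rabs (lam - mu)) by nra. assert (0 <= Cq * Rabs (lam - mu)) by nra.
    assert (0 <= C2 * Rabs (lam - mu)) by nra. lra.
  - intros lam x Hd. specialize (B2 lam 0 x Hd). lra.
  - intros lam x mu y Hd Hd'. specialize (L2 lam 0 x mu 0 y Hd Hd'). unfold gap in L2.
    rewrite (Rminus_diag 0), Rabs_R0, Rplus_0_r in L2.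
    assert (0 <= Rabs (x - y) + x * Rabs (lam - mu)).
    { pose proof (Rabs_pos (x - y)). pose proof (Rabs_pos (lam - mu)). destruct Hd. nra. }
    nra.
  - intros lam x Hd. rewrite <- EQ by exact Hd. destruct Hd. field. lra.
Qed.

(** x^(m+1) (q + x psi) increases in x, with increments comparable to x^m (x - y), so its equation
    with E has a solution by intermediate values. The lower comparison bounds (x - y)^(m+1) by the
    change of the data, which gives the modulus of continuity. *)
Lemma root_branch s m C (E q : R -> R) (psi : R -> R -> R) :
  0 < s -> 0 <= C -> E 0 = 0 -> 0 < q 0 ->
  (forall t, 0 < t < s -> 0 < E t) ->
  (forall t t', 0 <= t < s -> 0 <= t' < s ->
     Rabs (E t - E t') <= C * Rabs (t - t') /\ Rabs (q t - q t') <= C * Rabs (t - t')) ->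
  (forall t x, 0 <= t < s -> 0 < x < s -> Rabs (psi t x) <= C) ->
  (forall t x t' y, 0 <= t < s -> 0 < x < s -> 0 <= t' < s -> 0 < y < s ->
     x * Rabs (psi t x - psi t' y) <= C * (Rabs (x - y) + x * Rabs (t - t'))) ->
  exists tb (X : R -> R) K, 0 < tb <= s /\ 0 <= K /\ X 0 = 0 /\
    (forall t, 0 <= t < tb -> 0 <= X t < s) /\
    (forall t t', 0 <= t < tb -> 0 <= t' < tb -> Rabs (X t - X t') ^ S m <= K * Rabs (t - t')) /\
    (forall t, 0 < t < tb -> 0 < X t /\ X t ^ S m * (q t + X t * psi t (X t)) = E t).
Proof.
  intros Hs HC HE0 Hq0 HE HL HB HP.
  set (g := fun t x => x ^ S m * (q t + x * psi t x)).
  assert (Hg0 : forall t, g t 0 = 0) by (intros; unfold g; simpl; ring).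
  set (n := INR (S (S m))).
  assert (Hn : 1 <= n).
  { unfold n. rewrite S_INR. pose proof (pos_INR (S m)). lra. }
  (* Makes C (n + 1) x at most q(0)/4 up to x1: the term n C comes from the increment of x^(m+2),
     the other C from that of [psi]. *)
  set (x1 := Rmin (Rmin (s / 2) 1) (q 0 / (4 * (C + 1) * (n + 1)))).
  assert (Hcn : 0 < (C + 1) * (n + 1)) by (apply Rmult_lt_0_compat; lra).
  assert (Hx1 : 0 < x1).
  { unfold x1. repeat apply Rmin_glb_lt; try lra. apply Rdiv_lt_0_compat; lra. }
  assert (Hx1s : x1 <= s / 2) by (eapply Rle_trans; [apply Rmin_l|apply Rmin_l]).
  assert (Hx11 : x1 <= 1) by (eapply Rle_trans; [apply Rmin_l|apply Rmin_r]).
  assert (Hx1q : x1 * ((C + 1) * (n + 1)) <= q 0 / 4).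
  { replace (q 0 / 4) with (q 0 / (4 * (C + 1) * (n + 1)) * ((C + 1) * (n + 1)))
      by (field; lra).
    apply Rmult_le_compat_r; [lra|apply Rmin_r]. }
  assert (HxC : forall x, 0 <= x <= x1 -> C * (n + 1) * x <= q 0 / 4).
  { intros x Hx. eapply Rle_trans; [|exact Hx1q].
    apply Rle_trans with (C * (n + 1) * x1); [apply Rmult_le_compat_l; nra|].
    assert (0 <= (n + 1) * x1) by nra. lra. }
  (* Keeps q t between q(0)/2 and 2 q(0). *)
  set (t1 := Rmin s (q 0 / (2 * (C + 1)))).
  assert (Ht1 : 0 < t1) by (apply Rmin_glb_lt; [lra|apply Rdiv_lt_0_compat; lra]).
  assert (Ht1s : t1 <= s) by apply Rmin_l.
  assert (Hqt : forall t, 0 <= t < t1 -> q 0 / 2 <= q t <= 2 * q 0).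
  { intros t Ht. destruct (HL t 0 ltac:(lra) ltac:(lra)) as [_ Lq].
    rewrite Rminus_0_r, (Rabs_pos_eq t) in Lq by lra.
    assert (t * (C + 1) <= q 0 / 2).
    { replace (q 0 / 2) with (q 0 / (2 * (C + 1)) * (C + 1)) by (field; lra).
      apply Rmult_le_compat_r; [lra|]. pose proof (Rmin_r s (q 0 / (2 * (C + 1)))).
      unfold t1 in Ht. lra. }
    apply Rabs_le_between in Lq. nra. }
  assert (Pow : forall k x y, 0 <= y <= x -> 0 < x ->
            x ^ k * (x - y) <= x ^ S k - y ^ S k <= INR (S k) * x ^ k * (x - y)).
  { intros k x y Hy Hx. assert (0 <= y ^ k <= x ^ k) by (split; [apply pow_le|apply pow_incr]; lra).
    split.
    - simpl. nra.
    - pose proof (pow_lip x x y (S k) ltac:(lra) ltac:(rewrite Rabs_pos_eq; lra)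
        ltac:(rewrite Rabs_pos_eq; lra)) as P.
      assert (y ^ S k <= x ^ S k) by (apply pow_incr; lra).
      rewrite !Rabs_pos_eq in P by lra.
      apply (Rmult_le_reg_l x); [lra|]. simpl (x ^ S k) in P at 2. lra. }
  (* The lower constant is q(0)/2 from the leading term minus q(0)/4 from the perturbation; the
     upper one uses q t <= 2 q(0) and an increment of x^(m+1) at most n x^m (x - y). *)
  assert (Dec : forall t x y, 0 <= t < t1 -> 0 <= y < x -> x <= x1 ->
     (q 0 / 4) * (x ^ m * (x - y)) <= g t x - g t y
       <= (2 * n * q 0 + q 0 / 4) * (x ^ m * (x - y))).
  { intros t x y Ht Hy Hx. destruct (Hqt t Ht) as [Hqt1 Hqt2].
    assert (Hxm : 0 < x ^ m) by (apply pow_lt; lra).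
    specialize (HxC x ltac:(lra)).
    assert (Hz : 0 < x ^ m * (x - y)) by (apply Rmult_lt_0_compat; lra).
    destruct (Pow m x y ltac:(lra) ltac:(lra)) as [P1 P2].
    assert (HnS : INR (S m) <= n) by (unfold n; rewrite (S_INR (S m)); lra).
    assert (Main : Rabs (x ^ S (S m) * psi t x - y ^ S (S m) * psi t y)
              <= q 0 / 4 * (x ^ m * (x - y))).
    { apply Rle_trans with (C * (n + 1) * x * (x ^ m * (x - y)));
        [|apply Rmult_le_compat_r; lra].
      pose proof (HB t x ltac:(lra) ltac:(lra)) as Bx.
      destruct (Req_dec y 0) as [->|Hy0].
      - rewrite pow_i, Rmult_0_l, !Rminus_0_r by lia.
        rewrite Rabs_mult, Rabs_pos_eq by (apply pow_le; lra).
        replace (C * (n + 1) * x * (x ^ m * x)) with (x ^ S (S m) * (C * (n + 1)))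
          by (simpl; ring).
        apply Rmult_le_compat_l; [apply pow_le; lra|]. nra.
      - replace (x ^ S (S m) * psi t x - y ^ S (S m) * psi t y) with
          ((x ^ S (S m) - y ^ S (S m)) * psi t x + y ^ S m * (y * (psi t x - psi t y)))
          by (simpl; ring).
        eapply Rle_trans; [apply Rabs_triang|].
        destruct (Pow (S m) x y ltac:(lra) ltac:(lra)) as [Q1 Q2]. fold n in Q2.
        assert (Hxm1 : 0 < x ^ S m) by (apply pow_lt; lra).
        assert (Hym : 0 <= y ^ S m <= x ^ S m) by (split; [apply pow_le|apply pow_incr]; lra).
        rewrite !Rabs_mult, (Rabs_pos_eq y), (Rabs_pos_eq (y ^ S m)) by lra.
        rewrite (Rabs_pos_eq (x ^ S (S m) - y ^ S (S m))) by nra.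
        pose proof (HP t y t x ltac:(lra) ltac:(lra) ltac:(lra) ltac:(lra)) as HPt.
        rewrite Rminus_diag, Rabs_R0, Rmult_0_r, Rplus_0_r, (Rabs_minus_sym (psi t y)),
          (Rabs_minus_sym y), (Rabs_pos_eq (x - y)) in HPt by lra.
        assert ((x ^ S (S m) - y ^ S (S m)) * Rabs (psi t x) <= n * x ^ S m * (x - y) * C).
        { apply Rmult_le_compat; auto using Rabs_pos. nra. }
        assert (y ^ S m * (y * Rabs (psi t x - psi t y)) <= x ^ S m * (C * (x - y))).
        { apply Rmult_le_compat; auto; try lra.
          apply Rmult_le_pos; [lra|apply Rabs_pos]. }
        replace (C * (n + 1) * x * (x ^ m * (x - y))) with
          (n * x ^ S m * (x - y) * C + x ^ S m * (C * (x - y))) by (simpl; ring).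
        lra. }
    replace (g t x - g t y) with ((x ^ S m - y ^ S m) * q t
      + (x ^ S (S m) * psi t x - y ^ S (S m) * psi t y)) by (unfold g; simpl; ring).
    apply Rabs_le_between in Main.
    assert (x ^ m * (x - y) * (q 0 / 2) <= (x ^ S m - y ^ S m) * q t)
      by (apply Rmult_le_compat; lra).
    assert ((x ^ S m - y ^ S m) * q t <= n * (x ^ m * (x - y)) * (2 * q 0)).
    { apply Rmult_le_compat; try lra. nra. }
    lra. }
  assert (Lt : forall t t' x, 0 <= t < t1 -> 0 <= t' < t1 -> 0 <= x <= x1 ->
     Rabs (g t x - g t' x) <= 2 * C * Rabs (t - t')).
  { intros t t' x Ht Ht' Hx. pose proof (Rabs_pos (t - t')) as Htt.
    destruct (Req_dec x 0) as [->|Hx0]; [rewrite !Hg0, Rminus_diag, Rabs_R0; nra|].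
    destruct (HL t t' ltac:(lra) ltac:(lra)) as [_ Lq].
    pose proof (HP t x t' x ltac:(lra) ltac:(lra) ltac:(lra) ltac:(lra)) as HPt.
    rewrite Rminus_diag, Rabs_R0, Rplus_0_l in HPt.
    replace (g t x - g t' x) with
      (x ^ S m * ((q t - q t') + x * (psi t x - psi t' x))) by (unfold g; ring).
    rewrite Rabs_mult, Rabs_pos_eq by (apply pow_le; lra).
    destruct (pow_S_le x m ltac:(lra)).
    assert (Rabs (q t - q t' + x * (psi t x - psi t' x)) <= 2 * C * Rabs (t - t')).
    { eapply Rle_trans; [apply Rabs_triang|]. rewrite (Rabs_mult x), (Rabs_pos_eq x) by lra.
      assert (C * (x * Rabs (t - t')) <= C * Rabs (t - t'))
        by (apply Rmult_le_compat_l; nra). lra. }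
    pose proof (Rabs_pos (q t - q t' + x * (psi t x - psi t' x))). nra. }
  (* A lower bound for the left-hand side at x1; for t < [tb] the value E t stays below it, so a
     root exists in [0, x1]. *)
  set (e1 := q 0 / 4 * (x1 ^ m * x1)).
  assert (He1 : 0 < e1).
  { apply Rmult_lt_0_compat; [lra|]. apply Rmult_lt_0_compat; [apply pow_lt|]; lra. }
  set (tb := Rmin t1 (e1 / (C + 1))).
  assert (Htb : 0 < tb) by (apply Rmin_glb_lt; [lra|apply Rdiv_lt_0_compat; lra]).
  assert (Htb1 : tb <= t1) by apply Rmin_l.
  assert (Ex : forall t, 0 <= t < tb -> exists x, 0 <= x <= x1 /\ g t x = E t).
  { intros t Ht. destruct (Req_dec t 0) as [->|Ht0].
    { exists 0. split; [lra|]. rewrite Hg0. auto. }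
    (* Frozen outside [0, x1], since the intermediate value theorem used here asks for continuity on
       the whole line. *)
    set (h := fun x => g t (clip 0 x1 x)).
    set (L := 2 * n * q 0 + q 0 / 4).
    assert (HL0 : 0 <= L) by (unfold L; nra).
    assert (W : forall x y, 0 <= y <= x -> x <= x1 -> Rabs (g t x - g t y) <= L * (x - y)).
    { intros x y Hy Hx. destruct (Req_dec x y) as [->|Hxy];
        [rewrite !Rminus_diag, Rabs_R0; lra|].
      destruct (Dec t x y ltac:(lra) ltac:(lra) Hx) as [D1 D2]. fold L in D2.
      assert (0 < x ^ m <= 1).
      { split; [apply pow_lt; lra|]. rewrite <- (pow1 m). apply pow_incr. lra. }
      assert (0 <= x ^ m * (x - y) <= x - y) by nra.
      rewrite Rabs_pos_eq by nra. eapply Rle_trans; [exact D2|].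
      apply Rmult_le_compat_l; lra. }
    destruct (IVT_gen h 0 x1 (E t)) as [x [Hx1' Hx2]].
    - intros x. apply continuity_pt_filterlim. apply (lipschitz_continuous h L).
      intros u v. unfold h.
      pose proof (clip_range 0 x1 u ltac:(lra)). pose proof (clip_range 0 x1 v ltac:(lra)).
      apply Rle_trans with (L * Rabs (clip 0 x1 u - clip 0 x1 v)).
      + destruct (Rle_dec (clip 0 x1 u) (clip 0 x1 v)).
        * rewrite Rabs_minus_sym, (Rabs_minus_sym (clip 0 x1 u)),
            (Rabs_pos_eq (clip 0 x1 v - _)) by lra. apply W; lra.
        * rewrite (Rabs_pos_eq (clip 0 x1 u - _)) by lra. apply W; lra.
      + apply Rmult_le_compat_l; [exact HL0|].
        unfold clip, Rmax, Rmin, Rabs. repeat destruct Rle_dec; repeat destruct Rcase_abs; lra.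
    - unfold h. rewrite !clip_id by lra. rewrite Hg0.
      destruct (Dec t x1 0 ltac:(lra) ltac:(lra) ltac:(lra)) as [D1 _].
      rewrite Hg0, !Rminus_0_r in D1. fold e1 in D1.
      destruct (HL t 0 ltac:(lra) ltac:(lra)) as [LE _].
      rewrite HE0, !Rminus_0_r, (Rabs_pos_eq t) in LE by lra.
      assert (t * (C + 1) <= e1).
      { replace e1 with (e1 / (C + 1) * (C + 1)) by (field; lra).
        apply Rmult_le_compat_r; [lra|]. pose proof (Rmin_r t1 (e1 / (C + 1))).
        unfold tb in Ht. lra. }
      pose proof (HE t ltac:(lra)). pose proof (Rle_abs (E t)).
      rewrite Rmin_left, Rmax_right by lra. nra.
    - rewrite Rmin_left, Rmax_right in Hx1' by lra.
      exists x. split; [exact Hx1'|]. unfold h in Hx2. rewrite clip_id in Hx2 by lra. exact Hx2. }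
  set (X := fun t => epsilon (inhabits 0) (fun x => 0 <= x <= x1 /\ g t x = E t)).
  assert (HX : forall t, 0 <= t < tb -> 0 <= X t <= x1 /\ g t (X t) = E t).
  { intros t Ht. apply epsilon_spec. apply Ex, Ht. }
  (* E varies by C |t - t'| and the left-hand side, at fixed x, by 2C |t - t'|; dividing 3C by the
     slope constant q(0)/4 gives 12 C / q(0). *)
  assert (Hold : forall t t', 0 <= t < tb -> 0 <= t' < tb -> X t' <= X t ->
     Rabs (X t - X t') ^ S m <= 12 * C / q 0 * Rabs (t - t')).
  { intros t t' Ht Ht' Hle. destruct (HX t Ht) as [A1 A2]. destruct (HX t' Ht') as [A3 A4].
    assert (Hrhs : 0 <= 12 * C / q 0 * Rabs (t - t')).
    { apply Rmult_le_pos; [|apply Rabs_pos].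
      apply Rmult_le_pos; [lra|left; apply Rinv_0_lt_compat; lra]. }
    destruct (Req_dec (X t) (X t')) as [Heq|Hne].
    { rewrite Heq, Rminus_diag, Rabs_R0, pow_i by lia. exact Hrhs. }
    rewrite Rabs_pos_eq by lra.
    destruct (Dec t (X t) (X t') ltac:(lra) ltac:(lra) ltac:(lra)) as [D1 _].
    pose proof (Lt t t' (X t') ltac:(lra) ltac:(lra) A3) as L1.
    destruct (HL t t' ltac:(lra) ltac:(lra)) as [LE _].
    apply Rabs_le_between in L1. apply Rabs_le_between in LE.
    assert ((X t - X t') ^ S m <= X t ^ m * (X t - X t')).
    { simpl. rewrite Rmult_comm. apply Rmult_le_compat_r; [lra|]. apply pow_incr. lra. }
    assert (q 0 / 4 * (X t ^ m * (X t - X t')) <= 3 * C * Rabs (t - t')) by lra.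
    apply (Rmult_le_reg_l (q 0 / 4)); [lra|].
    replace (q 0 / 4 * (12 * C / q 0 * Rabs (t - t'))) with (3 * C * Rabs (t - t'))
      by (field; lra).
    eapply Rle_trans; [|eassumption]. apply Rmult_le_compat_l; lra. }
  assert (X0 : X 0 = 0).
  { destruct (HX 0 ltac:(lra)) as [A1 A2]. rewrite HE0 in A2.
    destruct (Req_dec (X 0) 0) as [|Hne]; [assumption|].
    destruct (Dec 0 (X 0) 0 ltac:(lra) ltac:(lra) ltac:(lra)) as [D1 _].
    rewrite A2, Hg0, !Rminus_0_r in D1.
    assert (0 < q 0 / 4 * (X 0 ^ m * X 0)); [|lra].
    apply Rmult_lt_0_compat; [lra|]. apply Rmult_lt_0_compat; [apply pow_lt|]; lra. }
  exists tb, X, (12 * C / q 0).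
  split; [lra|split; [|split; [exact X0|split; [|split]]]].
  - apply Rmult_le_pos; [lra|left; apply Rinv_0_lt_compat; lra].
  - intros t Ht. destruct (HX t Ht). lra.
  - intros t t' Ht Ht'. destruct (Rle_dec (X t') (X t)); [apply Hold; auto|].
    rewrite Rabs_minus_sym, (Rabs_minus_sym t). apply Hold; auto; lra.
  - intros t Ht. destruct (HX t ltac:(lra)) as [A1 A2]. split; [|exact A2].
    destruct (Req_dec (X t) 0) as [E0|]; [|lra]. rewrite E0, Hg0 in A2.
    pose proof (HE t ltac:(lra)). lra.
Qed.

Lemma Delta_derivable a b c :
  0 < b 0 -> 0 < c 0 -> ex_derive b 0 -> ex_derive c 0 -> ex_derive (Delta a b c) 0.
Proof.
  intros Hb Hc Db Dc. unfold Delta. auto_derive.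
  assert (0 < b 0 * c 0) by (apply Rmult_lt_0_compat; assumption).
  repeat split; auto; try lra.
  apply Rgt_not_eq, sqrt_lt_R0. assumption.
Qed.

Lemma derive_sign (f : R -> R) d :
  is_derive f 0 d -> 0 < d ->
  exists eta, 0 < eta /\ forall h, 0 < Rabs h < eta -> 0 < h * (f h - f 0).
Proof.
  intros H Hd. apply is_derive_Reals in H.
  destruct (H (d / 2) ltac:(lra)) as [eta Heta].
  exists eta. split; [apply cond_pos|]. intros h [Hh1 Hh2].
  assert (Hh : h <> 0) by (intros ->; rewrite Rabs_R0 in Hh1; lra).
  specialize (Heta h Hh Hh2). rewrite Rplus_0_l in Heta. apply Rabs_lt_between in Heta.
  replace (h * (f h - f 0)) with (h * h * ((f h - f 0) / h)) by (field; exact Hh).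
  apply Rmult_lt_0_compat; [|lra].
  destruct (Rdichotomy _ _ Hh); nra.
Qed.

Lemma holder_continuous_on (J : R -> Prop) (X : R -> R) m K :
  0 <= K ->
  (forall t t', J t -> J t' -> Rabs (X t - X t') ^ S m <= K * Rabs (t - t')) ->
  continuous_on J X.
Proof.
  intros HK HX t Ht P [eps HP].
  pose proof (pow_lt eps (S m) (cond_pos eps)) as He.
  assert (Hd : 0 < eps ^ S m / (K + 1)) by (apply Rdiv_lt_0_compat; lra).
  exists (mkposreal _ Hd). intros t' Ht' HJ. apply HP.
  change (Rabs (X t' - X t) < eps). change (Rabs (t' - t) < eps ^ S m / (K + 1)) in Ht'.
  apply Rnot_le_lt. intros Hle.
  assert (eps ^ S m <= Rabs (X t' - X t) ^ S m).
  { apply pow_incr. split; [left; apply cond_pos|exact Hle]. }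
  specialize (HX t' t HJ Ht). pose proof (Rabs_pos (t' - t)).
  assert ((K + 1) * Rabs (t' - t) < eps ^ S m).
  { replace (eps ^ S m) with ((K + 1) * (eps ^ S m / (K + 1))) by (field; lra).
    apply Rmult_lt_compat_l; lra. }
  lra.
Qed.

(* The two cases of the theorem correspond to [sg = 1] and [sg = -1]; after
   multiplying by the sign of [delta 0], the equation to be solved is
   [x^(m+1) (q + x psi) = 1 - Delta] with [q > 0] and a positive right-hand side. *)
Lemma periodic_branch f pi (Del delta : R -> R) m s sg :
  sg = 1 \/ sg = -1 ->
  0 < s ->
  (forall lam x, dom s lam x -> first_return f lam x (pi x lam)) ->
  smooth s (fun lam _ x => pi x lam / x) ->
  is_domin (within (fun p : R * R => 0 <= fst p) (locally (0, 0)))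
       (fun p : R * R => fst p ^ S (S m))
       (fun p : R * R => pi (fst p) (snd p)
          - (Del (snd p) * fst p + delta (snd p) * fst p ^ S (S m))) ->
  Del 0 = 1 -> ex_derive Del 0 -> delta 0 * Derive Del 0 * sg < 0 ->
  exists tb (X : R -> R) K, 0 < tb <= s /\ 0 <= K /\ X 0 = 0 /\
    (forall t, 0 <= t < tb -> 0 <= X t) /\
    (forall t t', 0 <= t < tb -> 0 <= t' < tb -> Rabs (X t - X t') ^ S m <= K * Rabs (t - t')) /\
    (forall t, 0 < t < tb -> 0 < X t /\
       exists gamma, nontrivial_periodic_orbit f (sg * t) gamma /\ gamma (X t, 0)).
Proof.
  intros Hsg Hs HFR Spi Hdom H1 HD Hneg.
  destruct (return_normal_form s pi Del delta m Hs Spi Hdom)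
    as [r [q [psi [C [Hr [HC [Hq0 [HL [HB [HP Hpi]]]]]]]]]].
  set (s2 := if Rlt_dec 0 (delta 0) then 1 else -1).
  assert (Hdne : delta 0 <> 0) by (intros E; rewrite E in Hneg; lra).
  assert (Hs2 : 0 < s2 * delta 0) by (unfold s2; destruct Rlt_dec; lra).
  assert (Hs2' : s2 = 1 \/ s2 = -1) by (unfold s2; destruct Rlt_dec; auto).
  assert (Hs22 : s2 * s2 = 1) by (destruct Hs2' as [-> | ->]; ring).
  assert (Abs : forall e z, e = 1 \/ e = -1 -> Rabs (e * z) = Rabs z).
  { intros e z [-> | ->]; [f_equal; ring|]. rewrite <- Rabs_Ropp. f_equal. ring. }
  (* The sign hypothesis times s2 delta(0) > 0 is delta(0)^2 times this quantity. It is the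
     derivative at 0 of s2 (1 - Delta(sg t)), which is therefore positive for small t > 0. *)
  assert (Hd0 : 0 < - (s2 * sg * Derive Del 0)).
  { assert (0 < - (delta 0 * Derive Del 0 * sg) * (s2 * delta 0))
      by (apply Rmult_lt_0_compat; lra).
    assert (0 < delta 0 * delta 0) by (destruct (Rdichotomy _ _ Hdne); nra).
    apply (Rmult_lt_reg_l (delta 0 * delta 0)); [assumption|]. lra. }
  destruct (derive_sign (fun t => s2 * (1 - Del (sg * t))) (- (s2 * sg * Derive Del 0)))
    as [eta [Heta Hpos]]; auto.
  { auto_derive.
    - rewrite Rmult_0_r. exact HD.
    - rewrite Rmult_0_r. replace (fun x : R => Del x) with Del by reflexivity. ring. }
  set (s' := Rmin r eta).
  assert (Hs' : 0 < s') by (apply Rmin_glb_lt; lra).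
  assert (Hs'r : s' <= r) by apply Rmin_l. assert (Hs'e : s' <= eta) by apply Rmin_r.
  assert (Lam : forall t, 0 <= t < s' -> Rabs (sg * t) < r).
  { intros t Ht. rewrite Abs, Rabs_pos_eq by (auto; lra). lra. }
  destruct (root_branch s' m C (fun t => s2 * (1 - Del (sg * t))) (fun t => s2 * q (sg * t))
    (fun t x => s2 * psi (sg * t) x)) as [tb [X [K [Htb [HK [X0 [XB [XH XE]]]]]]]]; auto.
  - rewrite Rmult_0_r, H1. ring.
  - rewrite Rmult_0_r, Hq0. exact Hs2.
  - intros t Ht. specialize (Hpos t). rewrite (Rabs_pos_eq t) in Hpos by lra.
    specialize (Hpos ltac:(lra)). cbv beta in Hpos. rewrite Rmult_0_r, H1 in Hpos. nra.
  - intros t t' Ht Ht'. destruct (HL (sg * t) (sg * t') (Lam t Ht) (Lam t' Ht')) as [L1 L2].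
    rewrite <- Rmult_minus_distr_l, Abs in L1, L2 by auto.
    rewrite <- !Rmult_minus_distr_l, !Abs by auto. split; [|exact L2].
    rewrite Rabs_minus_sym.
    replace (1 - Del (sg * t') - (1 - Del (sg * t))) with (Del (sg * t) - Del (sg * t')) by ring.
    exact L1.
  - intros t x Ht Hx. rewrite Abs by auto. apply HB. split; [apply Lam; auto|lra].
  - intros t x t' y Ht Hx Ht' Hy. rewrite <- Rmult_minus_distr_l, Abs by auto.
    specialize (HP (sg * t) x (sg * t') y).
    rewrite <- Rmult_minus_distr_l, Abs in HP by auto.
    apply HP; split; try (apply Lam; auto); lra.
  - exists tb, X, K. split; [lra|split; [exact HK|split; [exact X0|split; [|split]]]].
    + intros t Ht. apply XB, Ht.
    + exact XH.
    + intros t Ht. destruct (XE t Ht) as [Xp Xe]. split; [exact Xp|].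
      apply fixed_point_periodic.
      assert (Hd : dom r (sg * t) (X t)).
      { split; [apply Lam; lra|]. destruct (XB t ltac:(lra)). lra. }
      assert (E : pi (X t) (sg * t) = X t).
      { rewrite (Hpi _ _ Hd).
        assert (X t ^ S m * (q (sg * t) + X t * psi (sg * t) (X t)) = 1 - Del (sg * t)).
        { apply (Rmult_eq_reg_l s2); [|lra]. rewrite <- Xe. ring. }
        rewrite H. ring. }
      rewrite <- E at 2. apply HFR. eapply dom_le; [|exact Hd]. lra.
Qed.

Theorem theorem3p2
  (l u : Rbar) (Hl : Rbar_lt l 0) (Hu : Rbar_lt 0 u)
  (a : R) (Ha : 0 < a)
  (b c : R -> R)
  (Hb_smooth : smooth_on (open_interval l u) b)
  (Hc_smooth : smooth_on (open_interval l u) c)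
  (Hb_pos : forall lam, open_interval l u lam -> 0 < b lam)
  (Hc_pos : forall lam, open_interval l u lam -> 0 < c lam)
  (fbar : mode -> plane -> R -> plane)
  (Hfbar_analytic : forall i, analytic_field_on (open_interval l u) (fbar i))
  (Hfbar_small : forall i lam, open_interval l u lam ->
     is_domin (locally origin) (fun x : plane => x)
       (fun x : plane => fbar i x lam))
  (HDelta : Delta a b c 0 = 1)
  (HdDelta : Derive (Delta a b c) 0 <> 0)
  (pi : R -> R -> R)
  (Hpi : is_poincare_map (subsystem a b c fbar) (open_interval l u) pi)
  (delta : R -> R) (k : nat) (Hk : (1 < k)%nat) (Hdelta : delta 0 <> 0)
  (Hpi_expansion :
     is_domin (within (fun p : R * R => 0 <= fst p) (locally (0, 0)))
       (fun p : R * R => fst p ^ k)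
       (fun p : R * R => pi (fst p) (snd p)
          - (Delta a b c (snd p) * fst p + delta (snd p) * fst p ^ k))) :
  (delta 0 * Derive (Delta a b c) 0 < 0 ->
   exists (lambar : R) (x1 : R -> R),
     0 < lambar /\
     (forall lam, 0 <= lam < lambar -> open_interval l u lam /\ 0 <= x1 lam) /\
     continuous_on (fun lam : R => 0 <= lam < lambar) x1 /\
     x1 0 = 0 /\
     forall lam, 0 < lam < lambar ->
       0 < x1 lam /\
       exists gamma : plane -> Prop,
         nontrivial_periodic_orbit (subsystem a b c fbar) lam gamma /\
         gamma (x1 lam, 0)) /\
  (0 < delta 0 * Derive (Delta a b c) 0 ->
   exists (lamhat : R) (x1 : R -> R),
     0 < lamhat /\
     (forall lam, - lamhat < lam <= 0 -> open_interval l u lam /\ 0 <= x1 lam) /\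
     continuous_on (fun lam : R => - lamhat < lam <= 0) x1 /\
     x1 0 = 0 /\
     forall lam, - lamhat < lam < 0 ->
       0 < x1 lam /\
       exists gamma : plane -> Prop,
         nontrivial_periodic_orbit (subsystem a b c fbar) lam gamma /\
         gamma (x1 lam, 0)).
Proof.
  destruct (return_factor l u a b c fbar pi Hl Hu Hb_smooth Hc_smooth Hb_pos Hc_pos
    Hfbar_analytic Hfbar_small Hpi) as [s [Hs [HI [HFR Spi]]]].
  assert (I0 : open_interval l u 0) by (apply HI; rewrite Rabs_R0; exact Hs).
  assert (HD : ex_derive (Delta a b c) 0).
  { apply Delta_derivable; auto.
    - exact (Hb_smooth 1%nat 0 I0).
    - exact (Hc_smooth 1%nat 0 I0). }
  (* k = m + 2, so the equation for the fixed points has the positive exponent m + 1. *)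
  destruct k as [|[|m]]; [lia|lia|].
  pose proof (fun sg H => periodic_branch (subsystem a b c fbar) pi (Delta a b c) delta m s sg
    H Hs HFR Spi Hpi_expansion HDelta HD) as Branch.
  split; intros Hsign.
  - destruct (Branch 1) as [tb [X [K [Htb [HK [X0 [XB [XH XE]]]]]]]]; [auto|lra|].
    exists tb, X. split; [lra|split; [|split; [|split; [exact X0|]]]].
    + intros lam Hlam. split; [|apply XB, Hlam]. apply HI. rewrite Rabs_pos_eq; lra.
    + apply (holder_continuous_on _ X m K HK). exact XH.
    + intros lam Hlam. destruct (XE lam Hlam) as [Xp Xg].
      rewrite Rmult_1_l in Xg. split; assumption.
  - destruct (Branch (-1)) as [tb [X [K [Htb [HK [X0 [XB [XH XE]]]]]]]]; [auto|lra|].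
    (* The branch was built in t = -lam > 0; reflection preserves the modulus of continuity. *)
    exists tb, (fun lam => X (- lam)).
    split; [lra|split; [|split; [|split; [rewrite Ropp_0; exact X0|]]]].
    + intros lam Hlam. split; [|apply XB; lra]. apply HI. rewrite Rabs_left1; lra.
    + apply (holder_continuous_on _ (fun lam => X (- lam)) m K HK).
      intros t t' Ht Ht'. eapply Rle_trans; [apply XH; lra|].
      replace (- t - - t') with (- (t - t')) by ring. rewrite Rabs_Ropp. apply Rle_refl.
    + intros lam Hlam. destruct (XE (- lam) ltac:(lra)) as [Xp Xg].
      replace (-1 * - lam) with lam in Xg by ring. split; assumption.
Qed.
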